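(* Let $n\ge 2$ and $\kappa\ge 1$ be integers, let $D$ be a periodic skew diagram of degree $n$ and period $(m,-l)$ with $m+l=\kappa$, and let $L_D$ be the semisimple irreducible module for the degenerate double affine Hecke algebra $\ddot H_n(\kappa)$ associated to $D$. Then $L_D$ can be realised as a submodule of a Verma module (that is, there exist a character $\tau$ of $\mathbb{C}[u_1,\dots,u_n]$ and an injective $\ddot H_n(\kappa)$-module homomorphism $L_D\hookrightarrow M_\tau$) if and only if $\kappa=1$, or $\kappa\ge 2$ and the diagram $D$ has no infinite column.
   Context: **Group.** For $n\ge2$, $\dot W_n$ is the group generated by $s_1,\dots,s_{n-1},x_1^{\pm1},\dots,x_n^{\pm1}$ with relations $s_i^2=1$, $s_is_{i+1}s_i=s_{i+1}s_is_{i+1}$, $s_is_j=s_js_i$ ($|i-j|\ne1$), $x_ix_j=x_jx_i$, $s_ix_i=x_{i+1}s_i$, $s_ix_j=x_js_i$ ($j\ne i,i+1$). The $s_1,\dots,s_{n-1}$ generate the symmetric group $W_n$, and $s_{ij}\in W_n$ is the transposition of $i,j$. Put $s_0=x_1x_n^{-1}s_{1n}$ and $\pi=x_1s_1s_2\cdots s_{n-1}$. **Algebra.** For integers $n\ge2,\kappa\ge1$, $\ddot H_n(\kappa)$ is the unital associative $\mathbb{C}$-algebra which is $\mathbb{C}[\dot W_n]\otimes\mathbb{C}[u_1,\dots,u_n]$ as a vector space, in which the natural inclusions of $\mathbb{C}[\dot W_n]$ and $\mathbb{C}[u_1,\dots,u_n]$ are algebra homomorphisms, with the relations: $s_iu_i=u_{i+1}s_i-1$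 ($1\le i\le n-1$); $s_0u_n=(u_1-\kappa)s_0-1$; $s_iu_j=u_js_i$ ($j\not\equiv i,i+1 \bmod n$); $\pi u_i\pi^{-1}=u_{i+1}$ ($1\le i\le n-1$); $\pi u_n\pi^{-1}=u_1-\kappa$. **Diagrams.** Let $n,m,l$ be integers, $n\ge2$, $1\le m\le n$. A periodic skew diagram of degree $n$ and period $(m,-l)$ is a set $D\subseteq\mathbb{Z}^2$ (points $(a,b)$ are boxes, $a$ = row, $b$ = column) such that: (i) for each $a\in\mathbb{Z}$ there are integers $\mu_a\le\lambda_a$ with $\{b:(a,b)\in D\}=\{\mu_a,\mu_a+1,\dots,\lambda_a\}$; (ii) $\sum_{a=1}^m(\lambda_a-\mu_a+1)=n$; (iii) $D+\mathbb{Z}\cdot(m,-l)=D$; (iv') $\mu_{a+1}\le\mu_a$ and $\lambda_{a+1}\le\lambda_a$ for all $a$. $D$ has an infinite column if there is $b\in\mathbb{Z}$ such that $(a,b)\in D$ for infinitely many $a\in\mathbb{Z}$. **Row reading tableau and character.** The row reading tableau is the bijection $T_0:D\to\mathbb{Z}$ with $T_0((a,b)+k(m,-l))=T_0(a,b)+kn$ and $T_0(a,b)=\sum_{i=1}^{a-1}(\lambda_i-\mu_i+1)+b-\mu_a+1$ for $1\le a\le m$. If $i=T_0(a,b)$, set $C_{T_0}(i)=b-a$. The character $\chi_D$ of $\mathbb{C}[u_1,\dots,u_n]$ is given by $\chi_D(u_i)=C_{T_0}(i)$. **Modules.** For a character $\chi$ of $\mathbb{C}[u_1,\dots,u_n]$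 with one-dimensional module $\mathbb{C}_\chi=\mathbb{C}\mathbf 1_\chi$, the Verma module is $M_\chi=\mathrm{Ind}_{\mathbb{C}[u_1,\dots,u_n]}^{\ddot H_n(\kappa)}\mathbb{C}_\chi$; $M_D=M_{\chi_D}$, $\mathbf 1_D=\mathbf 1_{\chi_D}$. Let $I$ be the set of $i\in\{1,\dots,n\}$ such that $i$ and $i+1$ are in the same row of $T_0$. The small Verma module $N_D$ is the quotient of $M_D$ by the submodule generated by $(s_i-1)\mathbf 1_D$, $i\in I$. By known results, $N_D$ has a unique simple quotient, denoted $L_D$, and for a periodic skew diagram $D$ the module $L_D$ is semisimple, i.e. $u_1,\dots,u_n$ act on it diagonalizably. *)

(* Defs.v *)
From HB Require Import structures.
From mathcomp Require Import all_boot all_order all_algebra ring_quotient.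
From mathcomp Require Import finmap mpoly complex zify.
From mathcomp Require Import boolp classical_sets cardinality reals.

Set Implicit Arguments.
Unset Strict Implicit.
Unset Printing Implicit Defensive.

Import Order.TTheory GRing.Theory Num.Theory.
Local Open Scope ring_scope.
Local Open Scope quotient_scope.

(* Groups presented by generators and relations: words in the letters
   [(g, false) = g] and [(g, true) = g^-1], modulo the smallest congruence
   containing the relations. *)
Section PresentedGroup.
Variables (G : choiceType) (rel : seq (G * bool) -> seq (G * bool) -> Prop).

Notation word := (seq (G * bool)).

Inductive pres_cong : word -> word -> Prop :=
| pres_refl v : pres_cong v v
| pres_sym v w : pres_cong v w -> pres_cong w v
| pres_trans v w z : pres_cong v w -> pres_cong w z -> pres_cong v z
| pres_cat v v' w w' :
    pres_cong v v' -> pres_cong w w' -> pres_cong (v ++ w) (v' ++ w')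
| pres_cancel g b : pres_cong [:: (g, b); (g, ~~ b)] [::]
| pres_rel v w : rel v w -> pres_cong v w.

Definition word_inv (w : word) : word := rev [seq (p.1, ~~ p.2) | p <- w].

Lemma word_invK : involutive word_inv.
Proof.
move=> w; rewrite /word_inv map_rev revK -map_comp map_id_in // => -[g b] _ /=.
by rewrite negbK.
Qed.

Lemma pres_mulVw w : pres_cong (word_inv w ++ w) [::].
Proof.
elim: w => [|[g b] w IHw]; first exact: pres_refl.
rewrite /word_inv /= rev_cons -/(word_inv w) cat_rcons.
apply: pres_trans IHw; apply: pres_cat; first exact: pres_refl.
rewrite -[X in pres_cong _ X]cat0s.
apply: (@pres_cat [:: (g, ~~ b); (g, b)] _ w); last exact: pres_refl.
by rewrite -{2}[b]negbK; apply: pres_cancel.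
Qed.

Lemma pres_mulwV w : pres_cong (w ++ word_inv w) [::].
Proof. by rewrite -{1}[w]word_invK; apply: pres_mulVw. Qed.

Lemma pres_inv v w : pres_cong v w -> pres_cong (word_inv v) (word_inv w).
Proof.
move=> vw.
apply: (@pres_trans _ (word_inv v ++ w ++ word_inv w)).
  rewrite -{1}[word_inv v]cats0; apply: pres_cat; first exact: pres_refl.
  exact/pres_sym/pres_mulwV.
rewrite -[X in pres_cong _ X]cat0s catA; apply: pres_cat; last exact: pres_refl.
apply: pres_trans (pres_mulVw v); apply: pres_cat; first exact: pres_refl.
exact: pres_sym.
Qed.

Definition pres_eq (v w : word) : bool := `[< pres_cong v w >].

Lemma pres_eq_equiv : equiv_class_of pres_eq.
Proof.
split=> [v|v w|v w z].
- by apply/asboolP; apply: pres_refl.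
- by apply/asboolP/asboolP; apply: pres_sym.
- by move=> /asboolP vw /asboolP wz; apply/asboolP; apply: pres_trans wz.
Qed.

Canonical pres_equiv := EquivRelPack pres_eq_equiv.
Canonical pres_encModRel := defaultEncModRel pres_eq.

Definition pres_group := {eq_quot pres_eq}.

HB.instance Definition _ : EqQuotient _ pres_eq pres_group :=
  EqQuotient.on pres_group.
HB.instance Definition _ := Choice.on pres_group.

Lemma pi_presP v w :
  pres_cong v w <-> \pi_pres_group v = \pi_pres_group w.
Proof. by split=> [vw|/eqmodP/asboolP//]; apply/eqmodP/asboolP. Qed.

Lemma pres_reprK v : pres_cong (repr (\pi_pres_group v)) v.
Proof. by apply/pi_presP; rewrite reprK. Qed.

Definition pres_one : pres_group := \pi_pres_group [::].
Definition pres_mul (p q : pres_group) : pres_group := \pi_pres_group (repr p ++ repr q).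
Definition pres_opp (p : pres_group) : pres_group := \pi_pres_group (word_inv (repr p)).

Lemma pi_pres_mul v w :
  \pi_pres_group (v ++ w) = pres_mul (\pi v) (\pi w).
Proof. by apply/pi_presP/pres_sym/pres_cat; apply: pres_reprK. Qed.

Lemma pi_pres_inv v : \pi_pres_group (word_inv v) = pres_opp (\pi v).
Proof. by apply/pi_presP/pres_sym/pres_inv/pres_reprK. Qed.

Lemma pres_mulA : associative pres_mul.
Proof.
by move=> p q r; rewrite -[p]reprK -[q]reprK -[r]reprK -!pi_pres_mul catA.
Qed.

Lemma pres_mul1 : left_id pres_one pres_mul.
Proof. by move=> p; rewrite -[p]reprK -pi_pres_mul. Qed.

Lemma pres_mulr1 : right_id pres_one pres_mul.
Proof. by move=> p; rewrite -[p]reprK -pi_pres_mul cats0. Qed.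

Lemma pres_mulVr : left_inverse pres_one pres_opp pres_mul.
Proof.
move=> p; rewrite -[p]reprK -pi_pres_inv -pi_pres_mul.
exact/pi_presP/pres_mulVw.
Qed.

Lemma pres_mulrV : right_inverse pres_one pres_opp pres_mul.
Proof.
move=> p; rewrite -[p]reprK -pi_pres_inv -pi_pres_mul.
exact/pi_presP/pres_mulwV.
Qed.

HB.instance Definition _ := isGroup.Build pres_group
  pres_mulA pres_mul1 pres_mulr1 pres_mulVr pres_mulrV.

End PresentedGroup.

(* The group generated by s_1, ..., s_(n-1), x_1^(+-1), ..., x_n^(+-1).  To
   index the generators by plain natural numbers, numbered from 1, letters
   outside these ranges are also allowed and set equal to 1. *)
Section ExtendedAffineWeyl.
Variable n : nat.

Notation ls i := ((inl i : nat + nat, false)).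
Notation lx i := ((inr i : nat + nat, false)).

Inductive dW_rel : seq ((nat + nat) * bool) -> seq ((nat + nat) * bool) -> Prop :=
| dW_s_range i : ~~ (1 <= i < n)%N -> dW_rel [:: ls i] [::]
| dW_x_range i : ~~ (1 <= i <= n)%N -> dW_rel [:: lx i] [::]
| dW_ss i : (1 <= i < n)%N -> dW_rel [:: ls i; ls i] [::]
| dW_braid i : (1 <= i)%N -> (i.+1 < n)%N ->
    dW_rel [:: ls i; ls i.+1; ls i] [:: ls i.+1; ls i; ls i.+1]
| dW_sC i j : (1 <= i < n)%N -> (1 <= j < n)%N -> j != i.+1 -> i != j.+1 ->
    dW_rel [:: ls i; ls j] [:: ls j; ls i]
| dW_xC i j : (1 <= i <= n)%N -> (1 <= j <= n)%N ->
    dW_rel [:: lx i; lx j] [:: lx j; lx i]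
| dW_sx i : (1 <= i < n)%N -> dW_rel [:: ls i; lx i] [:: lx i.+1; ls i]
| dW_sxC i j : (1 <= i < n)%N -> (1 <= j <= n)%N -> j != i -> j != i.+1 ->
    dW_rel [:: ls i; lx j] [:: lx j; ls i].

Definition dW := pres_group dW_rel.
HB.instance Definition _ := Group.on dW.

Definition dW_s (i : nat) : dW := \pi_dW [:: ls i].
Definition dW_x (i : nat) : dW := \pi_dW [:: lx i].

(* With c = s_1 ... s_(n-2), the transposition s_1n is c s_(n-1) c^-1. *)
Definition dW_s1n : dW :=
  let c := \big[*%g/1%g]_(1 <= i < n.-1) dW_s i in (c * dW_s n.-1 * c^-1)%g.

Definition dW_s0 : dW := (dW_x 1 * (dW_x n)^-1 * dW_s1n)%g.

Definition dW_pi : dW := (dW_x 1 * \big[*%g/1%g]_(1 <= i < n) dW_s i)%g.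

Definition dW_saff (i : nat) : dW := if i == 0%N then dW_s0 else dW_s i.

End ExtendedAffineWeyl.

Section DAHA.
Variables (C : fieldType) (n : nat).

(* The variable u_i of C[u_1, ..., u_n], for 1 <= i <= n; multinomials numbers
   the variables from 0. *)
Definition uvar (i : nat) : {mpoly C[n]} := \sum_(k < n | k.+1 == i) 'X_k.

(* The degenerate double affine Hecke algebra.  The field [daha_pbw] says that
   the map C[W] (x) C[u_1, ..., u_n] -> H given by the two inclusions and the
   product of H is bijective, an element of the tensor product being written as
   a finitely supported function from W to C[u_1, ..., u_n].  The remaining
   data then determine H up to a unique isomorphism. *)
Record daha (kappa : nat) := Daha {
  daha_alg :> algType C;
  dahaW : dW n -> daha_alg;
  dahaU : {lrmorphism {mpoly C[n]} -> daha_alg};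
  dahaW1 : dahaW 1%g = 1;
  dahaWM : forall v w, dahaW (v * w)%g = dahaW v * dahaW w;
  daha_pbw : bijective (fun f : {fsfun dW n -> {mpoly C[n]} with 0} =>
    \sum_(w <- finsupp f) dahaW w * dahaU (f w));
  daha_su : forall i, (1 <= i < n)%N ->
    dahaW (dW_s n i) * dahaU (uvar i) =
    dahaU (uvar i.+1) * dahaW (dW_s n i) - 1;
  daha_s0u :
    dahaW (dW_s0 n) * dahaU (uvar n) =
    (dahaU (uvar 1) - kappa%:R) * dahaW (dW_s0 n) - 1;
  daha_suC : forall i j, (i < n)%N -> (1 <= j <= n)%N ->
    (j != i %[mod n])%N -> (j != i.+1 %[mod n])%N ->
    dahaW (dW_saff n i) * dahaU (uvar j) =
    dahaU (uvar j) * dahaW (dW_saff n i);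
  daha_piu : forall i, (1 <= i < n)%N ->
    dahaW (dW_pi n) * dahaU (uvar i) * dahaW ((dW_pi n)^-1)%g =
    dahaU (uvar i.+1);
  daha_piun :
    dahaW (dW_pi n) * dahaU (uvar n) * dahaW ((dW_pi n)^-1)%g =
    dahaU (uvar 1) - kappa%:R
}.

End DAHA.

Section Modules.
Variables (A : pzRingType) (V : lmodType A).

Definition gen_submod (X : V -> Prop) : {pred V} := fun v =>
  `[< forall S : {pred V}, submod_closed S -> (forall x, X x -> x \in S) ->
      v \in S >].

Lemma gen_submod_closed X : submod_closed (gen_submod X).
Proof.
split=> [|a u v /asboolP Xu /asboolP Xv]; apply/asboolP => S clS XS.
  by case: clS.
by have [_ linS] := clS; apply: linS; [apply: Xu | apply: Xv].
Qed.

HB.instance Definition _ X :=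
  GRing.isSubmodClosed.Build A V (gen_submod X) (gen_submod_closed X).

Lemma sub_gen_submod (X : V -> Prop) v : X v -> v \in gen_submod X.
Proof. by move=> Xv; apply/asboolP => S _; apply. Qed.

Definition simple_mod : Prop :=
  (exists v : V, v != 0) /\
  forall S : {pred V}, submod_closed S ->
    (forall v, v \in S -> v = 0) \/ (forall v, v \in S).

End Modules.

Section ModuleQuotient.
Variables (A : pzRingType) (V : lmodType A) (X : V -> Prop).

Definition mod_quot := Quotient.quot (gen_submod X).
HB.instance Definition _ := GRing.Zmodule.on mod_quot.
HB.instance Definition _ := EqQuotient.on mod_quot.

Definition mod_quot_scale (a : A) (q : mod_quot) : mod_quot :=
  \pi_mod_quot (a *: repr q).

Lemma pi_mod_quotP (u v : V) :
  (u - v \in gen_submod X) = (\pi_mod_quot u == \pi_mod_quot v).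
Proof. exact: Quotient.idealrBE. Qed.

Lemma pi_mod_quotD (u v : V) : \pi_mod_quot (u + v) = \pi u + \pi v.
Proof. exact: Quotient.pi_add. Qed.

Lemma pi_mod_quot_scale a (v : V) :
  \pi_mod_quot (a *: v) = mod_quot_scale a (\pi v).
Proof.
apply/eqP; rewrite -pi_mod_quotP -scalerBr; apply: rpredZ.
by rewrite pi_mod_quotP reprK.
Qed.

Fact mod_quot_scalerA a b q :
  mod_quot_scale a (mod_quot_scale b q) = mod_quot_scale (a * b) q.
Proof. by elim/quotW: q => v; rewrite -(pi_mod_quot_scale b)
  -!pi_mod_quot_scale scalerA. Qed.

Fact mod_quot_scale1r : left_id 1 mod_quot_scale.
Proof. by elim/quotW=> v; rewrite -pi_mod_quot_scale scale1r. Qed.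

Fact mod_quot_scalerDr : right_distributive mod_quot_scale +%R.
Proof.
move=> a; elim/quotW=> u; elim/quotW=> v.
by rewrite -pi_mod_quotD -!pi_mod_quot_scale -pi_mod_quotD scalerDr.
Qed.

Fact mod_quot_scalerDl q : {morph mod_quot_scale^~ q : a b / a + b}.
Proof.
elim/quotW: q => v a b.
by rewrite -!pi_mod_quot_scale -pi_mod_quotD scalerDl.
Qed.

HB.instance Definition _ := GRing.Zmodule_isLmodule.Build A mod_quot
  mod_quot_scalerA mod_quot_scale1r mod_quot_scalerDr mod_quot_scalerDl.

Lemma pi_mod_quotZ a (v : V) : \pi_mod_quot (a *: v) = a *: (\pi v : mod_quot).
Proof. exact: pi_mod_quot_scale. Qed.

Lemma mod_quot_pi_linear : linear (fun v : V => \pi_mod_quot v).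
Proof. by move=> a u v; rewrite pi_mod_quotD pi_mod_quotZ. Qed.

Lemma mod_quot_lift (W : lmodType A) (f : {linear V -> W}) :
  (forall x, X x -> f x = 0) ->
  exists g : {linear mod_quot -> W}, forall v, g (\pi v) = f v.
Proof.
move=> fX.
have f0 v : v \in gen_submod X -> f v = 0.
  move=> /asboolP /(_ [pred v | f v == 0]) H; apply/eqP/H => [|x /fX/eqP//].
  split=> [|a u w /eqP fu /eqP fw]; first by rewrite inE linear0.
  by rewrite inE linearP fu fw scaler0 addr0.
pose g (q : mod_quot) := f (repr q).
have gE v : g (\pi v) = f v.
  apply/eqP; rewrite -subr_eq0 -linearB; apply/eqP/f0.
  by rewrite pi_mod_quotP reprK.
have g_lin : linear g.
  move=> a; elim/quotW=> u; elim/quotW=> v.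
  by rewrite -pi_mod_quotZ -pi_mod_quotD !gE linearP.
pose gm := GRing.isLinear.Build A mod_quot W _ g g_lin.
pose gL : {linear mod_quot -> W} := HB.pack g gm.
by exists gL.
Qed.

End ModuleQuotient.

Section SkewDiagram.
Variables (n m : nat) (l : int).

(* Boxes are pairs (row, column).  The bounds [sk_mu] and [sk_lam] are
   determined by the set of boxes, since no row is empty. *)
Record skew_diagram := SkewDiagram {
  boxes : set (int * int);
  sk_mu : int -> int;
  sk_lam : int -> int;
  sk_mu_le_lam : forall a, sk_mu a <= sk_lam a;
  sk_boxesE : forall a b, boxes (a, b) <-> sk_mu a <= b <= sk_lam a;
  sk_degree : \sum_(1 <= a < m.+1) (sk_lam a%:Z - sk_mu a%:Z + 1) = n%:Z;
  sk_period : forall a b k : int,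
    boxes (a + k * m%:Z, b - k * l) <-> boxes (a, b);
  sk_mu_anti : forall a, sk_mu (a + 1) <= sk_mu a;
  sk_lam_anti : forall a, sk_lam (a + 1) <= sk_lam a
}.

Definition has_infinite_column (D : skew_diagram) : Prop :=
  exists b : int, infinite_set [set a | boxes D (a, b)]%classic.

Variable D : skew_diagram.

Definition row_size (a : int) : int := sk_lam D a - sk_mu D a + 1.

(* [T0_base] is the formula for T_0 on the rows 1, ..., m; [row_reading]
   extends it periodically, by translating the box into these rows. *)
Definition T0_base (p : int * int) : int :=
  \sum_(1 <= i < `|p.1|%N) row_size i%:Z + p.2 - sk_mu D p.1 + 1.

Definition row_reading (p : int * int) : int :=
  let k := ((p.1 - 1) %/ m%:Z)%Z in
  T0_base (p.1 - k * m%:Z, p.2 + k * l) + k * n%:Z.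

Definition T0_box (i : int) : int * int :=
  xget (0, 0) [set p | boxes D p /\ row_reading p = i]%classic.

Definition T0_content (i : int) : int := (T0_box i).2 - (T0_box i).1.

Definition same_row (i : nat) : Prop :=
  (1 <= i <= n)%N /\ (T0_box i%:Z).1 = (T0_box i.+1%:Z).1.

Lemma row_readingE (p : int * int) :
  1 <= p.1 <= m%:Z -> row_reading p = T0_base p.
Proof.
case: p => a b /= /andP[a1 am]; rewrite /row_reading /=.
by rewrite divz_small ?mul0r ?addr0 ?subr0 //; apply/andP; split; lia.
Qed.

Lemma row_reading_shift (a b k : int) : (0 < m)%N ->
  row_reading (a + k * m%:Z, b - k * l) = row_reading (a, b) + k * n%:Z.
Proof.
move=> m_gt0; rewrite /row_reading /=.
have -> : a + k * m%:Z - 1 = k * m%:Z + (a - 1) by lia.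
rewrite divzMDl; last by lia.
set q := ((a - 1) %/ m%:Z)%Z.
have -> : a + k * m%:Z - (k + q) * m%:Z = a - q * m%:Z by lia.
have -> : b - k * l + (k + q) * l = b + q * l by lia.
lia.
Qed.

Let psum (a : nat) : int := \sum_(1 <= i < a) row_size i%:Z.

Let psumS a : (0 < a)%N -> psum a.+1 = psum a + row_size a%:Z.
Proof. by move=> a0; rewrite /psum big_nat_recr. Qed.

Let row_size_gt0 a : 0 < row_size a.
Proof. by rewrite /row_size; have := sk_mu_le_lam D a; lia. Qed.

Let psum_le a b : (0 < a)%N -> (a <= b)%N -> psum a <= psum b.
Proof.
move=> a0; elim: b => [|b IHb]; first by case: a a0.
rewrite leq_eqVlt => /predU1P[->//|]; rewrite ltnS => ab.
by have := IHb ab; rewrite psumS; [have := row_size_gt0 b%:Z; lia | lia].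
Qed.

Let psum_end : psum m.+1 = n%:Z.
Proof. exact: sk_degree. Qed.

Let psum1 : psum 1 = 0.
Proof. by rewrite /psum big_geq. Qed.

Let psum_find (t : int) a : 1 <= t <= psum a.+1 ->
  exists2 c, (1 <= c <= a)%N & psum c + 1 <= t <= psum c.+1.
Proof.
elim: a => [|a IHa]; first by rewrite psum1; lia.
move=> /andP[t1 t2]; have [ta|ta] := leP t (psum a.+1).
  by have [|c c1 c2] := IHa; [lia | exists c => //; lia].
by exists a.+1; lia.
Qed.

Let box_base (p : int * int) : (0 < m)%N -> boxes D p ->
  exists (c : nat) (b k : int),
  [/\ (1 <= c <= m)%N, p = (c%:Z + k * m%:Z, b - k * l),
      sk_mu D c%:Z <= b <= sk_lam D c%:Z
    & row_reading p = psum c + b - sk_mu D c%:Z + 1 + k * n%:Z].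
Proof.
case: p => a b m0 Dab.
set k := ((a - 1) %/ m%:Z)%Z.
have ak : 1 <= a - k * m%:Z <= m%:Z.
  have := divz_eq (a - 1) m%:Z; rewrite -/k.
  have := @modz_ge0 (a - 1) m%:Z; have := @ltz_pmod (a - 1) m%:Z; lia.
exists (absz (a - k * m%:Z)%R), (b + k * l), k; split; first by lia.
- by congr pair; lia.
- rewrite gez0_abs; last lia.
  apply/(sk_boxesE D); apply/(sk_period D _ _ k).
  have -> : a - k * m%:Z + k * m%:Z = a by lia.
  by have -> : b + k * l - k * l = b by lia.
- by rewrite /row_reading /T0_base /= -/k /psum gez0_abs //; lia.
Qed.

Lemma row_reading_bij (i : int) : (0 < m)%N ->
  exists! p, boxes D p /\ row_reading p = i.
Proof.
move=> m0; have n0 : 0 < n%:Z.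
  rewrite -psum_end; have := @psum_le 2 m.+1 isT m0.
  by rewrite (@psumS 1) // psum1; have := row_size_gt0 1%N%:Z; lia.
set k := ((i - 1) %/ n%:Z)%Z.
have ik : 1 <= i - k * n%:Z <= n%:Z.
  have := divz_eq (i - 1) n%:Z; rewrite -/k.
  have := @modz_ge0 (i - 1) n%:Z; have := @ltz_pmod (i - 1) n%:Z; lia.
have [c cm ct] : exists2 c, (1 <= c <= m)%N &
    psum c + 1 <= i - k * n%:Z <= psum c.+1.
  by apply: psum_find; rewrite psum_end.
have c0 : (0 < c)%N by lia.
rewrite psumS // in ct.
pose b := i - k * n%:Z - psum c - 1 + sk_mu D c%:Z.
have bc : sk_mu D c%:Z <= b <= sk_lam D c%:Z by move: ct; rewrite /row_size /b; lia.
exists (c%:Z + k * m%:Z, b - k * l); split.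
  split; first by apply/(sk_period D)/(sk_boxesE D).
  rewrite row_reading_shift // row_readingE /=; last lia.
  by rewrite /T0_base /= -/(psum c) /b; lia.
move=> p [/(box_base m0)[c' [b' [k' [cm' -> bc' ->]]]]] ei.
have c'0 : (0 < c')%N by lia.
have tb' : psum c' + 1 <= psum c' + b' - sk_mu D c'%:Z + 1 <= psum c'.+1.
  by rewrite psumS // /row_size; lia.
have [t1 t2] : 0 <= psum c' /\ psum c'.+1 <= n%:Z.
  by split; [rewrite -psum1 psum_le | rewrite -psum_end psum_le]; lia.
have ek : k = k'.
  rewrite /k -ei.
  set t := psum c' + b' - _ + 1 in tb' *.
  have -> : t + k' * n%:Z - 1 = k' * n%:Z + (t - 1) by lia.
  by rewrite divzMDl ?divz_small ?addr0 //; lia.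
rewrite -ek in ei *.
have ec : c = c'.
  rewrite -psumS // in ct.
  have h1 : (c < c')%N -> psum c.+1 <= psum c' by apply: psum_le.
  have h2 : (c' < c)%N -> psum c'.+1 <= psum c by apply: psum_le.
  by case: (ltngtP c c') => [/h1|/h2|//]; lia.
by rewrite -ec in ei *; congr (_, _); rewrite /b; lia.
Qed.

Lemma T0_contentE (a b : int) : (0 < m)%N -> boxes D (a, b) ->
  T0_content (row_reading (a, b)) = b - a.
Proof.
move=> m0 Dab; have [p [_ pU]] := row_reading_bij (row_reading (a, b)) m0.
rewrite /T0_content /T0_box; case: xgetP => [q _ /pU <-|/(_ (a, b))].
  by rewrite (pU (a, b)).
by move=> [].
Qed.

End SkewDiagram.

Section VermaModules.
Variables (C : fieldType) (n kappa : nat) (H : daha C n kappa).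

(* The induced module H (x)_(C[u]) C_chi of the one-dimensional module C_chi is
   the quotient of H by the left ideal generated by the p - chi(p), for p in
   C[u_1, ..., u_n]; [verma_hom] is its universal property. *)
Definition verma_ideal (chi : {lrmorphism {mpoly C[n]} -> C | *%R})
  : H^o -> Prop := fun h => exists p, h = dahaU H p - (chi p)%:A.

Definition verma (chi : {lrmorphism {mpoly C[n]} -> C | *%R}) : lmodType H :=
  mod_quot (verma_ideal chi).

Definition verma_one (chi : {lrmorphism {mpoly C[n]} -> C | *%R})
  : verma chi := \pi_(mod_quot (verma_ideal chi)) (1 : H^o).

Lemma verma_hom (chi : {lrmorphism {mpoly C[n]} -> C | *%R})
    (W : lmodType H) (w : W) :
  (exists f : {linear verma chi -> W}, f (verma_one chi) = w) <->
  (forall p, dahaU H p *: w = (chi p)%:A *: w).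
Proof.
split=> [[f <-] p|wP].
  rewrite -!linearZ; congr (f _); apply/eqP.
  rewrite /verma_one -!pi_mod_quotZ -pi_mod_quotP; apply: sub_gen_submod.
  by exists p; rewrite -scalerBl; apply: mulr1.
pose g (h : H^o) : W := (h : H) *: w.
have g_lin : linear g by move=> a u v; rewrite /g scalerDl scalerA.
pose gL : {linear H^o -> W} :=
  HB.pack g (GRing.isLinear.Build H H^o W _ g g_lin).
have [|f fE] := @mod_quot_lift _ _ (verma_ideal chi) W gL.
  by move=> _ [p ->]; rewrite /= /g scalerBl wP subrr.
by exists f; rewrite fE /= /g scale1r.
Qed.

Lemma verma_hom_inj (chi : {lrmorphism {mpoly C[n]} -> C | *%R})
    (W : lmodType H) (f g : {linear verma chi -> W}) :
  f (verma_one chi) = g (verma_one chi) -> f =1 g.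
Proof.
move=> fg; elim/quotW=> h; have -> : h = h *: (1 : H^o) by rewrite -[LHS]mulr1.
by rewrite pi_mod_quotZ !linearZ /= -/(verma_one chi) fg.
Qed.

Variables (m : nat) (l : int) (D : skew_diagram n m l).

Definition skew_char : {lrmorphism {mpoly C[n]} -> C | *%R} :=
  meval (fun k : 'I_n => (T0_content D k.+1%:Z)%:~R).

Definition small_verma_rel : verma skew_char -> Prop := fun v =>
  exists2 i : nat, same_row D i &
    v = (dahaW H (dW_s n i) - 1) *: verma_one skew_char.

Definition small_verma : lmodType H := mod_quot small_verma_rel.

Definition is_LD (L : lmodType H) : Prop :=
  simple_mod L /\
  exists g : {linear small_verma -> L}, forall y, exists x, g x = y.

End VermaModules.

(* Main.v *)
(* The group acts faithfully on Z by permutations commuting with i |-> i + n,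
   every such permutation occurs, and the u_i extend to all i in Z by
   u_(i+n) = u_i - kappa.  Labelling the boxes of D by Z through the row reading
   tableau, the cyclic vector of L_D has weight i |-> content of the box i and is
   fixed by s_j whenever j and j + 1 lie in the same row.

   If D has no infinite column, or kappa = 1, choose a Verma module whose highest
   weight is that of the boxes read along the columns, each column reversed;
   antisymmetrize the generator along the columns of D and symmetrize the result
   along the rows.  As in the construction of Young symmetrizers this gives a
   nonzero vector v with the same weight and row invariance as the generator of
   L_D.  Every weight of the module Hv comes from a tableau increasing along the
   columns; a weight vector in a submodule is brought back to v by intertwiners,
   so that Hv is simple, and it is L_D.  (For kappa = 1 there is one row up to
   translation, and the columns play no role.)

   If D has an infinite column and kappa > 1, all rows have the same length k.
   In L_D the generator v satisfies a Garnir relation: the sum of v and of its k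
   transforms under the transpositions of a box of the row a with the first box
   of the row a + 1 vanishes, since its weight does not occur in L_D with the
   required invariance.  Let f : L_D -> M_tau be injective and choose in the
   support of f(v), as a linear combination of the group elements, a g for which
   g^-1 is extremal for a quadratic potential.  The Garnir relations imply that
   for each q in the row a + 1 there is x in the row a with g^-1 x > g^-1 q, which
   contradicts the periodicity of g^-1 after m steps. *)

Require Import Defs.
From HB Require Import structures.
From mathcomp Require Import fingroup perm.
From mathcomp Require Import all_boot all_order all_algebra.
From mathcomp Require Import finmap mpoly complex zify ring.
From mathcomp Require Import boolp classical_sets cardinality reals.

Set Implicit Arguments.
Unset Strict Implicit.
Unset Printing Implicit Defensive.

Import Order.TTheory GRing.Theory Num.Theory.
Local Open Scope ring_scope.
Local Open Scope quotient_scope.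

(** Translation by the period [(m, -l)] moves a box [l] columns to the left, so for [l = 0] a column
    contains all translates of its boxes and has no finite antisymmetrizer, while for [l > 0] it
    meets every residue class modulo [n] at most once. The obstacle in the simplicity argument is
    that a weight does not determine a tableau: boxes of equal content can be exchanged freely. The
    tableau is therefore sorted along the diagonals, and a counting argument shows that the sorted
    one increases along rows and along columns as soon as some tableaux of the same weight do. Only
    then do two adjacent entries in the wrong order have contents more than 1 apart, which keeps the
    intertwiners from vanishing. A quadratic potential, whose change under a transposition is a
    product of two differences, governs the sorting, the descents and the extremal choices. About
    [L_D] only the weight and the row invariance of its generator are used; it is compared with the
    constructed vector inside the product of the two modules. *)

Class atleast2 (n : nat) : Prop := atleast2P : (2 <= n)%N.

(** * The action on the integers *)

Section PeriodicPermutations.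
Context (n : nat) {n_ge2 : atleast2 n}.
Let hn : (2 <= n)%N := n_ge2.

Definition cg (a b : int) : bool := (n%:Z %| a - b)%Z.

Lemma cgP a b : reflect (exists q : int, a = b + q * n%:Z) (cg a b).
Proof.
apply: (iffP dvdzP) => -[q e]; exists q; lia.
Qed.

Lemma cg_refl a : cg a a.
Proof. by apply/cgP; exists 0; lia. Qed.

Lemma cg_sym a b : cg a b = cg b a.
Proof. by apply/cgP/cgP => -[q ->]; exists (- q); lia. Qed.

Lemma cg_trans a b c : cg a b -> cg b c -> cg a c.
Proof. by move=> /cgP[q ->] /cgP[r ->]; apply/cgP; exists (q + r); lia. Qed.

Lemma cgl a b c : cg a b -> cg a c = cg b c.
Proof.
move=> ab; apply/idP/idP; last exact: cg_trans.
by apply: cg_trans; rewrite cg_sym.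
Qed.

Lemma cgDr a b c : cg (a + c) (b + c) = cg a b.
Proof. by apply/cgP/cgP => -[q e]; exists q; lia. Qed.

Lemma cg_small a b : cg a b -> `|a - b| < n%:Z -> a = b.
Proof. by move=> /cgP[q ->]; have [->|q0] := eqVneq q 0; nia. Qed.

Lemma cg_neq a b : a != b -> `|a - b| < n%:Z -> cg a b = false.
Proof. by move=> ab lt; apply: contra_neqF ab => /cg_small; apply. Qed.

Lemma cgS a : cg a (a + 1) = false.
Proof. by apply: cg_neq; lia. Qed.

Definition periodic (f : int -> int) := forall j, f (j + n%:Z) = f j + n%:Z.

Lemma periodicM f : periodic f ->
  forall j q, f (j + q * n%:Z) = f j + q * n%:Z.
Proof.
move=> fP j.
have nat_case (q : nat) i : f (i + q%:Z * n%:Z) = f i + q%:Z * n%:Z.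
  elim: q => [|q IHq]; first by rewrite mul0r !addr0.
  have -> : i + q.+1%:Z * n%:Z = i + q%:Z * n%:Z + n%:Z by lia.
  by rewrite fP IHq; lia.
case=> q; first exact: nat_case.
have := nat_case q.+1 (j + Negz q * n%:Z).
have -> : j + Negz q * n%:Z + q.+1%:Z * n%:Z = j by lia.
by lia.
Qed.

Lemma periodic_cg f a b : periodic f -> cg a b -> cg (f a) (f b).
Proof.
by move=> fP /cgP[q ->]; apply/cgP; exists q; rewrite periodicM.
Qed.

Lemma injective_cg f a b : periodic f -> injective f ->
  cg (f a) (f b) = cg a b.
Proof.
move=> fP fI; apply/idP/idP; last exact: periodic_cg.
move=> /cgP[q]; rewrite -periodicM // => /fI ->.
by apply/cgP; exists q.
Qed.

(** The affine transposition: it exchanges [a + q n] and [b + q n] for all [q] at once. *)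
Definition tr (a b j : int) : int :=
  if cg j a then j - a + b else if cg j b then j - b + a else j.

Lemma tr_periodic a b : periodic (tr a b).
Proof.
move=> j; rewrite /tr.
have e : cg (j + n%:Z) j by apply/cgP; exists 1; lia.
by rewrite !(cgl _ e); case: ifP => _; [lia | case: ifP => _; lia].
Qed.

Lemma trK a b : ~~ cg a b -> involutive (tr a b).
Proof.
move=> ab j; rewrite /tr.
case ja: (cg j a).
  have jb : cg (j - a + b) b by move/cgP: ja => [q ->]; apply/cgP; exists q; lia.
  rewrite (cgl _ jb) jb cg_sym (negbTE ab); lia.
case jb: (cg j b); last by rewrite ja jb.
have -> : cg (j - b + a) a by move/cgP: jb => [q ->]; apply/cgP; exists q; lia.
lia.
Qed.

Lemma tr_inj a b : ~~ cg a b -> injective (tr a b).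
Proof. by move=> ab; apply: inv_inj; apply: trK. Qed.

Lemma trl a b : tr a b a = b.
Proof. by rewrite /tr cg_refl; lia. Qed.

Lemma trr a b : ~~ cg a b -> tr a b b = a.
Proof. by move=> ab; rewrite -{2}(trl a b) trK. Qed.

Lemma tr_id a b j : ~~ cg j a -> ~~ cg j b -> tr a b j = j.
Proof. by rewrite /tr => /negbTE -> /negbTE ->. Qed.

Lemma trC a b j : ~~ cg a b -> tr a b j = tr b a j.
Proof.
rewrite /tr => ab; case: ifP => ja; case: ifP => // jb.
by case/negP: ab; rewrite -(cgl _ ja).
Qed.

Lemma tr_conj f a b j : periodic f -> injective f ->
  f (tr a b j) = tr (f a) (f b) (f j).
Proof.
move=> fP fI; rewrite /tr !injective_cg //.
case: ifP => [/cgP[q ->]|_].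
  have -> : a + q * n%:Z - a + b = b + q * n%:Z by lia.
  by rewrite !periodicM //; lia.
case: ifP => [/cgP[q ->]|//].
have -> : b + q * n%:Z - b + a = a + q * n%:Z by lia.
by rewrite !periodicM //; lia.
Qed.

Definition xshift (a c j : int) : int := if cg j a then j + c * n%:Z else j.

Lemma xshift_periodic a c : periodic (xshift a c).
Proof.
move=> j; rewrite /xshift.
have e : cg (j + n%:Z) j by apply/cgP; exists 1; lia.
by rewrite !(cgl _ e); case: ifP => _; lia.
Qed.

Lemma xshiftD a c d j : xshift a c (xshift a d j) = xshift a (c + d) j.
Proof.
rewrite /xshift; case ja: (cg j a); last by rewrite ja.
have e : cg (j + d * n%:Z) j by apply/cgP; exists d; lia.
by rewrite (cgl _ e) ja; lia.
Qed.

Lemma xshift0 a j : xshift a 0 j = j.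
Proof. by rewrite /xshift; case: ifP => _; lia. Qed.

Lemma xshiftK a c : cancel (xshift a c) (xshift a (- c)).
Proof. by move=> j; rewrite xshiftD addNr xshift0. Qed.

Lemma xshift_conj f a c j : periodic f -> injective f ->
  f (xshift a c j) = xshift (f a) c (f j).
Proof.
move=> fP fI; rewrite /xshift injective_cg //.
by case: ifP => _; rewrite ?periodicM.
Qed.

Lemma xshiftC a b c d j : xshift a c (xshift b d j) = xshift b d (xshift a c j).
Proof.
rewrite (@xshift_conj (xshift a c)).
- rewrite {1 2}/xshift; case ba: (cg b a) => //.
  have e : cg (b + c * n%:Z) b by apply/cgP; exists c; lia.
  by rewrite /xshift ![cg _ (b + _)]cg_sym !(cgl _ e) ![cg b _]cg_sym.
- exact: xshift_periodic.
- exact: can_inj (xshiftK a c).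
Qed.

(* A letter out of range acts trivially, since it is the identity of [dW]. *)
Definition letter_act (p : (nat + nat) * bool) : int -> int :=
  match p.1 with
  | inl i => if (1 <= i < n)%N then tr i%:Z (i%:Z + 1) else id
  | inr i => if (1 <= i <= n)%N then xshift i%:Z (if p.2 then - 1 else 1) else id
  end.

Definition word_act w j := foldr letter_act j w.

Lemma letter_act_periodic p : periodic (letter_act p).
Proof.
rewrite /letter_act; case: p => -[i|i] b /=; case: ifP => // _.
- exact: tr_periodic.
- exact: xshift_periodic.
Qed.

Lemma letter_actK g b : cancel (letter_act (g, ~~ b)) (letter_act (g, b)).
Proof.
rewrite /letter_act; case: g => i j /=; case: ifP => // _.
- by apply: trK; rewrite cgS.
- by rewrite xshiftD; case: b => /=; rewrite ?addNr ?subrr xshift0.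
Qed.

Lemma word_act_cat v w j : word_act (v ++ w) j = word_act v (word_act w j).
Proof. by rewrite /word_act foldr_cat. Qed.

Lemma s_inj i : injective (tr i (i + 1)).
Proof. by apply: tr_inj; rewrite cgS. Qed.

Lemma cg_nat (i j : nat) : (1 <= i <= n)%N -> (1 <= j <= n)%N ->
  cg i%:Z j%:Z = (i == j).
Proof.
move=> hi hj; have [->|ij] := eqVneq i j; first exact: cg_refl.
by apply: cg_neq; lia.
Qed.

Lemma rel_act v w : dW_rel n v w -> word_act v =1 word_act w.
Proof.
case=> [i|i|i|i|i j|i j|i|i j]; rewrite /word_act /= /letter_act /=.
- by move=> /negbTE -> .
- by move=> /negbTE -> .
- by move=> -> j; rewrite /= trK // cgS.
- move=> h1 h2 j; rewrite !ifT; try lia.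
  have e : i.+1%:Z = i%:Z + 1 by lia.
  rewrite e; set a : int := i.
  (* Both sides of the braid relation are conjugates, equal to the transposition of [a] and
     [a + 2]. *)
  have -> : tr a (a + 1) (tr (a + 1) (a + 1 + 1) (tr a (a + 1) j)) = tr a (a + 1 + 1) j.
    rewrite (@tr_conj (tr a (a + 1))); [|exact: tr_periodic|exact: s_inj].
    rewrite (trK (a := a)) ?cgS // trr ?cgS //.
    by rewrite (@tr_id a (a + 1) (a + 1 + 1)) // cg_neq //; lia.
  rewrite (@tr_conj (tr (a + 1) (a + 1 + 1))); [|exact: tr_periodic|exact: s_inj].
  rewrite (trK (a := a + 1)) ?cgS // trl.
  by rewrite (@tr_id (a + 1) (a + 1 + 1) a) // cg_neq //; lia.
- move=> h1 h2 h3 h4 k; rewrite h1 h2.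
  rewrite (@tr_conj (tr i%:Z (i%:Z + 1)) j); [|exact: tr_periodic|exact: s_inj].
  have [<-|ij] := eqVneq i j; first by rewrite trl trr ?cgS // trC // cg_sym cgS.
  have e : j%:Z + 1 = j.+1%:Z by lia.
  have e' : i%:Z + 1 = i.+1%:Z by lia.
  by rewrite [X in tr X _ _]tr_id ?[X in tr _ X _]tr_id // ?e ?e' cg_nat; lia.
- by move=> -> -> k /=; rewrite xshiftC.
- move=> h k; rewrite h !ifT; try lia.
  rewrite (@xshift_conj (tr i%:Z (i%:Z + 1))); [|exact: tr_periodic|exact: s_inj].
  by rewrite trl; congr (xshift _ _ _); lia.
- move=> h1 h2 h3 h4 k; rewrite h1 h2.
  rewrite (@xshift_conj (tr i%:Z (i%:Z + 1))); [|exact: tr_periodic|exact: s_inj].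
  have e' : i%:Z + 1 = i.+1%:Z by lia.
  by rewrite tr_id // ?e' cg_nat; lia.
Qed.

Lemma cong_act v w : pres_cong (dW_rel n) v w -> word_act v =1 word_act w.
Proof.
elim=> {v w} [v|v w _ IH|v w z _ IH1 _ IH2|v v' w w' _ IH1 _ IH2|g b|v w].
- by [].
- by move=> j.
- by move=> j; rewrite IH1.
- by move=> j; rewrite !word_act_cat IH2 IH1.
- move=> j; have := letter_actK g b j.
  by rewrite /word_act /= -{2}[b]negbK letter_actK.
- exact: rel_act.
Qed.

Local Notation W := (dW n).

Definition act (g : W) : int -> int := word_act (repr g).

Lemma act_pi w : act (\pi_(dW n) w) =1 word_act w.
Proof. by apply: cong_act; apply: pres_reprK. Qed.

Lemma actM (g h : W) j : act (g * h)%g j = act g (act h j).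
Proof. by rewrite [(g * h)%g]/(pres_mul g h) act_pi word_act_cat. Qed.

Lemma act1 j : act 1%g j = j.
Proof. by rewrite [1%g]/(pres_one _) act_pi. Qed.

Lemma actK (g : W) : cancel (act g) (act (g^-1)%g).
Proof. by move=> j; rewrite -actM mulVg act1. Qed.

Lemma actKV (g : W) : cancel (act (g^-1)%g) (act g).
Proof. by move=> j; rewrite -actM mulgV act1. Qed.

Lemma act_injective (g : W) : injective (act g).
Proof. exact: can_inj (actK g). Qed.

Lemma act_periodic (g : W) : periodic (act g).
Proof.
move=> j; rewrite /act /word_act; elim: (repr g) => //= p w IHw.
by rewrite IHw letter_act_periodic.
Qed.

Lemma act_s i : act (dW_s n i) =1 if (1 <= i < n)%N then tr i%:Z (i%:Z + 1) else id.
Proof. by move=> j; rewrite act_pi /word_act /= /letter_act /=. Qed.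

Lemma act_x i : act (dW_x n i) =1 if (1 <= i <= n)%N then xshift i%:Z 1 else id.
Proof. by move=> j; rewrite act_pi /word_act /= /letter_act /=. Qed.

Lemma act_xV i : act (dW_x n i)^-1%g =1 if (1 <= i <= n)%N then xshift i%:Z (-1) else id.
Proof.
move=> j; apply: (@act_injective (dW_x n i)); rewrite actKV act_x.
by case: ifP => // _; rewrite xshiftD subrr xshift0.
Qed.

End PeriodicPermutations.

(** * Faithfulness of the action *)

Section Faithful.
Context (n : nat) {n_ge2 : atleast2 n}.
Let hn : (2 <= n)%N := n_ge2.
Local Notation W := (dW n).
Local Notation s := (dW_s n).
Local Notation x := (dW_x n).
Local Open Scope group_scope.

Lemma s_sq i : s i * s i = 1.
Proof.
have [h|h] := boolP (1 <= i < n)%N.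
  by rewrite -[s i * s i]pi_pres_mul; apply/pi_presP/pres_rel/dW_ss.
have -> : s i = 1 by apply/pi_presP/pres_rel/dW_s_range.
by rewrite mulg1.
Qed.

Lemma s_inv i : (s i)^-1 = s i.
Proof. exact/mulg1_eq/s_sq. Qed.

Lemma s_braid i : (1 <= i)%N -> (i.+1 < n)%N ->
  s i * s i.+1 * s i = s i.+1 * s i * s i.+1.
Proof.
move=> h1 h2; rewrite -!mulgA.
have e a b c : s a * (s b * s c) =
    \pi_(dW n) [:: (inl a, false); (inl b, false); (inl c, false)].
  rewrite -[s b * s c]pi_pres_mul -[s a * _]pi_pres_mul.
  exact: congr1.
by rewrite !e; apply/pi_presP/pres_rel/dW_braid.
Qed.

Lemma s_comm i j : (1 <= i < n)%N -> (1 <= j < n)%N -> j != i.+1 -> i != j.+1 ->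
  commute (s i) (s j).
Proof.
move=> *; rewrite /commute -[s i * s j]pi_pres_mul -[s j * s i]pi_pres_mul.
exact/pi_presP/pres_rel/dW_sC.
Qed.

Lemma x_comm i j : commute (x i) (x j).
Proof.
have x1 k : ~~ (1 <= k <= n)%N -> x k = 1.
  by move=> h; apply/pi_presP/pres_rel/dW_x_range.
have [hi|/x1 ->] := boolP (1 <= i <= n)%N; last by rewrite /commute mulg1 mul1g.
have [hj|/x1 ->] := boolP (1 <= j <= n)%N; last by rewrite /commute mulg1 mul1g.
rewrite /commute -[x i * x j]pi_pres_mul -[x j * x i]pi_pres_mul.
exact/pi_presP/pres_rel/dW_xC.
Qed.

Lemma s_x i : (1 <= i < n)%N -> s i * x i = x i.+1 * s i.
Proof.
move=> h; rewrite -[s i * x i]pi_pres_mul -[x i.+1 * s i]pi_pres_mul.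
exact/pi_presP/pres_rel/dW_sx.
Qed.

Lemma s_xC i j : (1 <= i < n)%N -> (1 <= j <= n)%N -> j != i -> j != i.+1 ->
  s i * x j = x j * s i.
Proof.
move=> *; rewrite -[s i * x j]pi_pres_mul -[x j * s i]pi_pres_mul.
exact/pi_presP/pres_rel/dW_sxC.
Qed.

Lemma s_x_swap i j : (1 <= i < n)%N -> (1 <= j <= n)%N ->
  exists2 k, (1 <= k <= n)%N & s i * x j = x k * s i.
Proof.
move=> hi hj; have [ji|ji] := eqVneq j i.
  by exists i.+1; [lia | rewrite ji s_x].
have [ji'|ji'] := eqVneq j i.+1; last by exists j; rewrite // s_xC.
exists i; first lia.
apply: (mulgI (s i)); rewrite ji' !mulgA s_sq mul1g s_x //.
by rewrite -mulgA s_sq mulg1.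
Qed.

Inductive s_gen (k : nat) : W -> Prop :=
| s_gen1 : s_gen k 1
| s_genM i g : (1 <= i < k)%N -> s_gen k g -> s_gen k (s i * g).

Inductive x_gen (k : nat) : W -> Prop :=
| x_gen1 : x_gen k 1
| x_genM i g : (1 <= i <= k)%N -> x_gen k g -> x_gen k (x i * g)
| x_genV i g : (1 <= i <= k)%N -> x_gen k g -> x_gen k ((x i)^-1 * g).

Definition cyc j k : W := \big[*%g/1]_(j <= i < k) s i.

Lemma cyc_comm i j k : (1 <= i < n)%N -> (1 <= j)%N -> (k <= n)%N ->
  (i.+1 < j)%N || (k < i)%N -> commute (s i) (cyc j k).
Proof.
move=> hi hj hk hij; rewrite /cyc big_nat_cond; apply: commute_prod => t.
by rewrite andbT => ht; apply: s_comm; lia.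
Qed.

(** Coset decomposition of a symmetric group from the Coxeter relations alone: [s i] on the left of
    a representative [cyc j k.+1] either yields another representative or passes to its right as a
    generator of the smaller group, by commutation or by the braid relation. *)
Lemma s_gen_cyc k g : (k < n)%N -> s_gen k.+1 g ->
  exists j, (1 <= j <= k.+1)%N /\ exists2 h, s_gen k h & g = cyc j k.+1 * h.
Proof.
move=> kn; elim=> [|i {}g hi _ [j [hj [h hh ->]]]].
  exists k.+1; split; first lia.
  by exists 1; [exact: s_gen1 | rewrite /cyc big_geq // mulg1].
rewrite mulgA.
have [ij|ij] := ltnP i j.
  have [ij'|ij'] := ltnP i.+1 j.
    exists j; split=> //; exists (s i * h); first by apply: s_genM => //; lia.
    have -> : s i * cyc j k.+1 = cyc j k.+1 * s i by apply: cyc_comm; lia.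
    by rewrite mulgA.
  have e : j = i.+1 by lia.
  exists i; split; first lia; exists h => //.
  by rewrite e /cyc [in RHS]big_ltn; last lia.
have [ij'|ij'] := eqVneq i j.
  exists j.+1; split; first lia; exists h => //.
  by rewrite ij' {1}/cyc big_ltn ?mulgA ?s_sq ?mul1g //; lia.
exists j; split; first lia.
case: i hi ij ij' => // i hi ij ij'.
exists (s i * h); first by apply: s_genM => //; lia.
rewrite [in RHS]mulgA; congr (_ * _).
have cE : cyc j k.+1 = cyc j i * (s i * s i.+1) * cyc i.+2 k.+1.
  rewrite /cyc (@big_cat_nat _ _ _ i) /=; try lia.
  by rewrite (@big_ltn _ _ _ i) 1?(@big_ltn _ _ _ i.+1) ?mulgA //; lia.
rewrite cE.
have c1 : s i.+1 * cyc j i = cyc j i * s i.+1 by apply: cyc_comm; lia.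
have c2 : s i * cyc i.+2 k.+1 = cyc i.+2 k.+1 * s i by apply: cyc_comm; lia.
rewrite -!mulgA -c2 !mulgA c1 -!mulgA; congr (_ * _); rewrite !mulgA.
by rewrite -[s i.+1 * s i * s i.+1]s_braid //; lia.
Qed.

Lemma s_gen_act k g (j : nat) : s_gen k g -> (k <= n)%N -> (1 <= j <= n)%N ->
  exists2 j' : nat, (1 <= j' <= n)%N & act g j = j' /\ ((k < j)%N -> j' = j).
Proof.
move=> + kn; elim=> {g} [|i g hi _ IH] hj; first by exists j; rewrite ?act1.
have [j' hj' [e ej]] := IH hj.
rewrite actM e act_s ifT; last lia.
have := @tr_id n i (i%:Z + 1)%R j'.
rewrite (_ : (i%:Z + 1)%R = i.+1%:Z); last lia.
rewrite !cg_nat //; try lia.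
have [ji|ji] := eqVneq j' i; first by rewrite ji trl => _; exists i.+1; lia.
have [ji'|ji'] := eqVneq j' i.+1; last by move=> -> //; exists j'.
by rewrite ji' trr; [exists i; lia | rewrite cg_nat //; lia].
Qed.

Lemma cyc_act j k : (1 <= j <= k)%N -> (k <= n)%N -> act (cyc j k) k = j.
Proof.
move=> + kn; elim: {j}(k - j)%N {-2}j (erefl (k - j)%N) => [|d IHd] j hd hj.
  by rewrite /cyc big_geq ?act1; lia.
rewrite /cyc big_ltn ?actM; last lia.
have := IHd j.+1; rewrite /cyc => ->; try lia.
rewrite act_s ifT; last lia.
have -> : j.+1%:Z = (j%:Z + 1)%R by lia.
by rewrite trr // cgS.
Qed.

(** The image of [k] under the cycle identifies the coset representative, so an element acting
    trivially loses one generator after the other. *)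
Lemma s_gen_faithful k g : (k <= n)%N -> s_gen k g ->
  (forall j : nat, (1 <= j <= n)%N -> act g j = j) -> g = 1.
Proof.
elim: k g => [|k IHk] g kn gk gE; first by case: gk => // i h; lia.
have [j [hj [h hh gh]]] := s_gen_cyc kn gk.
have [j0 _ [hk /(_ (ltnSn k)) e]] := @s_gen_act k h k.+1 hh (ltnW kn) ltac:(lia).
have jk := gE k.+1 ltac:(lia).
rewrite gh actM hk e cyc_act in jk; try lia.
have {}jk : j = k.+1 by lia.
have {}gh : g = h by rewrite gh jk /cyc big_geq // mul1g.
by subst g; apply: (IHk h (ltnW kn) hh gE).
Qed.

Lemma x_gen_monomial k g : x_gen k.+1 g ->
  exists a b : nat, exists2 h, x_gen k h & g = x k.+1 ^+ a * (x k.+1)^-1 ^+ b * h.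
Proof.
have xVC i j : commute (x i)^-1 (x j).
  exact/commute_sym/commuteV/x_comm.
have xVVC i j : commute (x i)^-1 (x j)^-1 by exact/commuteV.
elim=> [|i {}g hi _ [a [b [h hh ->]]]|i {}g hi _ [a [b [h hh ->]]]].
- by exists 0%N, 0%N, 1; [exact: x_gen1 | rewrite !mulg1].
- have [->|ik] := eqVneq i k.+1; first by exists a.+1, b, h; rewrite // expgS !mulgA.
  exists a, b, (x i * h); first by apply: x_genM => //; lia.
  rewrite !mulgA; congr (_ * _).
  rewrite -[LHS]mulgA; apply: commuteM; apply: commuteX; first exact: x_comm.
  exact/commuteV/x_comm.
- have [->|ik] := eqVneq i k.+1.
    exists a, b.+1, h; rewrite // expgS !mulgA; congr (_ * _ * _).
    exact/commuteX/xVC.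
  exists a, b, ((x i)^-1 * h); first by apply: x_genV => //; lia.
  rewrite !mulgA; congr (_ * _).
  rewrite -[LHS]mulgA; apply: commuteM; apply: commuteX; first exact: xVC.
  exact: xVVC.
Qed.

Lemma x_pow_act i (a b : nat) j : (1 <= i <= n)%N ->
  act (x i ^+ a * (x i)^-1 ^+ b) j = xshift n i (a%:Z - b%:Z)%R j.
Proof.
move=> hi; elim: a => [|a IHa].
  rewrite expg0 mul1g; elim: b => [|b IHb].
    by rewrite expg0 act1 subrr xshift0.
  by rewrite expgS actM IHb act_xV // hi xshiftD; congr xshift; lia.
by rewrite expgS -mulgA actM IHa act_x hi xshiftD; congr xshift; lia.
Qed.

Lemma x_gen_act k g (j : nat) : x_gen k g -> (k <= n)%N -> (1 <= j <= n)%N ->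
  exists2 c : int, act g j = (j%:Z + c * n%:Z)%R & ((k < j)%N -> c = 0%R).
Proof.
move=> + kn hj; have step i d (c : int) : (1 <= i <= k)%N ->
    ((k < j)%N -> c = 0%R) ->
    exists2 c' : int, xshift n i d (j%:Z + c * n%:Z)%R = (j%:Z + c' * n%:Z)%R
      & ((k < j)%N -> c' = 0%R).
  move=> hi hc; rewrite /xshift.
  have /cgl -> : cg n (j%:Z + c * n%:Z)%R j by apply/cgP; exists c.
  rewrite cg_nat //; last lia.
  have [ji|ji] := eqVneq j i; last by exists c.
  by exists (c + d)%R; [lia | lia].
elim=> {g} [|i g hi _ [c e hc]|i g hi _ [c e hc]].
- by exists 0%R; rewrite ?act1 ?mul0r ?addr0.
- by rewrite actM e act_x ifT; [exact: step | lia].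
- by rewrite actM e act_xV // ifT; [exact: step | lia].
Qed.

Lemma x_gen_faithful k g : (k <= n)%N -> x_gen k g ->
  (forall j : nat, (1 <= j <= n)%N -> act g j = j) -> g = 1.
Proof.
elim: k g => [|k IHk] g kn gk gE.
  by case: gk => // i h; lia.
have [a [b [h hh gh]]] := x_gen_monomial gk.
have [c e /(_ (ltnSn k)) c0] := @x_gen_act k h k.+1 hh (ltnW kn) ltac:(lia).
have ab := gE k.+1 ltac:(lia).
rewrite gh actM e c0 mul0r addr0 x_pow_act in ab; last lia.
rewrite /xshift cg_refl in ab; have {}ab : a = b by nia.
have {}gh : g = h by rewrite gh ab expVgn mulgV mul1g.
by subst g; apply: (IHk h (ltnW kn) hh gE).
Qed.

Lemma s_x_gen i g : (1 <= i < n)%N -> x_gen n g ->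
  exists2 g', x_gen n g' & s i * g = g' * s i.
Proof.
move=> hi; elim=> [|j {}g hj _ [g' hg' e]|j {}g hj _ [g' hg' e]].
- by exists 1; [exact: x_gen1 | rewrite mulg1 mul1g].
- have [k hk ek] := s_x_swap hi hj.
  by exists (x k * g'); [exact: x_genM | rewrite mulgA ek -!mulgA e].
- have [k hk ek] := s_x_swap hi hj.
  exists ((x k)^-1 * g'); first exact: x_genV.
  rewrite -[RHS]mulgA -e !mulgA; congr (_ * _).
  by apply: (mulgI (x k)); rewrite !mulgA -ek mulgK mulgV mul1g.
Qed.

Lemma dW_factor (g : W) : exists2 a, x_gen n a & exists2 b, s_gen n b & g = a * b.
Proof.
have s1 k : ~~ (1 <= k < n)%N -> s k = 1.
  by move=> h; apply/pi_presP/pres_rel/dW_s_range.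
have x1 k : ~~ (1 <= k <= n)%N -> x k = 1.
  by move=> h; apply/pi_presP/pres_rel/dW_x_range.
have stepS i h : (exists2 a, x_gen n a & exists2 b, s_gen n b & h = a * b) ->
    exists2 a, x_gen n a & exists2 b, s_gen n b & s i * h = a * b.
  have [hi|/s1 ->] := boolP (1 <= i < n)%N; last by rewrite mul1g.
  move=> [a ha [b hb ->]]; have [a' ha' e] := s_x_gen hi ha.
  exists a' => //; exists (s i * b); first exact: s_genM.
  by rewrite mulgA e -mulgA.
have catE p w : \pi_(dW n) (p :: w) = \pi_(dW n) [:: p] * \pi_(dW n) w.
  by rewrite -cat1s pi_pres_mul.
have invE i : \pi_(dW n) [:: (i, true)] = (\pi_(dW n) [:: (i, false)])^-1.
  by rewrite -[RHS]pi_pres_inv.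
rewrite -[g]reprK; elim: (repr g) => [|[[i|i] []] w IHw].
- by exists 1; [exact: x_gen1 | exists 1; [exact: s_gen1 | rewrite mulg1]].
- by rewrite catE invE -/(s i) s_inv; apply: stepS.
- by rewrite catE; apply: stepS.
- rewrite catE invE -/(x i); move: IHw => [a ha [b hb ->]].
  have [hi|/x1 ->] := boolP (1 <= i <= n)%N.
    exists ((x i)^-1 * a); first exact: x_genV.
    by exists b => //; rewrite mulgA.
  by rewrite invg1 mul1g; exists a => //; exists b.
- rewrite catE -/(x i); move: IHw => [a ha [b hb ->]].
  have [hi|/x1 ->] := boolP (1 <= i <= n)%N.
    exists (x i * a); first exact: x_genM.
    by exists b => //; rewrite mulgA.
  by rewrite mul1g; exists a => //; exists b.
Qed.

Lemma act_eq1 (g : W) : (forall j, act g j = j) -> g = 1.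
Proof.
have [a ha [b hb ->]] := dW_factor g => abE.
have bE (j : nat) : (1 <= j <= n)%N -> act b j = j.
  move=> hj; have [j' hj' [e _]] := s_gen_act hb (leqnn n) hj.
  have [c e' _] := x_gen_act ha (leqnn n) hj'.
  (* [b] permutes 1, ..., n while [a] moves labels by multiples of [n], so the two can only cancel
     if [b] fixes [j]. *)
  have := abE j; rewrite actM e e' => /eqP; have [->|c0] := eqVneq c 0%R; first by lia.
  by nia.
have b1 : b = 1 by apply: s_gen_faithful hb bE.
rewrite b1 mulg1 in abE *.
by apply: (@x_gen_faithful n).
Qed.

Lemma act_inj (g h : W) : act g =1 act h -> g = h.
Proof.
move=> gh; apply: divg1_eq; apply: act_eq1 => j.
by rewrite actM gh actKV.
Qed.

End Faithful.

(** * Affine permutations *)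

Section AffineElements.
Context (n : nat) {n_ge2 : atleast2 n}.
Let hn : (2 <= n)%N := n_ge2.
Local Notation W := (dW n).

Lemma residue (j : int) : exists i : 'I_n, cg n j (i.+1%:Z).
Proof.
have lt : (`|((j - 1) %% n%:Z)%Z| < n)%N.
  by have := @ltz_pmod (j - 1) n%:Z; have := @modz_ge0 (j - 1) n%:Z; lia.
exists (Ordinal lt); apply/cgP; exists ((j - 1) %/ n%:Z)%Z => /=.
have := divz_eq (j - 1) n%:Z; have := @modz_ge0 (j - 1) n%:Z; lia.
Qed.

Lemma cg_ord (i j : 'I_n) : cg n i.+1%:Z j.+1%:Z = (i == j).
Proof. by rewrite cg_nat //; have := ltn_ord i; have := ltn_ord j; lia. Qed.

Lemma periodic_ext f g : periodic n f -> periodic n g ->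
  (forall i : nat, (1 <= i <= n)%N -> f i = g i) -> f =1 g.
Proof.
move=> fP gP fg j; have [i /cgP[q ->]] := residue j.
by rewrite !periodicM // fg //; have := ltn_ord i; lia.
Qed.

Lemma cyc_act_lt j k i : (1 <= j <= k)%N -> (k <= n)%N -> (1 <= i < k)%N ->
  act (cyc n j k) i = if (i < j)%N then i else i.+1.
Proof.
move=> + kn hi; elim: {j}(k - j)%N {-2}j (erefl (k - j)%N) => [|d IHd] j hd hj.
  rewrite /cyc big_geq ?act1; last lia.
  by rewrite ifT //; lia.
rewrite /cyc big_ltn ?actM; last lia.
have := IHd j.+1; rewrite /cyc => ->; try lia.
rewrite act_s ifT; last lia.
have [ij|ij] := ltnP i j.+1.
  have [->|ij'] := eqVneq i j; first by rewrite trl ltnn; lia.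
  rewrite tr_id ?ifT //; try lia.
    by rewrite cg_nat //; lia.
  by rewrite (_ : j%:Z + 1 = j.+1%:Z) ?cg_nat; lia.
rewrite ifF; last lia.
rewrite tr_id //; first by rewrite cg_nat //; lia.
by rewrite (_ : j%:Z + 1 = j.+1%:Z) ?cg_nat; lia.
Qed.

Lemma act_dW_pi j : act (dW_pi n) j = j + 1.
Proof.
move: j; apply: periodic_ext => [|j|i hi]; [exact: act_periodic | lia |].
rewrite actM -/(cyc n 1 n) act_x ifT; last lia.
have [ilt|ige] := ltnP i n.
  rewrite cyc_act_lt ?ifF; try lia.
  by rewrite /xshift (_ : 1 = 1%N%:Z) // cg_nat ?ifF; lia.
have -> : i = n by lia.
by rewrite cyc_act /xshift ?cg_refl; lia.
Qed.

Lemma act_s1n : act (dW_s1n n) =1 tr n 1 n.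
Proof.
move=> j; rewrite /dW_s1n -/(cyc n 1 n.-1) !actM act_s ifT; last lia.
rewrite tr_conj; [|exact: act_periodic|exact: act_injective].
rewrite actKV cyc_act; try lia.
have -> : n.-1%:Z + 1 = n by lia.
suff -> : act (cyc n 1 n.-1) n = n by [].
have : forall a k : nat, (1 <= a)%N -> (k < n)%N -> act (cyc n a k) n = n.
  move=> a k a1 kn; rewrite /cyc big_nat_cond; elim/big_ind: _ => [|g h|i hi].
  - exact: act1.
  - by rewrite actM => eg ->.
  - rewrite act_s; case: ifP => // hi'; rewrite tr_id //.
      by rewrite cg_nat //; lia.
    by rewrite (_ : i%:Z + 1 = i.+1%:Z) ?cg_nat; lia.
by apply; lia.
Qed.

Lemma tr_translate a b q : tr n (a + q * n%:Z) (b + q * n%:Z) =1 tr n a b.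
Proof.
have e c j : cg n j (c + q * n%:Z) = cg n j c.
  by rewrite ![cg n j _]cg_sym; apply: cgl; apply/cgP; exists q.
by move=> j; rewrite /tr !e; case: ifP => _; [lia | case: ifP => _; lia].
Qed.

Lemma act_s0 : act (dW_s0 n) =1 tr n 0 1.
Proof.
apply: periodic_ext => [||i hi]; [exact: act_periodic | exact: tr_periodic |].
rewrite /dW_s0 actM (actM (dW_x n 1)) act_xV act_x !ifT; try lia.
rewrite act_s1n.
have n1 : cg n n%:Z 1 = false by rewrite (_ : 1 = 1%N%:Z) // cg_nat; lia.
have n0 : cg n n%:Z 0 by apply/cgP; exists 1; lia.
have z1 : cg n 0 1 = false by rewrite -[1]add0r cgS.
have [->|i1] := eqVneq i 1%N.
  rewrite trl trr ?z1 // {2}/xshift cg_refl /xshift.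
  by rewrite (_ : n%:Z + -1 * n%:Z = 0) ?z1 //; lia.
have [->|i2] := eqVneq i n.
  rewrite trr; last by rewrite cg_sym n1.
  rewrite {2}/xshift cg_sym n1 /xshift cg_refl /tr n0; lia.
have h1 : cg n i 1 = false by rewrite (_ : 1 = 1%N%:Z) // cg_nat; lia.
have h2 : cg n i n%:Z = false by rewrite cg_nat; lia.
have h0 : cg n i 0 = false by rewrite cg_sym -(cgl _ n0) cg_sym.
by rewrite !tr_id ?h1 ?h2 ?h0 // /xshift h2 h1.
Qed.

(** Simple reflections indexed by all integers, with [s_0] in the class of [n]: the rotation of the
    affine diagram becomes a shift of the index. *)
Definition sg (k : int) : W := dW_saff n (absz (k %% n%:Z)%Z).

Lemma act_sg k : act (sg k) =1 tr n k (k + 1).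
Proof.
move=> j; rewrite /sg /dW_saff.
set r := absz _; have r_lt : (r < n)%N.
  by rewrite /r; have := @ltz_pmod k n%:Z; have := @modz_ge0 k n%:Z; lia.
have kE : k = r%:Z + (k %/ n%:Z)%Z * n%:Z.
  by have := divz_eq k n%:Z; have := @modz_ge0 k n%:Z; lia.
rewrite [in RHS]kE -addrAC tr_translate; case: eqP => [->|r0].
  exact: act_s0.
by rewrite act_s ifT //; lia.
Qed.

Definition piz (d : int) : W :=
  match d with Posz k => (dW_pi n ^+ k)%g | Negz k => ((dW_pi n)^-1 ^+ k.+1)%g end.

Lemma act_piz d j : act (piz d) j = j + d.
Proof.
have pV i : act (dW_pi n)^-1%g i = i - 1.
  by apply: (@act_injective _ _ (dW_pi n)); rewrite actKV act_dW_pi; lia.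
case: d => k; rewrite /piz.
  elim: k => [|k IHk]; first by rewrite expg0 act1; lia.
  by rewrite expgS actM IHk act_dW_pi; lia.
elim: k => [|k IHk]; first by rewrite expg1 pV; lia.
by rewrite expgS actM IHk pV; lia.
Qed.

Lemma sgK k : (sg k * sg k)%g = 1%g.
Proof. by apply: act_eq1 => j; rewrite actM !act_sg trK // cgS. Qed.

Lemma sg_translate k q : sg (k + q * n%:Z) = sg k.
Proof.
by apply: act_inj => j; rewrite !act_sg -addrAC tr_translate.
Qed.

Lemma sg_conj (g : W) i k : act g i = k -> act g (i + 1) = k + 1 ->
  (g * sg i = sg k * g)%g.
Proof.
move=> e1 e2; apply: act_inj => j; rewrite !actM !act_sg tr_conj ?e1 ?e2 //.
  exact: act_periodic.
exact: act_injective.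
Qed.

(** When [f] grows by [n] and [k] by [K] over a period, [K * f - n * k] is periodic, so the sum does
    not depend on the representatives 1, ..., n. It measures how far [f] is from being proportional
    to [k]. *)
Definition pot (K : int) (k f : int -> int) : int :=
  \sum_(i < n) (K * f i.+1%:Z - n%:Z * k i.+1%:Z) ^+ 2.

Lemma pot_ge0 K k f : 0 <= pot K k f.
Proof. by apply: sumr_ge0 => i _; apply: sqr_ge0. Qed.

Lemma sum_two_residues (F : int -> int) a b : ~~ cg n a b ->
  (forall j, F (j + n%:Z) = F j) ->
  \sum_(i < n) F i.+1%:Z = F a + F b +
    \sum_(i < n | ~~ cg n i.+1%:Z a && ~~ cg n i.+1%:Z b) F i.+1%:Z.
Proof.
move=> ab FP.
have Fcg c d : cg n c d -> F c = F d.
  move=> /cgP[q ->].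
  have FM (m : nat) i : F (i + m%:Z * n%:Z) = F i.
    elim: m => [|m IHm]; first by rewrite mul0r addr0.
    by rewrite -IHm -[RHS]FP; congr F; lia.
  case: q => m; first exact: FM.
  by rewrite -(FM m.+1); congr F; lia.
have [ia ha] := residue a; have [ib hb] := residue b.
have ca (i : 'I_n) : cg n i.+1%:Z a = (i == ia).
  by rewrite -cg_ord cg_sym (cgl _ ha) cg_sym.
have cb (i : 'I_n) : cg n i.+1%:Z b = (i == ib).
  by rewrite -cg_ord cg_sym (cgl _ hb) cg_sym.
rewrite (bigD1 ia) //= (bigD1 ib) /=; last first.
  by rewrite -ca -(cgl _ hb) cg_sym.
rewrite (Fcg a _ ha) (Fcg b _ hb) -addrA; congr (_ + (_ + _)).
by apply: eq_bigl => i; rewrite ca cb.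
Qed.

(** Only the mixed terms of the squares change. For [K > 0] an exchange that puts [f] in the order
    of [k] therefore lowers the potential. *)
Lemma pot_swap K k f f' a b : periodic n f -> periodic n f' ->
  (forall j, k (j + n%:Z) = k j + K) -> ~~ cg n a b ->
  f' a = f b -> f' b = f a ->
  (forall j, ~~ cg n j a -> ~~ cg n j b -> f' j = f j) ->
  pot K k f' = pot K k f + 2 * K * n%:Z * ((k a - k b) * (f a - f b)).
Proof.
move=> fP f'P kP ab ea eb ej; rewrite /pot.
rewrite !(@sum_two_residues (fun j => (K * _ j - n%:Z * k j) ^+ 2) a b) //.
- rewrite ea eb; set S' := \sum_(_ < n | _) _; set S := \sum_(_ < n | _) _.
  have -> : S' = S by apply: eq_bigr => i /andP[ia ib]; rewrite ej.
  ring.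
- by move=> j; rewrite fP kP; ring.
- by move=> j; rewrite f'P kP; ring.
Qed.

Lemma sg_left_swap K k (g : W) i a b : (forall j, k (j + n%:Z) = k j + K) ->
  act g a = i -> act g b = i + 1 ->
  pot K k (act (sg i * g)%g) = pot K k (act g) - 2 * K * n%:Z * (k a - k b).
Proof.
move=> kP ga gb; have ab : ~~ cg n a b.
  by rewrite -(injective_cg (f := act g)) ?ga ?gb ?cgS //;
    [exact: act_periodic | exact: act_injective].
rewrite (@pot_swap K k (act g) _ a b) ?ga ?gb //; try exact: act_periodic.
- by rewrite (_ : i - (i + 1) = -1); [ring | lia].
- by rewrite actM ga act_sg trl.
- by rewrite actM gb act_sg trr // cgS.
- move=> j ja jb; rewrite actM act_sg tr_id //.
    by rewrite -ga injective_cg //; [exact: act_periodic | exact: act_injective].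
  by rewrite -gb injective_cg //; [exact: act_periodic | exact: act_injective].
Qed.

Lemma increasing_lt (f : int -> int) : (forall i, f i < f (i + 1)) ->
  forall i j, (f i < f j) = (i < j).
Proof.
move=> fS; have H (i : int) (d : nat) : f i < f (i + d.+1%:Z).
  elim: d => [|d IHd]; first exact: fS.
  apply: lt_trans IHd _; rewrite (_ : i + d.+2%:Z = i + d.+1%:Z + 1); last lia.
  exact: fS.
have mono (i j : int) : i < j -> f i < f j.
  move=> ij; have -> : j = i + (absz (j - i - 1)%R).+1%:Z by lia.
  exact: H.
move=> i j; have [/mono -> //|/mono h|->] := ltgtP i j; last by rewrite ltxx.
by apply/negbTE; rewrite -leNgt ltW.
Qed.

(** A strictly increasing map gains at least [n] over a period and has exactly [n] to gain, so every
    step is 1. *)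
Lemma increasing_shift (f : int -> int) : periodic n f ->
  (forall i, f i < f (i + 1)) -> forall i, f i = i + f 0.
Proof.
move=> fP fS.
have ge (i : int) (d : nat) : f i + d%:Z <= f (i + d%:Z).
  elim: d => [|d IHd]; first by rewrite !addr0.
  have := fS (i + d%:Z); rewrite (_ : i + d.+1%:Z = i + d%:Z + 1); lia.
have step (i : int) : f (i + 1) = f i + 1.
  have := ge (i + 1) n.-1; have -> : i + 1 + n.-1%:Z = i + n%:Z by lia.
  by rewrite fP; have := fS i; move: hn; lia.
have nat_case (d : nat) : f d%:Z = d%:Z + f 0.
  elim: d => [|d IHd]; first by rewrite add0r.
  by rewrite -[d.+1]addn1 PoszD step IHd; lia.
case=> d; first exact: nat_case.
have : forall k : nat, f (- k%:Z) = - k%:Z + f 0.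
  elim=> [|k IHk]; first by rewrite oppr0 add0r.
  have := step (- k.+1%:Z); rewrite (_ : - k.+1%:Z + 1 = - k%:Z); last lia.
  by rewrite IHk; lia.
by move=> /(_ d.+1); rewrite NegzE.
Qed.

Lemma act_increasing (g : W) : (forall i, act g i < act g (i + 1)) ->
  g = piz (act g 0).
Proof.
move=> h; apply: act_inj => j; rewrite act_piz.
by apply: increasing_shift => //; apply: act_periodic.
Qed.

(** Sorting by adjacent exchanges, each of which lowers the nonnegative integer [pot K k]. This
    turns a reading order of a diagram into a group element. *)
Lemma key_order (K : int) (k : int -> int) : 0 < K -> injective k ->
  (forall j, k (j + n%:Z) = k j + K) ->
  exists g : W, forall p q, (act g p < act g q) = (k p < k q).
Proof.
move=> K0 kI kP.
have H (N : nat) : forall g : W, pot K k (act g) < N%:Z ->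
    exists g : W, forall p q, (act g p < act g q) = (k p < k q).
  elim: N => [|N IHN] g; first by have := pot_ge0 K k (act g); lia.
  have [[i hi]|/forallNP h] := pselect (exists i, k (act g^-1%g (i + 1)) < k (act g^-1%g i)).
    move=> lt; apply: (IHN (sg i * g)%g).
    rewrite (@sg_left_swap K k g i (act g^-1%g i) (act g^-1%g (i + 1))) ?actKV //.
    rewrite -(subr_gt0 (k _)) in hi.
    have : 0 < 2 * K * n%:Z * (k (act g^-1%g i) - k (act g^-1%g (i + 1))).
      by rewrite !mulr_gt0 //; lia.
    by set t := _ * (_ - _); lia.
  move=> _; exists g => p q.
  rewrite -[in RHS](actK g p) -[in RHS](actK g q).
  rewrite (@increasing_lt (fun i => k (act g^-1%g i))) // => i.
  have /negP := h i; rewrite -leNgt le_eqVlt => /orP[/eqP/kI/act_injective|//].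
  lia.
apply: (H (absz (pot K k (act (1%g : W)))).+1 1%g).
by have := pot_ge0 K k (act (1%g : W)); lia.
Qed.

(** After sorting with the key [f] itself, [f] becomes an increasing periodic map, hence a
    translation. *)
Lemma act_surj f : periodic n f -> injective f -> exists g : W, act g =1 f.
Proof.
move=> fP fI; have [|g gE] := @key_order n%:Z f _ fI fP; [lia |].
exists (piz (f (act g^-1%g 0)) * g)%g => j; rewrite actM act_piz.
have := @increasing_shift (fun i => f (act g^-1%g i)) _ _ (act g j).
rewrite actK => -> //= i.
  by rewrite act_periodic fP.
by rewrite -gE !actKV ltrDl.
Qed.

Definition dW_of (f : int -> int) : W := xget 1%g [set g | act g =1 f]%classic.

Lemma act_dW_of f : periodic n f -> injective f -> act (dW_of f) =1 f.
Proof.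
move=> fP fI; rewrite /dW_of; case: xgetP => // h.
by have [g /h] := act_surj fP fI.
Qed.

Definition tg (a b : int) : W := dW_of (tr n a b).

Lemma act_tg a b : ~~ cg n a b -> act (tg a b) =1 tr n a b.
Proof. by move=> ab; apply: act_dW_of; [exact: tr_periodic | exact: tr_inj]. Qed.

Lemma tg_conj (g : W) a b : ~~ cg n a b ->
  (g * tg a b = tg (act g a) (act g b) * g)%g.
Proof.
move=> ab; apply: act_inj => j; rewrite !actM !act_tg //; last first.
  by rewrite injective_cg //; [exact: act_periodic | exact: act_injective].
by rewrite tr_conj //; [exact: act_periodic | exact: act_injective].
Qed.

Lemma tg_sg i : tg i (i + 1) = sg i.
Proof. by apply: act_inj => j; rewrite act_tg ?cgS // act_sg. Qed.

Lemma tgC a b : ~~ cg n a b -> tg a b = tg b a.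
Proof.
move=> ab; apply: act_inj => j; rewrite !act_tg //; last by rewrite cg_sym.
by rewrite trC.
Qed.

Lemma tgK a b : ~~ cg n a b -> (tg a b * tg a b)%g = 1%g.
Proof. by move=> ab; apply: act_eq1 => j; rewrite actM !act_tg // trK. Qed.

(** The words need not be reduced: an upper bound for the length suffices for the inductions. *)
Inductive sg_word : nat -> W -> Prop :=
| sg_word0 d : sg_word 0 (piz d)
| sg_wordS k N g : sg_word N g -> sg_word N.+1 (sg k * g)%g.

Lemma sg_word_exists (g : W) : exists N, sg_word N g.
Proof.
have [N] : exists N : nat, pot n id (act g) < N%:Z.
  by exists (absz (pot n id (act g))).+1; have := pot_ge0 n id (act g); lia.
elim: N g => [|N IHN] g; first by have := pot_ge0 n id (act g); lia.
have [[i hi]|/forallNP h] := pselect (exists i, act g^-1%g (i + 1) < act g^-1%g i).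
  move=> lt; have [|M hM] := IHN (sg i * g)%g.
    rewrite (@sg_left_swap n id g i (act g^-1%g i) (act g^-1%g (i + 1))) ?actKV //.
    rewrite -(subr_gt0 (act _ _)) in hi.
    have : 0 < 2 * n%:Z * n%:Z * (act g^-1%g i - act g^-1%g (i + 1)).
      by rewrite !mulr_gt0 //; lia.
    by rewrite /=; set t := _ * (_ - _); lia.
  by exists M.+1; rewrite -[g]mul1g -(sgK i) -mulgA; apply: sg_wordS.
move=> _; exists 0%N.
have -> : g = piz (- act g^-1%g 0); last exact: sg_word0.
apply: invg_inj; rewrite [LHS]act_increasing.
  by apply/esym/mulg1_eq; apply: act_eq1 => j; rewrite actM !act_piz -addrA ?subrr ?addNr addr0.
move=> i; have /negP := h i; rewrite -leNgt le_eqVlt => /orP[/eqP/act_injective|//].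
lia.
Qed.

(* The exchange condition: the two strands [j] and [j + 1] cross at exactly one
   letter of the word that can be deleted. *)
Lemma sg_word_exchange N (g : W) j : sg_word N g -> act g (j + 1) < act g j ->
  exists2 M, (M < N)%N & sg_word M (g * sg j)%g.
Proof.
elim=> [d|k {}N h hN IH]; first by rewrite !act_piz; lia.
move=> lt; have [lt'|ge] := ltP (act h (j + 1)) (act h j).
  by have [M MN hM] := IH lt'; exists M.+1; rewrite // -mulgA; apply: sg_wordS.
exists N => //.
have neq : act h (j + 1) != act h j.
  by apply/eqP => /act_injective; lia.
have e : cg n (act h j) k /\ act h (j + 1) = act h j + 1.
  move: lt; rewrite !actM !act_sg /tr.
  case: ifP => c1; first case: ifP => c2; first lia.
    by case: ifP => c3; lia.
  case: ifP => c2; first by case: ifP => c3; [lia | case: ifP; lia].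
  by case: ifP => c3; [lia | case: ifP => c4; lia].
suff -> : (sg k * h * sg j = h)%g by [].
have [/cgP[q kE] e'] := e.
rewrite -mulgA (@sg_conj h j (act h j)) // kE sg_translate mulgA sgK mul1g //.
Qed.

End AffineElements.

(** * Weights of modules *)

Section AlgebraRelations.
Context (C : numFieldType) (n kappa : nat) {n_ge2 : atleast2 n}.
Let hn : (2 <= n)%N := n_ge2.
Variable H : daha C n kappa.

Local Notation T := (dahaW H).

(* The variables u_k are extended to all integers k by u_(k+n) = u_k - kappa. *)
Definition uext (k : int) : {mpoly C[n]} :=
  uvar C n (absz ((k - 1) %% n%:Z)%Z).+1 - (kappa%:Z * ((k - 1) %/ n%:Z)%Z)%:~R.

Definition uZ (k : int) : H := dahaU H (uext k).

Lemma uextE (i : nat) (q : int) : (1 <= i <= n)%N ->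
  uext (i%:Z + q * n%:Z) = uvar C n i - (kappa%:Z * q)%:~R.
Proof.
move=> hi; rewrite /uext.
have -> : i%:Z + q * n%:Z - 1 = q * n%:Z + i.-1%:Z by lia.
rewrite divzMDl ?modzMDl; last lia.
rewrite divz_small ?modz_small ?addr0; try lia.
by congr (uvar _ _ _ - _); lia.
Qed.

Local Notation U := uZ.

Lemma uext_period k : uext (k + n%:Z) = uext k - kappa%:R.
Proof.
have [i /cgP[q ->]] := residue (n := n) k; have := ltn_ord i => ilt.
rewrite -addrA (_ : q * n%:Z + n%:Z = (q + 1) * n%:Z); last by lia.
rewrite !uextE; try lia.
by rewrite mulrDr mulr1 intrD opprD addrA.
Qed.

Lemma U_period k : U (k + n%:Z) = U k - kappa%:R.
Proof. by rewrite /uZ uext_period rmorphB rmorph_nat. Qed.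

Lemma U_nat (i : nat) (q : int) : (1 <= i <= n)%N ->
  U (i%:Z + q * n%:Z) = dahaU H (uvar C n i) - (kappa%:Z * q)%:~R.
Proof. by move=> hi; rewrite /uZ uextE // rmorphB rmorph_int. Qed.

Lemma intC (z : int) (a : H) : z%:~R * a = a * z%:~R.
Proof. by rewrite mulrzl mulrzr. Qed.

Lemma T_sgU k : T (sg n k) * U k = U (k + 1) * T (sg n k) - 1.
Proof.
have kE := divz_eq k n%:Z; set q := (k %/ n%:Z)%Z in kE.
have r_lt : (absz (k %% n%:Z)%Z < n)%N.
  by have := @ltz_pmod k n%:Z; have := @modz_ge0 k n%:Z; lia.
have r_abs : (k %% n%:Z)%Z = absz (k %% n%:Z)%Z.
  by rewrite gez0_abs // modz_ge0; lia.
rewrite /sg /dW_saff; set r := absz _ in r_abs r_lt *.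
rewrite r_abs in kE; case: eqP => [r0|/eqP r0].
  rewrite (_ : k = n%:Z + (q - 1) * n%:Z); last by rewrite kE r0; lia.
  rewrite U_nat; last lia.
  rewrite (_ : n%:Z + (q - 1) * n%:Z + 1 = 1%N%:Z + q * n%:Z); last lia.
  rewrite U_nat; last lia.
  rewrite mulrBr daha_s0u -intC mulrBr mulr1 intrB !mulrBl /=.
  by rewrite opprB addrA [_ - 1 + _]addrAC subrK addrAC.
rewrite (_ : k = r%:Z + q * n%:Z); last by rewrite kE; lia.
rewrite (_ : r%:Z + q * n%:Z + 1 = r.+1%:Z + q * n%:Z); last lia.
rewrite !U_nat; try lia.
rewrite mulrBr daha_su -?intC ?mulrBl; last lia.
by rewrite addrAC.
Qed.

Lemma T_sgUC k j : ~~ cg n j k -> ~~ cg n j (k + 1) ->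
  T (sg n k) * U j = U j * T (sg n k).
Proof.
move=> jk jk1; have [i jE] := residue (n := n) j; have := ltn_ord i => ilt.
have kE := divz_eq k n%:Z; set q := (k %/ n%:Z)%Z in kE.
have r_lt : (absz (k %% n%:Z)%Z < n)%N.
  by have := @ltz_pmod k n%:Z; have := @modz_ge0 k n%:Z; lia.
have r_abs : (k %% n%:Z)%Z = absz (k %% n%:Z)%Z.
  by rewrite gez0_abs // modz_ge0; lia.
rewrite /sg; set r := absz _ in r_abs r_lt *.
rewrite r_abs in kE; have [p ->] := cgP _ _ jE.
have kr : cg n k r by apply/cgP; exists q; rewrite kE; lia.
have cgmod (a b : nat) : cg n a b = (a == b %[mod n])%N.
  by rewrite /cg -eqz_mod_dvd -eqz_nat -!modz_nat.
rewrite U_nat; last lia.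
rewrite mulrBr mulrBl -intC; congr (_ - _).
apply: daha_suC => //.
  by rewrite -cgmod -(cgl _ jE) cg_sym -(cgl _ kr) cg_sym.
rewrite -cgmod -(cgl _ jE) (_ : r.+1%:Z = r%:Z + 1); last lia.
by rewrite cg_sym -(cgl _ (_ : cg n (k + 1) _)) ?cgDr // cg_sym.
Qed.

Lemma T_piU k : T (dW_pi n) * U k = U (k + 1) * T (dW_pi n).
Proof.
have TK (a b : H) : T (dW_pi n) * a * T (dW_pi n)^-1%g = b ->
    T (dW_pi n) * a = b * T (dW_pi n).
  by move=> <-; rewrite -!mulrA -dahaWM mulVg dahaW1 mulr1.
have [i /cgP[q ->]] := residue (n := n) k; have := ltn_ord i => ilt.
have [lt|ge] := ltnP i.+1 n.
  rewrite (_ : i.+1%:Z + q * n%:Z + 1 = i.+2%:Z + q * n%:Z); last lia.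
  rewrite !U_nat; try lia.
  by rewrite mulrBr mulrBl -intC; congr (_ - _); apply/TK/daha_piu; lia.
rewrite (_ : i.+1 = n); last lia.
rewrite (_ : n%:Z + q * n%:Z + 1 = 1%N%:Z + (q + 1) * n%:Z); last lia.
rewrite !U_nat; try lia.
rewrite mulrBr -intC (TK _ _ (daha_piun H)) -mulrBl; congr (_ * _).
by rewrite mulrDr mulr1 intrD opprD [- _ - _]addrC addrA.
Qed.

Lemma T_pizU d k : T (piz n d) * U k = U (k + d) * T (piz n d).
Proof.
have TV i : T (dW_pi n)^-1%g * U i = U (i - 1) * T (dW_pi n)^-1%g.
  rewrite -[LHS]mulr1 -dahaW1 -(mulgV (dW_pi n)) dahaWM !mulrA; congr (_ * _).
  rewrite -mulrA -{1}(subrK 1 i) -T_piU mulrA -dahaWM mulVg dahaW1 mul1r //.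
case: d => d; rewrite /piz.
  elim: d k => [|d IHd] k; first by rewrite expg0 dahaW1 addr0 mulr1 mul1r.
  rewrite expgS dahaWM -mulrA IHd mulrA T_piU -mulrA; congr (U _ * _); lia.
elim: d k => [|d IHd] k; first by rewrite expg1 TV.
rewrite expgS dahaWM -mulrA IHd mulrA TV -mulrA; congr (U _ * _); lia.
Qed.

(** All relations between reflections and the [u_i] in one formula, so that a word can be crossed
    letter by letter without a case for [s_0]. *)
Lemma U_T_sg i k :
  U i * T (sg n k) = T (sg n k) * U (tr n k (k + 1) i)
    + ((cg n i (k + 1))%:Z - (cg n i k)%:Z)%:~R.
Proof.
have UM (q i' : int) : U (i' + q * n%:Z) = U i' - (kappa%:Z * q)%:~R.
  have [j /cgP[r ->]] := residue (n := n) i'; have := ltn_ord j => jlt.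
  rewrite -addrA -mulrDl !U_nat; try lia.
  by rewrite mulrDr intrD opprD addrA.
have [/cgP[q ->]|ik] := boolP (cg n i k).
  have e : cg n (k + q * n%:Z) k by apply/cgP; exists q.
  rewrite (cgl _ e) cgS /tr e.
  rewrite (_ : k + q * n%:Z - k + (k + 1) = k + 1 + q * n%:Z); last lia.
  rewrite !UM mulrBl mulrBr -intC.
  rewrite -[T (sg n k) * U (k + 1)]mulr1 -dahaW1 -(sgK k) dahaWM.
  rewrite -[T _ * _ * _]mulrA [U _ * (_ * _)]mulrA.
  rewrite -[U (k + 1) * T (sg n k)](subrK 1) -T_sgU mulrDl mul1r mulrDr.
  rewrite !mulrA -dahaWM sgK dahaW1 mul1r mulrN1z.
  by rewrite [in RHS]addrAC addrK.
have [/cgP[q ->]|ik1] := boolP (cg n i (k + 1)).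
  have e : cg n (k + 1 + q * n%:Z) (k + 1) by apply/cgP; exists q.
  have e' : cg n (k + 1 + q * n%:Z) k = false by rewrite (cgl _ e) cg_sym cgS.
  rewrite /tr e e'.
  rewrite (_ : k + 1 + q * n%:Z - (k + 1) + k = k + q * n%:Z); last lia.
  by rewrite !UM mulrBl mulrBr -intC T_sgU addrAC subrK.
by rewrite tr_id // T_sgUC // subrr addr0.
Qed.

End AlgebraRelations.

(** * Weight vectors and the module generated by one of them *)

Section WeightModules.
Context (C : numFieldType) (n kappa : nat) {n_ge2 : atleast2 n}.
Let hn : (2 <= n)%N := n_ge2.
Variable H : daha C n kappa.
Variable V : lmodType H.

Local Notation T := (dahaW H).
Local Notation U := (uZ H).
Local Notation W := (dW n).

(* [V] is a module over the ring [H]; complex scalars act through [H]. *)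
Definition sc (c : C) (x : V) : V := (c%:A : H) *: x.

Lemma scDr c x y : sc c (x + y) = sc c x + sc c y.
Proof. exact: scalerDr. Qed.

Lemma scBr c x y : sc c (x - y) = sc c x - sc c y.
Proof. exact: scalerBr. Qed.

Lemma sc0r c : sc c 0 = 0.
Proof. exact: scaler0. Qed.

Lemma scDl c d x : sc (c + d) x = sc c x + sc d x.
Proof. by rewrite /sc !scalerDl. Qed.

Lemma scNl c x : sc (- c) x = - sc c x.
Proof. by rewrite /sc !scaleNr. Qed.

Lemma scBl c d x : sc (c - d) x = sc c x - sc d x.
Proof. by rewrite scDl scNl. Qed.

Lemma sc0l x : sc 0 x = 0.
Proof. by rewrite /sc scale0r scale0r. Qed.

Lemma sc1l x : sc 1 x = x.
Proof. by rewrite /sc scale1r scale1r. Qed.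

Lemma scA c d x : sc c (sc d x) = sc (c * d) x.
Proof. by rewrite /sc scalerA mulr_algl scalerA. Qed.

Lemma sc_comm (h : H) c x : h *: sc c x = sc c (h *: x).
Proof. by rewrite /sc !scalerA mulr_algl mulr_algr. Qed.

Lemma sc_int z x : sc z%:~R x = z%:~R *: x.
Proof. by rewrite /sc (scaler_int z (1 : H)). Qed.

Lemma sc_inj c x : c != 0 -> sc c x = 0 -> x = 0.
Proof. by move=> c0 e; rewrite -[x]sc1l -(mulVf c0) -scA e sc0r. Qed.

Definition wt (chi : int -> int) (x : V) : Prop :=
  forall k, U k *: x = sc (chi k)%:~R x.

Lemma wt_linear chi c x y : wt chi x -> wt chi y -> wt chi (sc c x + y).
Proof.
move=> wx wy k; rewrite scalerDr sc_comm wx wy scDr; congr (_ + _).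
by rewrite !scA mulrC.
Qed.

Lemma wt_ext chi psi x : chi =1 psi -> wt chi x -> wt psi x.
Proof. by move=> e w k; rewrite w e. Qed.

Lemma wt_period chi x k : x != 0 -> wt chi x -> chi (k + n%:Z) = chi k - kappa%:Z.
Proof.
move=> x0 wx; apply/eqP; rewrite -subr_eq0; apply/eqP/(@intr_inj C).
apply/eqP; apply: contraT => c0; case/negP: x0; apply/eqP/(sc_inj c0).
rewrite rmorphB /= scBl -wx U_period scalerBl wx.
by rewrite rmorphB /= scBl [sc (kappa%:~R) _]sc_int pmulrn subrr.
Qed.

Lemma wt_of_range chi x :
  (forall k, chi (k + n%:Z) = chi k - kappa%:Z) ->
  (forall i : nat, (1 <= i <= n)%N -> U i *: x = sc (chi i)%:~R x) -> wt chi x.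
Proof.
move=> chiP h k; have [i ki] := residue (n := n) k; have := ltn_ord i => ilt.
have chiM (q : nat) j : (U (j + q%:Z * n%:Z) *: x = sc (chi (j + q%:Z * n%:Z))%:~R x)
    <-> (U j *: x = sc (chi j)%:~R x).
  elim: q => [|q IHq]; first by rewrite mul0r !addr0.
  rewrite -IHq (_ : j + q.+1%:Z * n%:Z = j + q%:Z * n%:Z + n%:Z); last lia.
  rewrite U_period chiP scalerBl rmorphB /= scBl [sc (kappa%:~R) _]sc_int pmulrn.
  by split=> [/addIr //|->].
have [[q|q] kE] := cgP _ _ ki; first by rewrite kE; apply/chiM/h; lia.
apply/(chiM q.+1 k); rewrite kE (_ : _ + _ + _ = i.+1%:Z); last lia.
by apply: h; lia.
Qed.

Definition weight_eval (chi : int -> int) (p : {mpoly C[n]}) : C :=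
  p.@[fun i : 'I_n => (chi i.+1%:Z)%:~R].

Lemma uext_ord (i : 'I_n) : uext C n kappa i.+1%:Z = 'X_i.
Proof.
rewrite -[i.+1%:Z]addr0 -(mul0r n%:Z) uextE; last by have := ltn_ord i; lia.
by rewrite mulr0 subr0 /uvar (big_pred1 i) // => k; rewrite eqSS.
Qed.

Lemma wt_poly chi x p : wt chi x -> dahaU H p *: x = sc (weight_eval chi p) x.
Proof.
move=> wx; rewrite /weight_eval.
have mon (m : 'X_{1..n}) : dahaU H 'X_[m] *: x =
    sc ('X_[m].@[fun i : 'I_n => (chi i.+1%:Z)%:~R]) x.
  rewrite mpolyXE_id; elim/big_ind: _ => [|p1 p2 IH1 IH2|i _].
  - by rewrite !rmorph1 scale1r sc1l.
  - by rewrite !rmorphM -scalerA IH2 sc_comm IH1 scA mulrC.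
  - elim: (m i) => [|d IHd]; first by rewrite !expr0 !rmorph1 scale1r sc1l.
    rewrite exprS !rmorphM -scalerA IHd sc_comm /= mevalXU -uext_ord.
    by rewrite -[dahaU H _]/(uZ H i.+1%:Z) wx scA mulrC.
elim/mpolyind: p => [|c m p _ _ IHp]; first by rewrite !rmorph0 scale0r sc0l.
rewrite rmorphD /= scalerDl IHp linearZ /= -mulr_algl -scalerA mon.
by rewrite mevalD scDl mevalZ -scA.
Qed.

Definition subsp (E : V -> Prop) : Prop :=
  E 0 /\ forall c x y, E x -> E y -> E (sc c x + y).

Lemma subspZ E c x : subsp E -> E x -> E (sc c x).
Proof. by move=> [E0 EL] Ex; rewrite -[sc c x]addr0; apply: EL. Qed.

Lemma subspD E x y : subsp E -> E x -> E y -> E (x + y).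
Proof. by move=> [_ EL] Ex Ey; rewrite -[x]sc1l; apply: EL. Qed.

(** By the PBW property an element of [H] is a sum of terms [T w * p(u)], and [p(u)] acts on [v] by
    a scalar. *)
Lemma span_ind chi v (E : V -> Prop) : wt chi v -> subsp E ->
  (forall g, E (T g *: v)) -> forall h : H, E (h *: v).
Proof.
move=> wv ES Eg h; have [f' _ /(_ h) <-] := daha_pbw H.
set f := f' h; rewrite scaler_suml; elim/big_ind: _ => [|x y|g _].
- by case: ES.
- exact: subspD.
- by rewrite -scalerA (wt_poly _ wv) sc_comm; apply: subspZ.
Qed.

Section CyclicVector.
Variables (chi : int -> int) (v : V) (J : int -> Prop) (eps : C).
Hypothesis wv : wt chi v.
Hypothesis Jv : forall j, J j -> T (sg n j) *: v = sc eps v.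

Definition J_increasing (g : W) : Prop := forall j, J j -> act g j < act g (j + 1).

(** The span of the vectors [T g *: v] for words shorter than [N], encoded as the intersection of
    all subspaces containing them. *)
Let fil N x := forall E, subsp E ->
  (forall M g, (M < N)%N -> sg_word M g -> E (T g *: v)) -> E x.

(** Triangularity: when [U k] crosses a reflection, the correction term is the word with that letter
    deleted. *)
Let U_fil N g : sg_word N g -> forall k,
  fil N (U k *: (T g *: v) - sc (chi (act g^-1%g k))%:~R (T g *: v)).
Proof.
elim=> [d|i {}N {}g hN IH] k.
  have -> : act (piz n d)^-1%g k = k - d.
    by apply: (@act_injective _ _ (piz n d)); rewrite actKV act_piz subrK.
  rewrite scalerA -{1}(subrK d k) -T_pizU -scalerA wv sc_comm subrr.
  by move=> E [].
rewrite scalerA dahaWM mulrA U_T_sg mulrDl scalerDl -!scalerA.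
rewrite -sc_int -addrAC -sc_comm -scalerBr invgM actM.
have -> : act (sg n i)^-1%g k = tr n i (i + 1) k.
  by apply: (@act_injective _ _ (sg n i)); rewrite actKV act_sg trK ?cgS.
move=> E ES EN; apply: subspD => //; last by apply: subspZ => //; apply: EN hN.
apply: (IH _ (fun x => E (T (sg n i) *: x))).
  split=> [|c x y Ex Ey]; first by rewrite scaler0; case: ES.
  by rewrite scalerDr sc_comm; case: ES => _; apply.
move=> M h MN hM; rewrite scalerA -dahaWM.
by apply: (EN M.+1) => //; apply: sg_wordS.
Qed.

(* The vectors g v span the submodule generated by v.  A word g that
   is not increasing on J can be shortened, and for the others (u_k - chi(g^-1 k))
   g v is a combination of shorter words. *)
Lemma cyclic_ind (E : V -> Prop) : subsp E -> E v ->
  (forall g, J_increasing g -> g <> 1%g -> forall x,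
     (forall k, E (U k *: x - sc (chi (act g^-1%g k))%:~R x)) -> E x) ->
  forall h : H, E (h *: v).
Proof.
move=> ES Ev Eext; apply: (span_ind wv ES) => g.
have [N] := sg_word_exists g; elim/ltn_ind: N g => N IHN g hN.
have [Jg|nJ] := pselect (J_increasing g).
  have [->|g1] := pselect (g = 1%g); first by rewrite dahaW1 scale1r.
  apply: (Eext g) => // k; apply: (U_fil hN) => // M h MN hM.
  exact: IHN hM.
have [j jP] : exists j, ~ (J j -> act g j < act g (j + 1)).
  by apply/existsNP => h; apply: nJ.
move/not_implyP: jP => [Jj /negP]; rewrite -leNgt le_eqVlt.
move=> /orP[/eqP/act_injective|lt]; first lia.
have [M MN hM] := sg_word_exchange hN lt.
have := IHN M MN _ hM; rewrite dahaWM -scalerA (Jv Jj) sc_comm => Eg.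
(* The exchange only provides [eps] times the wanted vector. Since a reflection is an involution,
   [eps * eps] acts on [v] as 1. *)
have e2 : sc (eps * eps) v = v.
  by rewrite -scA -(Jv Jj) -sc_comm -(Jv Jj) scalerA -dahaWM sgK dahaW1 scale1r.
rewrite -e2 -scA !sc_comm; exact: subspZ.
Qed.

End CyclicVector.

(* The vectors that are annihilated by some product of factors u_k - lambda(k)
   with all lambda in P, whatever the choice of the indices k. *)
Inductive killed (P : (int -> int) -> Prop) : V -> Prop :=
| killed0 : killed P 0
| killedS lam x : P lam ->
    (forall k, killed P (U k *: x - sc (lam k)%:~R x)) -> killed P x.

Lemma U_comm j k : U j * U k = U k * U j.
Proof. by rewrite /uZ -!rmorphM mulrC. Qed.

Lemma U_sub_comm j k a b x :
  U j *: (U k *: x - sc a x) - sc b (U k *: x - sc a x) =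
  U k *: (U j *: x - sc b x) - sc a (U j *: x - sc b x).
Proof.
rewrite !scalerBr !scBr !sc_comm !scalerA U_comm !scA [b * a]mulrC.
rewrite !opprB !addrA [LHS]addrAC [RHS]addrAC; congr (_ + _).
by rewrite addrAC.
Qed.

Lemma killed_U P j b x : killed P x -> killed P (U j *: x - sc b x).
Proof.
move=> Kx; elim: Kx j b => [|lam {}x Pl _ IH] j b.
  by rewrite scaler0 sc0r subrr; apply: killed0.
by apply: (killedS Pl) => k; rewrite U_sub_comm; apply: IH.
Qed.

Lemma killedZ P c x : killed P x -> killed P (sc c x).
Proof.
elim=> [|lam {}x Pl _ IH]; first by rewrite sc0r; apply: killed0.
apply: (killedS Pl) => k; have := IH k; rewrite sc_comm scBr.
by rewrite !scA [c * _]mulrC.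
Qed.

Lemma killedD P x y : killed P x -> killed P y -> killed P (x + y).
Proof.
move=> Kx; elim: Kx y => [|lam {}x Pl _ IH] y Ky; first by rewrite add0r.
apply: (killedS Pl) => k; rewrite scalerDr scDr opprD addrACA.
by apply: IH; apply: killed_U.
Qed.

Lemma killed_subsp P : subsp (killed P).
Proof.
split=> [|c x y Kx Ky]; first exact: killed0.
by apply: killedD => //; apply: killedZ.
Qed.

Lemma wt_U_sub psi x k a : wt psi x ->
  U k *: x - sc a x = sc ((psi k)%:~R - a) x.
Proof. by move=> wx; rewrite wx scBl. Qed.

Lemma wt_sc psi c x : wt psi x -> wt psi (sc c x).
Proof.
by move=> wx; rewrite -[sc c x]addr0; apply: wt_linear => // k; rewrite scaler0 sc0r.
Qed.

Lemma killed_weight P psi x : killed P x -> x != 0 -> wt psi x ->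
  exists2 lam, P lam & lam =1 psi.
Proof.
elim=> [|lam {}x Pl _ IH] x0 wx; first by rewrite eqxx in x0.
have [e|/existsNP[k /eqP ne]] := pselect (forall k, lam k = psi k); first by exists lam.
apply: (IH k); rewrite (wt_U_sub _ _ wx); last exact: wt_sc.
apply: contra x0 => /eqP /sc_inj ->; rewrite // -rmorphB intr_eq0 subr_eq0.
by rewrite eq_sym.
Qed.

Lemma killed_eigenvector P x : killed P x -> x != 0 ->
  exists (h : H) lam, [/\ P lam, h *: x != 0 & wt lam (h *: x)].
Proof.
elim=> [|lam {}x Pl _ IH] x0; first by rewrite eqxx in x0.
have [e|/existsNP[k /eqP ne]] :=
    pselect (forall k, U k *: x - sc (lam k)%:~R x = 0).
  exists 1, lam; rewrite !scale1r; split=> // k.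
  by apply/eqP; rewrite -subr_eq0 e.
have [h [mu [Pm h0 wh]]] := IH k ne.
exists (h * (U k - ((lam k)%:~R : C)%:A)), mu.
by rewrite -scalerA scalerBl.
Qed.

(* The sum of the generalized weight spaces for the weights other than chi. *)
Definition off_weight chi (x : V) : Prop :=
  exists2 p, weight_eval chi p != 0 & dahaU H p *: x = 0.

Lemma off_weight_subsp chi : subsp (off_weight chi).
Proof.
split=> [|c x y [p p0 px] [q q0 qy]].
  by exists 1; rewrite ?scaler0 // /weight_eval rmorph1 oner_neq0.
exists (p * q); first by rewrite /weight_eval rmorphM mulf_neq0.
rewrite scalerDr {1}mulrC !rmorphM -!scalerA qy scaler0 addr0 sc_comm px.
by rewrite sc0r scaler0.
Qed.

(** The polynomial [u_k - c] does not vanish at [chi], so it can be multiplied into the annihilating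
    polynomial. *)
Lemma off_weight_U chi k c x : (chi k)%:~R != c ->
  off_weight chi (U k *: x - sc c x) ->
  (forall k, chi (k + n%:Z) = chi k - kappa%:Z) -> off_weight chi x.
Proof.
move=> ne [p p0 px] chiP.
have UE : weight_eval chi (uext C n kappa k) = (chi k)%:~R.
  have [i /cgP[q ->]] := residue (n := n) k; have := ltn_ord i => ilt.
  have chiM (m : nat) j : chi (j + m%:Z * n%:Z) = chi j - m%:Z * kappa%:Z.
    elim: m => [|m IHm]; first by rewrite !mul0r addr0 subr0.
    rewrite (_ : j + m.+1%:Z * n%:Z = j + m%:Z * n%:Z + n%:Z); last lia.
    by rewrite chiP IHm; lia.
  have -> : chi (i.+1%:Z + q * n%:Z) = chi i.+1%:Z - q * kappa%:Z.
    case: q => q; first exact: chiM.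
    have := chiM q.+1 (i.+1%:Z + Negz q * n%:Z).
    by rewrite (_ : _ + _ + _ = i.+1%:Z); lia.
  have e := @uext_ord i; rewrite -[i.+1%:Z]addr0 -(mul0r n%:Z) uextE in e; last lia.
  rewrite uextE; last lia.
  rewrite mulr0 subr0 in e; rewrite e /weight_eval rmorphB /= mevalXU rmorph_int.
  by rewrite rmorphB /= [q * _]mulrC.
exists (p * (uext C n kappa k - c%:MP)).
  rewrite /weight_eval rmorphM mulf_neq0 // rmorphB /= mevalC subr_eq0.
  by rewrite -/(weight_eval chi _) UE.
have cE : dahaU H c%:MP = c%:A by rewrite -[c%:MP]mulr1 mul_mpolyC linearZ /= rmorph1.
by rewrite rmorphM -scalerA rmorphB /= scalerBl cE.
Qed.

End WeightModules.

(** * Skew diagrams and tableaux *)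

Section LabelledDiagram.
Context (n : nat) {n_ge2 : atleast2 n}.
Let hn : (2 <= n)%N := n_ge2.
Local Notation W := (dW n).

(* A periodic skew diagram described through the labels of its boxes in the
   row reading tableau. *)
Record labelling (m l : int) (row col : int -> int) (lab : int -> int -> int) : Prop := {
  lb_m : 0 < m;
  lb_l : 0 <= l;
  lb_row : forall i, row (i + n%:Z) = row i + m;
  lb_col : forall i, col (i + n%:Z) = col i - l;
  lb_lex : forall i j, i < j -> row i < row j \/ row i = row j /\ col i < col j;
  lb_skew : forall i j a b, row i <= a <= row j -> col i <= b <= col j ->
    row (lab a b) = a /\ col (lab a b) = b
}.

Variables (m l : int) (row col : int -> int) (lab : int -> int -> int).
Hypothesis L : labelling m l row col lab.

Definition cont (i : int) : int := col i - row i.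

Lemma cont_period (i : int) : cont (i + n%:Z) = cont i - (m + l).
Proof. by rewrite /cont (lb_row L) (lb_col L); lia. Qed.

Lemma lab_inj (i j : int) : row i = row j -> col i = col j -> i = j.
Proof. by case: (ltgtP i j) => // /(lb_lex L); lia. Qed.

Lemma lab_lt (i j : int) : row i < row j \/ row i = row j /\ col i < col j -> i < j.
Proof. by case: (ltgtP i j) => // [/(lb_lex L)|->]; lia. Qed.

Lemma labK (i : int) : lab (row i) (col i) = i.
Proof. by have [] := @lb_skew _ _ _ _ _ L i i (row i) (col i); rewrite ?lexx //; apply: lab_inj. Qed.

Lemma row_le (i j : int) : i <= j -> row i <= row j.
Proof. by rewrite le_eqVlt => /predU1P[->//|/(lb_lex L)]; lia. Qed.

Lemma row_next (i j : int) : row j = row i -> col j = col i + 1 -> j = i + 1.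
Proof.
move=> rE cE; have ij : i < j by apply: lab_lt; lia.
have [//|ne] := eqVneq j (i + 1).
have /(lb_lex L) h1 : i < i + 1 by lia.
have /(lb_lex L) h2 : i + 1 < j by lia.
lia.
Qed.

Lemma row_succ (i : int) : row (i + 1) = row i -> col (i + 1) = col i + 1.
Proof.
move=> rE; have /(lb_lex L) h : i < i + 1 by lia.
have [||r c] := @lb_skew _ _ _ _ _ L i (i + 1) (row i) (col i + 1); try lia.
by rewrite -(row_next r c).
Qed.

Lemma cont_inj (i j : int) : cont i = cont j -> row i = row j -> i = j.
Proof. by rewrite /cont => c r; apply: lab_inj => //; lia. Qed.

Lemma cont_lt_row (i j : int) : cont i = cont j -> i < j -> row i < row j.
Proof. by rewrite /cont => c /(lb_lex L); lia. Qed.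

(** A box of the same diagonal in a higher row would, by skewness, force a box to the left of
    [p]. *)
Lemma row_start_min (p q : int) : row (p - 1) != row p -> cont q = cont p ->
  row p <= row q.
Proof.
rewrite /cont => st c; rewrite leNgt; apply/negP => lt.
have [||r c'] := @lb_skew _ _ _ _ _ L q p (row p) (col p - 1); try lia.
have e : p = lab (row p) (col p - 1) + 1 by apply: row_next; lia.
by move: st; rewrite {1}e addrK r eqxx.
Qed.

Lemma row_end_max (p q : int) : row (p + 1) != row p -> cont q = cont p ->
  row q <= row p.
Proof.
rewrite /cont => st c; rewrite leNgt; apply/negP => lt.
have [||r c'] := @lb_skew _ _ _ _ _ L p q (row p) (col p + 1); try lia.
have e : lab (row p) (col p + 1) = p + 1 by apply: row_next; lia.
by move: st; rewrite -e r eqxx.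
Qed.

Definition row_adj (i : int) : Prop := row (i + 1) = row i.

(* Along a row, row (g p) - row p is nondecreasing; it is nonnegative at the
   start of the row and nonpositive at its end. *)
Lemma row_increasing_cont_eq1 (g : W) : J_increasing row_adj g ->
  (forall p, cont (act g p) = cont p) -> g = 1%g.
Proof.
move=> Jg gc; have m0 := lb_m L.
have ge (N : nat) : forall p, row (p - N%:Z) < row p -> row p <= row (act g p).
  elim: N => [|N IHN] p; first by rewrite subr0 ltxx.
  have [e|ne] := eqVneq (row (p - 1)) (row p); last first.
    by move=> _; apply: row_start_min.
  rewrite (_ : p - N.+1%:Z = p - 1 - N%:Z); last lia.
  rewrite -{1}e => /IHN; rewrite e => /le_trans; apply; apply: row_le.
  have := Jg (p - 1); rewrite /row_adj subrK => /(_ (esym e)); lia.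
have le (N : nat) : forall p, row p < row (p + N%:Z) -> row (act g p) <= row p.
  elim: N => [|N IHN] p; first by rewrite addr0 ltxx.
  have [e|ne] := eqVneq (row (p + 1)) (row p); last first.
    by move=> _; apply: row_end_max.
  rewrite (_ : p + N.+1%:Z = p + 1 + N%:Z); last lia.
  rewrite -{1}e => /IHN; rewrite e; apply: le_trans; apply: row_le.
  by have := Jg p e; lia.
apply: act_eq1 => p; apply: cont_inj => //; apply/eqP; rewrite eq_le.
have h1 : row p < row (p + n%:Z) by rewrite (lb_row L); lia.
have h2 : row (p - n%:Z) < row p.
  have e : p - n%:Z + n%:Z = p by lia.
  by have := lb_row L (p - n%:Z); rewrite e; lia.
by rewrite (le n _ h1) (ge n _ h2).
Qed.

Lemma cont_translate (q p : int) : cont (p + q * n%:Z) = cont p - q * (m + l).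
Proof.
have nat_case (k : nat) (i : int) : cont (i + k%:Z * n%:Z) = cont i - k%:Z * (m + l).
  elim: k => [|k IHk]; first by rewrite !mul0r addr0 subr0.
  rewrite (_ : i + k.+1%:Z * n%:Z = i + k%:Z * n%:Z + n%:Z); last lia.
  by rewrite cont_period IHk; lia.
case: q => k; first exact: nat_case.
have := nat_case k.+1 (p + Negz k * n%:Z).
rewrite (_ : p + Negz k * n%:Z + k.+1%:Z * n%:Z = p); lia.
Qed.

Lemma cont_cg (p q : int) : cg n p q -> cont p = cont q -> p = q.
Proof.
move=> /cgP[k ->]; rewrite cont_translate => e.
have m0 := lb_m L; have l0 := lb_l L.
suff -> : k = 0 by rewrite mul0r addr0.
by have [->//|k0] := eqVneq k 0; nia.
Qed.

(** The content drops by [m + l > 0] over each period, so a label [i + k n] on the diagonal [c] has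
    [k] bounded by [c] and the contents of one period: diagonals are finite. *)
Lemma diagonal_below (c p : int) : exists2 s : seq int, uniq s &
  forall q, (q \in s) = (cont q == c) && (q < p).
Proof.
have m0 := lb_m L; have l0 := lb_l L.
pose M : int := \sum_(i < n) `|cont i.+1%:Z|.
have cM (i : 'I_n) : `|cont i.+1%:Z| <= M.
  by rewrite /M (bigD1 i) //= lerDl sumr_ge0.
have M0 : 0 <= M by apply: sumr_ge0.
pose N : nat := absz (n%:Z + n%:Z * (`|c| + M) + `|p|)%R.
exists [seq q <- [seq k%:Z - N%:Z | k <- iota 0 (N + N).+1] | (cont q == c) && (q < p)].
  by rewrite filter_uniq // map_inj_uniq ?iota_uniq // => i j; lia.
move=> q; rewrite mem_filter andb_idr // => /andP[/eqP cq qp].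
have qN : `|q| <= N%:Z.
  have [i /cgP[k kE]] := residue (n := n) q; have := ltn_ord i.
  have := cM i; rewrite kE cont_translate in cq *.
  rewrite /N gez0_abs; last by rewrite !addr_ge0 // mulr_ge0 // addr_ge0.
  have k1 : `|k| <= `|c| + M.
    by have := cM i; have : `|k| <= `|k * (m + l)|; [nia | lia].
  nia.
apply/mapP; exists (absz (q + N%:Z)%R); last lia.
rewrite mem_iota; lia.
Qed.

Definition diag_sorted (u : W) : Prop :=
  forall p q, cont p = cont q -> p < q -> act u p < act u q.

Section Sorting.
Variables (da db : int).
Hypothesis dab : da = 0 /\ db = 1 \/ da = 1 /\ db = 0.

(** The step [(da, db)] leads to the right neighbour or to the one below, so that one argument
    serves for rows and columns. *)
Definition nb_increasing (u : W) : Prop := forall p q,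
  row q = row p + da -> col q = col p + db -> act u p < act u q.

Let pre x := lab (row x - da) (col x - db).
Let suc x := lab (row x + da) (col x + db).
Let is_nb p q := row q = row p + da /\ col q = col p + db.

(* If u p > u q for neighbours p, q, then t^-1 u followed by the predecessor map
   and u^-1 t injects the boxes on the diagonal of q up to q, with at most
   one exception, into those on the diagonal of p before p; but there are
   too few of the latter. *)
Lemma sorted_nb_increasing (u t : W) :
  (forall p, cont (act u^-1%g (act t p)) = cont p) ->
  diag_sorted u -> nb_increasing t -> nb_increasing u.
Proof.
move=> ut su ti p p1 rp cp; rewrite ltNge; apply/negP; rewrite le_eqVlt.
case/orP => [/eqP /act_injective|lt].
  by move=> e; move: rp cp; rewrite e; lia.
pose x y := act t^-1%g (act u y).
have ux y : act t (x y) = act u y by rewrite /x actKV.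
have cx y : cont (x y) = cont y by rewrite -ut ux actK.
have xI : injective x by move=> y z /act_injective /act_injective.
pose F y := act u^-1%g (act t (pre (x y))).
have [sB uB memB] := diagonal_below (cont p) p.
have preP y (a : int) : is_nb a y -> pre y = a.
  by move=> [r c]; rewrite /pre r c !addrK labK.
have sucP y a : is_nb y a -> suc y = a.
  by move=> [r c]; rewrite /suc -r -c labK.
have FB y : cont y = cont p1 -> y <= p1 -> is_nb (pre (x y)) (x y) -> F y \in sB.
  move=> cy yp [r c]; have cF : cont (F y) = cont p.
    rewrite /F ut; have := cx y; rewrite cy /cont; lia.
  have lF : act u (F y) < act u p.
    rewrite /F actKV; apply: lt_trans (ti _ _ r c) _; rewrite ux.
    apply: le_lt_trans lt; move: yp; rewrite [y <= p1]le_eqVlt => /orP[/eqP -> //|yp].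
    by apply/ltW/su.
  rewrite memB cF eqxx /=; rewrite ltNge le_eqVlt; apply/negP.
  case/orP => [/eqP e|/(su _ _ (esym cF))]; last by rewrite ltNge ltW.
  by rewrite -e ltxx in lF.
have FI : {in [pred y | `[< is_nb (pre (x y)) (x y) >]] &, injective F}.
  move=> y z /asboolP [ry cy] /asboolP [rz cz] /act_injective /act_injective e.
  by apply: xI; apply: lab_inj; rewrite ?ry ?rz ?cy ?cz e.
have sucB q : q \in sB -> is_nb q (suc q) /\ (cont (suc q) = cont p1 /\ suc q < p1).
  rewrite memB => /andP[/eqP cq qp]; have := cont_lt_row cq qp.
  move: cq; rewrite /cont => cq rq.
  have [||r c] := @lb_skew _ _ _ _ _ L q p1 (row q + da) (col q + db); try lia.
  split; first by split.
  by split; [rewrite /suc; lia | apply: lab_lt; rewrite /suc; lia].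
have nbp : is_nb p p1 by [].
have sI : {in sB &, injective suc}.
  move=> q r /sucB[h1 _] /sucB[h2 _] e.
  by rewrite -(preP _ _ h1) e (preP _ _ h2).
pose LA := p1 :: map suc sB.
have uLA : uniq LA.
  rewrite /= map_inj_in_uniq // uB andbT; apply/negP => /mapP[q /sucB[_ [_ lt']] e].
  by rewrite -e ltxx in lt'.
have LAP y : y \in LA -> [/\ cont y = cont p1, y <= p1 & exists a, is_nb a y].
  rewrite inE => /predU1P[->|/mapP[q /sucB[h1 [h2 h3]] ->]].
    by split=> //; exists p.
  by split=> //; [apply: ltW | exists q].
have bound (s : seq int) : uniq s -> (forall y, y \in s -> cont y = cont p1) ->
    (forall y, y \in s -> y <= p1) ->
    (forall y, y \in s -> is_nb (pre (x y)) (x y)) -> (size s <= size sB)%N.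
  move=> us sc sp sn; rewrite -(size_map F); apply: uniq_leq_size.
    rewrite map_inj_in_uniq // => y z ys zs; apply: FI; apply/asboolP; exact: sn.
  by move=> _ /mapP[y ys ->]; apply: FB; [exact: sc | exact: sp | exact: sn].
have start_uniq y : ~ is_nb (pre y) y -> cont y = cont p1 ->
    forall z, cont z = cont p1 -> row y <= row z.
  move=> ny cy z cz; rewrite leNgt; apply/negP => lt'; apply: ny.
  move: cy cz; rewrite /cont => cy cz.
  have [||r c] := @lb_skew _ _ _ _ _ L z y (row y - da) (col y - db); try lia.
  by rewrite /is_nb /pre r c !subrK.
have nbpre a y : is_nb a y -> is_nb (pre y) y by move=> h; rewrite (preP _ _ h).
have [[y0 [c0 n0]]|nos] := pselect (exists y0, cont y0 = cont p1 /\ ~ is_nb (pre y0) y0).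
  have y0A : y0 \notin LA.
    by apply/negP => /LAP[_ _ [a /nbpre]].
  (* [F] is unusable at the one [y] with [x y = y0]. Adding [y0] itself, which is not in [LA], makes
     up for the possible loss, and the list is still longer than [sB]. *)
  pose LB := [seq y <- y0 :: LA | x y != y0].
  have szB : (size LA <= size LB)%N.
    rewrite /LB size_filter; have := count_predC (fun y => x y != y0) (y0 :: LA).
    rewrite /= -/(size LA).
    have : (count (predC (fun y => x y != y0)) (y0 :: LA) <= 1)%N.
      rewrite -size_filter; case E : (filter _ _) => [|y1 [|y2 s]] //.
      have : uniq (filter (predC (fun y => x y != y0)) (y0 :: LA)).
        by rewrite filter_uniq //= y0A.
      have : all (predC (fun y => x y != y0)) (filter (predC (fun y => x y != y0)) (y0 :: LA)).
        exact: filter_all.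
      rewrite E /= => /and3P[/negPn/eqP e1 /negPn/eqP e2 _].
      by rewrite inE (xI y1 y2) ?eqxx // e1 e2.
    rewrite /=; lia.
  have h0 y : y \in y0 :: LA -> cont y = cont p1 /\ y <= p1.
    rewrite inE => /predU1P[->|/LAP[] //]; split=> //.
    have := start_uniq _ n0 c0 p1 erefl; rewrite le_eqVlt => /orP[/eqP r|r].
      by rewrite (cont_inj c0 r).
    by apply/ltW/lab_lt; left.
  have lt1 : (size sB < size LB)%N by apply: leq_trans szB; rewrite /LA /= size_map.
  suff : (size LB <= size sB)%N by rewrite leqNgt lt1.
  apply: bound => [|y|y|y].
  - by rewrite filter_uniq //= y0A.
  - by rewrite mem_filter => /andP[_ /h0[]].
  - by rewrite mem_filter => /andP[_ /h0[]].
  - rewrite mem_filter => /andP[xy /h0[cy _]]; apply: contrapT => h.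
    case/eqP: xy; have cxy : cont (x y) = cont p1 by rewrite cx.
    apply: cont_inj; first by rewrite cxy c0.
    by apply/eqP; rewrite eq_le !start_uniq.
suff : (size LA <= size sB)%N by rewrite /LA /= size_map ltnn.
apply: bound => // y.
- by move=> /LAP[].
- by move=> /LAP[].
- move=> /LAP[cy _ _]; apply: contrapT => h; apply: nos; exists (x y).
  by rewrite cx.
Qed.

End Sorting.

Definition standard (u : W) : Prop := nb_increasing 0 1 u /\ nb_increasing 1 0 u.

Lemma row_adj_nb_increasing (u : W) :
  J_increasing row_adj u <-> nb_increasing 0 1 u.
Proof.
split=> [Ju p q r c|ui p rp].
  have e : q = p + 1 by apply: row_next; lia.
  by rewrite e; apply: Ju; rewrite /row_adj -e; lia.
by apply: ui; rewrite ?(row_succ rp) ?rp; lia.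
Qed.

Lemma standard_mono (u : W) : standard u -> forall q p : int,
  row q <= row p -> col q <= col p -> act u q <= act u p.
Proof.
move=> [ur uc] q.
have H (N : nat) : forall p, row q <= row p -> col q <= col p ->
    row p - row q + (col p - col q) <= N%:Z -> act u q <= act u p.
  elim: N => [|N IHN] p rr cc le.
    have -> : q = p by apply: lab_inj; lia.
    exact: lexx.
  have [lt|ge] := ltP (row q) (row p).
    have [||r c] := @lb_skew _ _ _ _ _ L q p (row p - 1) (col p); try lia.
    apply: le_trans (IHN (lab (row p - 1) (col p)) _ _ _) (ltW (uc _ _ _ _)); lia.
  have [lt|ge'] := ltP (col q) (col p); last first.
    have -> : q = p by apply: lab_inj; lia.
    exact: lexx.
  have [||r c] := @lb_skew _ _ _ _ _ L q p (row p) (col p - 1); try lia.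
  apply: le_trans (IHN (lab (row p) (col p - 1)) _ _ _) (ltW (ur _ _ _ _)); lia.
move=> p rr cc; apply: (H (absz (row p - row q + (col p - col q))%R)) => //; lia.
Qed.

(** If the contents differ by at most 1, the box with the smaller label lies weakly above and to the
    left of the other, and a standard [u] cannot invert them. *)
Lemma standard_descent (u : W) (p q : int) : standard u -> q < p ->
  act u p < act u q -> 1 < `|cont p - cont q|.
Proof.
move=> us qp lt; rewrite ltNge; apply/negP => le.
suff : act u q <= act u p by rewrite leNgt lt.
by apply: standard_mono => //; have := lb_lex L qp; move: le; rewrite /cont; lia.
Qed.

(** Exchanging boxes of equal content preserves the weight, so each weight that comes from a group
    element comes from one sorted along the diagonals. *)
Lemma swap_diag (u : W) (p q : int) : cont p = cont q -> p < q ->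
  act u q < act u p ->
  pot n n id (act (u * tg n p q)%g) < pot n n id (act u) /\
  forall i, cont (act (u * tg n p q)^-1%g i) = cont (act u^-1%g i).
Proof.
move=> c pq lt.
have npq : ~~ cg n p q.
  by apply/negP => /cont_cg /(_ c); lia.
have tE : (tg n p q)^-1%g = tg n p q by apply/mulg1_eq/tgK.
split=> [|i]; last first.
  rewrite invgM actM tE act_tg // /tr.
  case: ifP => [/cgP[k ->]|_].
    by rewrite (_ : p + k * n%:Z - p + q = q + k * n%:Z) ?cont_translate ?c //; lia.
  case: ifP => [/cgP[k ->]|//].
  by rewrite (_ : q + k * n%:Z - q + p = p + k * n%:Z) ?cont_translate ?c //; lia.
rewrite (@pot_swap n _ n%:Z id (act u) _ p q) //; try exact: act_periodic.
- have : 0 < (q - p) * (act u p - act u q) by apply: mulr_gt0; lia.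
  by rewrite /=; nia.
- by rewrite actM act_tg // trl.
- by rewrite actM act_tg // trr.
- by move=> j jp jq; rewrite actM act_tg // tr_id.
Qed.

End LabelledDiagram.

(** * Submodules of cyclic modules *)

Section CyclicModules.
Context (C : numFieldType) (n kappa : nat) {n_ge2 : atleast2 n}.
Let hn : (2 <= n)%N := n_ge2.
Variable H : daha C n kappa.
Variable V : lmodType H.

Local Notation T := (dahaW H).
Local Notation U := (uZ H).
Local Notation W := (dW n).

Section Generic.
Variables (chi : int -> int) (v : V) (J : int -> Prop) (eps : C).
Hypothesis wv : wt chi v.
Hypothesis Jv : forall j, J j -> T (sg n j) *: v = sc eps v.

Definition J_weight (lam : int -> int) : Prop :=
  exists2 g : W, J_increasing J g & forall i, lam i = chi (act g^-1%g i).

Lemma cyclic_killed (h : H) : killed J_weight (h *: v).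
Proof.
apply: (cyclic_ind wv Jv (killed_subsp V J_weight)).
  apply: (@killedS _ _ _ _ _ _ chi) => [|k].
    by exists 1%g => [j _|i]; rewrite ?invg1 ?act1 //; lia.
  by rewrite wv subrr; apply: killed0.
move=> g Jg _ x Kx; apply: (killedS _ Kx).
by exists g.
Qed.

Lemma cyclic_weight (h : H) psi : h *: v != 0 -> wt psi (h *: v) -> J_weight psi.
Proof.
move=> hv0 wpsi.
have [lam [g Jg e] e'] := killed_weight (cyclic_killed h) hv0 wpsi.
by exists g => // i; rewrite -e' e.
Qed.

Hypothesis chiP : forall k, chi (k + n%:Z) = chi k - kappa%:Z.
Hypothesis chi_uniq : forall g : W, J_increasing J g ->
  (forall p, chi (act g p) = chi p) -> g = 1%g.

(* The generalized weight space of weight chi is the line through v. *)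
Lemma cyclic_line (h : H) : exists c, off_weight chi (h *: v - sc c v).
Proof.
have [off0 offL] := off_weight_subsp V chi.
apply: (cyclic_ind wv Jv (E := fun x => exists c, off_weight chi (x - sc c v))).
- split=> [|c x y [a ha] [b hb]]; first by exists 0; rewrite sc0l subr0.
  exists (c * a + b); rewrite scDl -scA opprD addrACA -scBr.
  exact: offL.
- by exists 1; rewrite sc1l subrr.
move=> g Jg g1 x Ex.
have [p /eqP ne] : exists p, chi (act g p) <> chi p.
  by apply/existsNP => e; apply: g1; apply: chi_uniq.
have [c] := Ex (act g p); rewrite actK => hc.
pose d : C := (chi (act g p))%:~R - (chi p)%:~R.
have d0 : d != 0 by rewrite subr_eq0 eqr_int.
(* On [v] the operator [u_(g p) - chi(p)] is the scalar [d]; the multiple [c / d] is what cancels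
   [c v]. *)
exists (c / d); apply: (@off_weight_U _ _ _ _ _ _ _ (act g p) (chi p)%:~R) => //.
  by rewrite -subr_eq0.
have subACA (a b a' b' : V) : a - b - (a' - b') = a - a' - (b - b').
  by rewrite !opprB !addrA [LHS]addrAC [RHS]addrAC [a - b - a']addrAC.
rewrite scalerBr sc_comm wv scBr subACA !scA -scBl [_ * (c / d)]mulrC -mulrBr.
by rewrite divfK.
Qed.

Lemma cyclic_line_wt (h : H) : wt chi (h *: v) -> exists c, h *: v = sc c v.
Proof.
move=> wh; have [c [p p0 px]] := cyclic_line h; exists c.
apply/eqP; rewrite -subr_eq0; apply/eqP/(sc_inj p0); rewrite -wt_poly //.
by rewrite addrC -[sc c v]sc1l -scNl; apply: wt_linear => //; apply: wt_sc.
Qed.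

End Generic.

Section Diagram.
Variables (m l : int) (row col : int -> int) (lab : int -> int -> int).
Hypothesis L : labelling n m l row col lab.
Hypothesis mlk : m + l = kappa%:Z.
Local Notation cont := (cont row col).
Local Notation row_adj := (row_adj row).
Variable v : V.
Hypothesis wv : wt cont v.
Hypothesis Jv : forall j, row_adj j -> T (sg n j) *: v = sc 1 v.

Lemma diagram_cont_period (k : int) : cont (k + n%:Z) = cont k - kappa%:Z.
Proof. by rewrite (cont_period L) mlk. Qed.

Hypothesis col_weight : forall (h : H) psi, h *: v != 0 -> wt psi (h *: v) ->
  exists2 t : W, nb_increasing row col 1 0 t &
    forall i, psi i = cont (act t^-1%g i).

Let wt_u (u : W) (x : V) := wt (fun i => cont (act u^-1%g i)) x.

(** The intertwiner [s_i + 1 / (u_i - u_(i+1))], evaluated on a weight vector. *)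
Lemma wt_intertwine psi (x : V) i : wt psi x -> 1 < `|psi i - psi (i + 1)| ->
  x != 0 ->
  let y := T (sg n i) *: x + sc ((psi i - psi (i + 1))%:~R^-1) x in
  y != 0 /\ wt (fun k => psi (tr n i (i + 1) k)) y.
Proof.
move=> wx d1 x0; set d : int := psi i - psi (i + 1) => y.
have d0 : (d%:~R : C) != 0 by rewrite intr_eq0; move: d1; rewrite -/d; lia.
have psiP k : psi (k + n%:Z) = psi k - kappa%:Z by apply: wt_period wx.
have psiM (q k : int) : psi (k + q * n%:Z) = psi k - q * kappa%:Z.
  have nat_case (j : nat) (k' : int) : psi (k' + j%:Z * n%:Z) = psi k' - j%:Z * kappa%:Z.
    elim: j => [|j IHj]; first by rewrite !mul0r addr0 subr0.
    rewrite (_ : k' + j.+1%:Z * n%:Z = k' + j%:Z * n%:Z + n%:Z); last lia.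
    by rewrite psiP IHj; lia.
  case: q => q; first exact: nat_case.
  have := nat_case q.+1 (k + Negz q * n%:Z).
  by rewrite (_ : k + Negz q * n%:Z + q.+1%:Z * n%:Z = k); lia.
have d0' : (psi i)%:~R - (psi (i + 1))%:~R != 0 :> C by rewrite -rmorphB.
split.
  (* If [y] vanished, the involution would act on [x] by [-1/d], which is impossible for
     [|d| > 1]. *)
  apply/eqP => y0; have Tx : T (sg n i) *: x = sc (- d%:~R^-1) x.
    by apply/eqP; rewrite scNl -addr_eq0; apply/eqP.
  have : sc (d%:~R^-1 * d%:~R^-1 - 1) x = 0.
    rewrite scBl -mulrNN -scA -Tx -sc_comm -Tx scalerA -dahaWM sgK dahaW1.
    by rewrite scale1r sc1l subrr.
  move=> e; case/negP: x0; apply/eqP; apply: (sc_inj _ e).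
  rewrite subr_eq0 -invfM invr_eq1 -intrM -[1]/(1%:~R) eqr_int.
  by move: d1; rewrite -/d; nia.
move=> k; rewrite /y scalerDr scalerA U_T_sg scalerDl -scalerA wx !sc_comm.
rewrite wx scDr -addrA; congr (_ + _); rewrite -sc_int !scA -scDl; congr (sc _ x).
rewrite -[in RHS]mulrC; apply: (mulfI d0); rewrite mulrDr !mulrA [d%:~R * _ * _]mulrAC.
rewrite [d%:~R * d%:~R^-1 * _]mulrC.
have [/cgP[q kE]|ki] := boolP (cg n k i).
  have e : cg n k i by apply/cgP; exists q.
  rewrite (cgl _ e) cgS /tr e kE (_ : i + q * n%:Z - i + (i + 1) = i + 1 + q * n%:Z); last lia.
  by rewrite !psiM /d !rmorphB /= !rmorphM /= ?mulr0z ?mulr1z; field.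
have [/cgP[q kE]|ki1] := boolP (cg n k (i + 1)).
  have e : cg n k (i + 1) by apply/cgP; exists q.
  rewrite /tr (negbTE ki) e kE (_ : i + 1 + q * n%:Z - (i + 1) + i = i + q * n%:Z); last lia.
  by rewrite !psiM /d !rmorphB /= !rmorphM /= ?mulr0z ?mulr1z; field.
by rewrite tr_id // subrr mulr0z; field.
Qed.

(** Induction on the potential of a group element [u] that gives the weight. Equal contents are
    sorted without touching the vector, and descents are removed by intertwiners. When neither
    applies, [u] is a translation; a power of pi then brings the weight to [cont], where only
    multiples of [v] occur. *)
Lemma submodule_generator (S : V -> Prop) :
  (forall h x, S x -> S (h *: x)) -> (forall x y, S x -> S y -> S (x + y)) ->
  v != 0 ->
  forall h0 : H, h0 *: v != 0 -> S (h0 *: v) -> S v.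
Proof.
move=> SZ SD v0.
have step (N : nat) : forall (u : W) (h : H), pot n n id (act u) < N%:Z ->
    h *: v != 0 -> S (h *: v) -> wt_u u (h *: v) -> S v.
  elim: N => [|N IHN] u h; first by have := pot_ge0 n n id (act u); lia.
  move=> lt h0 Sh wh.
  have [su|nsu] := pselect (diag_sorted row col u); last first.
    have [p [q [c [pq lt']]]] : exists p q, cont p = cont q /\ p < q /\ act u q < act u p.
      apply: contrapT => no; apply: nsu => p q c pq; rewrite ltNge le_eqVlt.
      apply/negP => /orP[/eqP /act_injective|lt']; first lia.
      by apply: no; exists p, q.
    have [lt2 e] := swap_diag L c pq lt'.
    apply: (IHN (u * tg n p q)%g h) => //; first lia.
    by apply: wt_ext wh => i; rewrite e.
  (* The weight comes from one element increasing along rows and from another increasing along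
     columns. Both properties pass to [u] because it is sorted along the diagonals. *)
  have us : standard row col u.
    split.
      have [t Jt e] := cyclic_weight wv Jv h0 wh.
      apply: (sorted_nb_increasing L _ (t := t) _ su) => [|p|]; first by left.
        by rewrite e actK.
      exact/(row_adj_nb_increasing L).
    have [t ti e] := col_weight h0 wh.
    apply: (sorted_nb_increasing L _ (t := t) _ su ti) => [|p]; first by right.
    by rewrite e actK.
  have [[i hi]|/forallNP nodesc] :=
      pselect (exists i, act u^-1%g (i + 1) < act u^-1%g i).
    have big : 1 < `|cont (act u^-1%g i) - cont (act u^-1%g (i + 1))|.
      by apply: (standard_descent L us hi); rewrite !actKV; lia.
    have [y0 wy] := wt_intertwine wh big h0.
    have yE : T (sg n i) *: (h *: v) + sc ((cont (act u^-1%g i) -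
        cont (act u^-1%g (i + 1)))%:~R^-1) (h *: v) =
        (T (sg n i) * h + ((cont (act u^-1%g i) -
        cont (act u^-1%g (i + 1)))%:~R^-1 : C)%:A * h) *: v.
      by rewrite scalerDl -!scalerA.
    rewrite yE in y0 wy; apply: (IHN (sg n i * u)%g _ _ y0).
    - rewrite (@sg_left_swap n _ n%:Z id u i (act u^-1%g i) (act u^-1%g (i + 1))) ?actKV //.
      have : 0 < 2 * n%:Z * n%:Z * (act u^-1%g i - act u^-1%g (i + 1)).
        by rewrite !mulr_gt0 //; lia.
      by rewrite /=; set t := _ * (_ - _); lia.
    - by rewrite -yE; apply: SD; apply: SZ.
    - apply: wt_ext wy => k; congr cont; rewrite invgM actM; congr act.
      by apply: (@act_injective _ _ (sg n i)); rewrite actKV act_sg trK ?cgS.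
  have uE : (u^-1)%g = piz n (act u^-1%g 0).
    apply: act_increasing => i; have /negP := nodesc i.
    rewrite -leNgt le_eqVlt => /orP[/eqP /act_injective|//]; lia.
  set d := act u^-1%g 0 in uE.
  have wx : wt cont ((T (piz n d) * h) *: v).
    move=> k; rewrite -scalerA scalerA -{1}(subrK d k) -T_pizU -scalerA wh sc_comm.
    by rewrite uE act_piz subrK.
  have [c e] := cyclic_line_wt wv Jv diagram_cont_period
    (fun g Jg => row_increasing_cont_eq1 L Jg) wx.
  have c0 : c != 0.
    apply: contraNneq h0 => c0; rewrite c0 sc0l in e.
    rewrite -[h]mul1r -dahaW1 -(mulVg (piz n d)) dahaWM -mulrA -scalerA e.
    by rewrite scaler0.
  rewrite -[v]sc1l -(mulVf c0) -scA -e /sc -scalerA; do 2!apply: (SZ).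
  exact: Sh.
move=> h0 nz Sh.
have [k [lam [[g _ e] k0 wk]]] := killed_eigenvector (cyclic_killed wv Jv h0) nz.
rewrite scalerA in k0 wk.
apply: (step (absz (pot n n id (act g))).+1 g _ _ k0).
- by have := pot_ge0 n n id (act g); lia.
- by rewrite -scalerA; apply: SZ.
- exact: wt_ext wk.
Qed.

End Diagram.

End CyclicModules.

(** * Embedding a simple module by means of its generator *)

Section Embedding.
Context (C : numFieldType) (n kappa : nat) {n_ge2 : atleast2 n}.
Variable H : daha C n kappa.
Local Notation T := (dahaW H).

Lemma simple_cyclic (M : lmodType H) (v : M) : simple_mod M -> v != 0 ->
  forall y, exists h : H, y = h *: v.
Proof.
move=> [_ Ms] v0.
case: (Ms [pred y | `[< exists h : H, y = h *: v >]]) => [|all0|gen y].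
- split=> [|a x y]; rewrite !inE.
    by exists 0; rewrite scale0r.
  move=> [h ->] [k ->].
  by exists (a * h + k); rewrite scalerDl scalerA.
- case/negP: v0; apply/eqP/all0; rewrite inE.
  by exists 1; rewrite scale1r.
- by have := gen y; rewrite inE.
Qed.

Lemma simple_injective (M V : lmodType H) (f : {linear M -> V}) (v : M) :
  simple_mod M -> f v != 0 -> injective f.
Proof.
move=> [_ Ms] fv; case: (Ms [pred y | f y == 0]) => [|K0|all0].
- split=> [|a x y]; rewrite !inE ?linear0 // => /eqP fx /eqP fy.
  by rewrite linearP fx fy scaler0 addr0.
- move=> x y e; apply/eqP; rewrite -subr_eq0; apply/eqP/K0.
  by rewrite inE linearB e subrr.
- by have := all0 v; rewrite inE (negbTE fv).
Qed.

Variables (m l : int) (row col : int -> int) (lab : int -> int -> int).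
Hypothesis L : labelling n m l row col lab.
Hypothesis mlk : m + l = kappa%:Z.
Local Notation cont := (cont row col).
Local Notation row_adj := (row_adj row).

Lemma simple_embedding (M V : lmodType H) (vM : M) (v : V) :
  simple_mod M -> vM != 0 -> v != 0 -> wt cont vM -> wt cont v ->
  (forall j, row_adj j -> T (sg n j) *: vM = sc 1 vM) ->
  (forall j, row_adj j -> T (sg n j) *: v = sc 1 v) ->
  (forall (h : H) psi, h *: v != 0 -> wt psi (h *: v) ->
     exists2 t : dW n, nb_increasing row col 1 0 t &
       forall i, psi i = cont (act t^-1%g i)) ->
  exists f : {linear M -> V}, injective f.
Proof.
move=> Ms vM0 v0 wM wv JM Jv cw.
have gen := simple_cyclic Ms vM0.
have ann (h : H) : h *: vM = 0 -> h *: v = 0.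
  move=> hM; apply/eqP; apply: contraT => hv.
  pose S x := exists k : H, x = k *: (h *: v).
  have SZ a x : S x -> S (a *: x) by move=> [k ->]; exists (a * k); rewrite scalerA.
  have SD x y : S x -> S y -> S (x + y).
    by move=> [k ->] [k' ->]; exists (k + k'); rewrite scalerDl.
  have S1 : S (h *: v) by exists 1; rewrite scale1r.
  have [k kv] := submodule_generator L mlk wv Jv cw SZ SD v0 hv S1.
  (* The pair has the same weight and row invariance, so its multiples modulo the other weights form
     a line. But [k * h] sends it to [(0, v)], which cannot lie on that line. *)
  pose w : (M * V)%type := (vM, v).
  have ww : wt cont w.
    by move=> i; rewrite /sc /w; congr pair; [exact: wM | exact: wv].
  have Jw j : row_adj j -> T (sg n j) *: w = sc 1 w.
    by move=> h'; rewrite /sc /w; congr pair; [exact: JM | exact: Jv].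
  have [c [p p0 pw]] := cyclic_line ww Jw (diagram_cont_period L mlk)
    (fun g Jg => row_increasing_cont_eq1 L Jg) (k * h).
  have e : (k * h) *: w - sc c w = (sc (- c) vM, sc (1 - c) v).
    rewrite /sc /w; congr pair; rewrite /= -/(sc _ _).
      by rewrite -scalerA hM scaler0 add0r scNl.
    by rewrite -scalerA -kv scBl sc1l.
  rewrite e in pw; have [] : dahaU H p *: sc (- c) vM = 0 /\ dahaU H p *: sc (1 - c) v = 0.
    by case: pw.
  rewrite !sc_comm (wt_poly _ wM) (wt_poly _ wv) !scA => eM ev.
  have c0 : c = 0.
    apply/eqP; apply: contraNT vM0 => c0; apply/eqP; apply: (sc_inj _ eM).
    by rewrite mulf_neq0 ?oppr_eq0.
  move: ev; rewrite c0 subr0 mul1r => /(sc_inj p0) e0.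
  by rewrite e0 eqxx in v0.
have [fh fhE] : exists fh : M -> H, forall y, y = fh y *: vM.
  by exists (fun y => projT1 (cid (gen y))) => y; case: cid.
pose f (y : M) : V := fh y *: v.
have f_lin : linear f.
  move=> a x y; apply/eqP; rewrite -subr_eq0 /f scalerA -scalerDl -scalerBl.
  apply/eqP/ann; rewrite scalerBl scalerDl -scalerA -!fhE.
  by rewrite subrr.
pose fL : {linear M -> V} := HB.pack f (GRing.isLinear.Build H M V _ f f_lin).
exists fL; apply: (simple_injective (v := vM)) => //=.
rewrite /f; have -> : fh vM *: v = v; last by [].
apply/eqP; rewrite -subr_eq0 -[X in _ - X]scale1r -scalerBl; apply/eqP/ann.
by rewrite scalerBl -fhE scale1r subrr.
Qed.

End Embedding.

(** * The labelling of a periodic skew diagram *)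

Section DiagramLabelling.
Context (n : nat) {n_ge2 : atleast2 n}.
Variables (m : nat) (l : int) (D : skew_diagram n m l).
Hypothesis m_gt0 : (0 < m)%N.

Local Notation mu := (sk_mu D).
Local Notation lam := (sk_lam D).

Definition dg_row (i : int) : int := (T0_box D i).1.
Definition dg_col (i : int) : int := (T0_box D i).2.
Definition dg_lab (a b : int) : int := row_reading D (a, b).

Lemma T0_boxP i : boxes D (T0_box D i) /\ row_reading D (T0_box D i) = i.
Proof.
have [p [hp _]] := row_reading_bij D i m_gt0.
by rewrite /T0_box; case: xgetP => [q _ //|/(_ p)].
Qed.

Lemma T0_box_row_reading p : boxes D p -> T0_box D (row_reading D p) = p.
Proof.
move=> Dp; have [q [_ qU]] := row_reading_bij D (row_reading D p) m_gt0.
by rewrite -(qU _ (T0_boxP _)) (qU p).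
Qed.

Lemma dg_box (i : int) : mu (dg_row i) <= dg_col i <= lam (dg_row i).
Proof.
by apply/(sk_boxesE D); rewrite /dg_row /dg_col -surjective_pairing; case: (T0_boxP i).
Qed.

Lemma dg_labK (i : int) : dg_lab (dg_row i) (dg_col i) = i.
Proof.
by rewrite /dg_lab /dg_row /dg_col -surjective_pairing; case: (T0_boxP i).
Qed.

Lemma dg_labP (a b : int) : mu a <= b <= lam a ->
  dg_row (dg_lab a b) = a /\ dg_col (dg_lab a b) = b.
Proof.
by move=> /(sk_boxesE D)/T0_box_row_reading e; rewrite /dg_row /dg_col e.
Qed.

Lemma mu_lam_period (a k : int) :
  mu (a + k * m%:Z) = mu a - k * l /\ lam (a + k * m%:Z) = lam a - k * l.
Proof.
have box c b : boxes D (c, b) = (mu c <= b <= lam c) :> Prop.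
  by apply/propext; apply: sk_boxesE.
have per b : mu (a + k * m%:Z) <= b - k * l <= lam (a + k * m%:Z) <-> mu a <= b <= lam a.
  by rewrite -!box; apply: sk_period.
have h1 := sk_mu_le_lam D a; have h2 := sk_mu_le_lam D (a + k * m%:Z).
have := (per (mu a)).2; have := (per (lam a)).2.
have := (per (mu (a + k * m%:Z) + k * l)).1; have := (per (lam (a + k * m%:Z) + k * l)).1.
by rewrite !addrK; lia.
Qed.

Lemma mu_lam_anti (a a' : int) : a <= a' -> mu a' <= mu a /\ lam a' <= lam a.
Proof.
move=> aa; have -> : a' = a + (absz (a' - a)%R)%:Z by lia.
elim: (absz _) => [|k IHk]; first by rewrite addr0.
have h1 : mu (a + k%:Z + 1) <= mu (a + k%:Z) := sk_mu_anti D _.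
have h2 : lam (a + k%:Z + 1) <= lam (a + k%:Z) := sk_lam_anti D _.
rewrite (_ : a + k.+1%:Z = a + k%:Z + 1); lia.
Qed.

Lemma dg_l_ge0 : 0 <= l.
Proof.
have := mu_lam_period 0 1; rewrite add0r !mul1r => -[h _].
have [|h' _] := @mu_lam_anti 0 m%:Z; lia.
Qed.

(** The formula of the row reading is affine in the column even outside the diagram, so no box
    condition appears. *)
Lemma dg_lab_shift (a b c : int) : dg_lab a (b + c) = dg_lab a b + c.
Proof. by rewrite /dg_lab /row_reading /T0_base /=; lia. Qed.

Lemma dg_lab_period (a b k : int) :
  dg_lab (a + k * m%:Z) (b - k * l) = dg_lab a b + k * n%:Z.
Proof. exact: row_reading_shift. Qed.

(** From row [m] to row [m + 1] this is the condition that the rows of one period have [n] boxes in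
    total; other rows follow by translation. *)
Lemma dg_lab_next (a : int) : dg_lab (a + 1) (mu (a + 1)) = dg_lab a (lam a) + 1.
Proof.
have base (c : nat) : (1 <= c <= m)%N -> dg_lab c (mu c) =
    \sum_(1 <= i < c) row_size D i%:Z + 1.
  by move=> hc; rewrite /dg_lab row_readingE /T0_base /=; lia.
have H (c : nat) : (1 <= c <= m)%N ->
    dg_lab (c%:Z + 1) (mu (c%:Z + 1)) = dg_lab c (lam c) + 1.
  move=> hc.
  have -> : lam c = mu c + (row_size D c - 1) by rewrite /row_size; lia.
  rewrite dg_lab_shift base //.
  have e : \sum_(1 <= i < c.+1) row_size D i%:Z =
      \sum_(1 <= i < c) row_size D i%:Z + row_size D c%:Z.
    by rewrite big_nat_recr //; lia.
  have [cm|cm] := eqVneq c m; last first.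
    rewrite (_ : c%:Z + 1 = c.+1%:Z); last lia.
    by rewrite base ?e; lia.
  have e1 : \sum_(1 <= i < c.+1) row_size D i%:Z = n%:Z.
    by rewrite cm; apply: sk_degree.
  have [e2 _] := mu_lam_period 1%N%:Z 1.
  rewrite (_ : c%:Z + 1 = 1%N%:Z + 1 * m%:Z); last by rewrite cm; lia.
  rewrite e2 dg_lab_period base; last lia.
  by rewrite big_geq //; move: e; rewrite e1; lia.
have aE : exists c : nat, exists k : int, (1 <= c <= m)%N /\ a = c%:Z + k * m%:Z.
  have e := divz_eq (a - 1) m%:Z; have r0 := @modz_ge0 (a - 1) m%:Z.
  have r1 := @ltz_pmod (a - 1) m%:Z.
  exists (absz ((a - 1) %% m%:Z)%Z).+1, ((a - 1) %/ m%:Z)%Z; lia.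
have [c [k [hc ->]]] := aE.
rewrite -addrAC; have [-> _] := mu_lam_period (c%:Z + 1) k.
have [_ ->] := mu_lam_period c%:Z k.
by rewrite !dg_lab_period H //; lia.
Qed.

Lemma dg_lab_lt (a b a' b' : int) : a < a' -> mu a <= b <= lam a ->
  mu a' <= b' <= lam a' -> dg_lab a b < dg_lab a' b'.
Proof.
move=> aa hb hb'.
have rowlt c d : mu c <= d <= lam c -> dg_lab c (mu c) <= dg_lab c d < dg_lab (c + 1) (mu (c + 1)).
  move=> hd; rewrite dg_lab_next.
  have -> : d = mu c + (d - mu c) by lia.
  have -> : lam c = mu c + (lam c - mu c) by lia.
  by rewrite !dg_lab_shift; lia.
have mono (k : nat) : dg_lab (a + 1) (mu (a + 1)) <= dg_lab (a + 1 + k%:Z) (mu (a + 1 + k%:Z)).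
  elim: k => [|k IHk]; first by rewrite addr0.
  have := rowlt (a + 1 + k%:Z) (mu (a + 1 + k%:Z)).
  have := sk_mu_le_lam D (a + 1 + k%:Z).
  rewrite (_ : a + 1 + k.+1%:Z = a + 1 + k%:Z + 1); lia.
have := rowlt a b hb; have := rowlt a' b' hb'; have := mono (absz (a' - a - 1)%R).
rewrite (_ : a + 1 + _ = a'); lia.
Qed.

Lemma diagram_labelling : labelling n m%:Z l dg_row dg_col dg_lab.
Proof.
split.
- by lia.
- exact: dg_l_ge0.
- move=> i; have := dg_box i; have := dg_lab_period (dg_row i) (dg_col i) 1.
  rewrite dg_labK !mul1r => <- hb; apply: (proj1 (dg_labP _)).
  by have := mu_lam_period (dg_row i) 1; rewrite !mul1r; lia.
- move=> i; have := dg_box i; have := dg_lab_period (dg_row i) (dg_col i) 1.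
  rewrite dg_labK !mul1r => <- hb; apply: (proj2 (dg_labP _)).
  by have := mu_lam_period (dg_row i) 1; rewrite !mul1r; lia.
- move=> i j ij; have hi := dg_box i; have hj := dg_box j.
  case: (ltgtP (dg_row i) (dg_row j)) => [|lt|e]; [by left | |].
    by have := dg_lab_lt lt hj hi; rewrite !dg_labK; lia.
  right; split=> //; have e1 := dg_labK i; have e2 := dg_labK j; rewrite e in e1.
  have := dg_lab_shift (dg_row j) (dg_col i) (dg_col j - dg_col i).
  by rewrite [dg_col i + _]addrC subrK e1 e2; lia.
- move=> i j a b /andP[a1 a2] hb; apply: dg_labP.
  have := dg_box i; have := dg_box j; have := mu_lam_anti a1; have := mu_lam_anti a2; lia.
Qed.

(** For [l > 0] the row bounds drift to the left with the rows, so they pass a given column after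
    finitely many. For [l = 0] the left bound is periodic and monotone, hence constant. *)
Lemma infinite_columnP : has_infinite_column D <-> l = 0.
Proof.
have l0 := dg_l_ge0; split=> [[b infb]|le].
  apply: contrapT => l1; apply: infb.
  pose N : nat := absz (`|lam 0| + `|mu 0| + `|b| + 1)%R.
  have lN (k : nat) : lam (0 + k%:Z * m%:Z) <= lam 0 - k%:Z.
    by have [_ ->] := mu_lam_period 0 k%:Z; nia.
  have mN (k : nat) : mu (0 + (- k%:Z) * m%:Z) >= mu 0 + k%:Z.
    by have [-> _] := mu_lam_period 0 (- k%:Z); nia.
  pose s := [seq k%:Z - (N * m)%N%:Z | k <- iota 0 (N * m + N * m).+1].
  apply: (@sub_finite_set _ _ [set` s]%classic).
    move=> a /(sk_boxesE D) hb; suff : a \in s by [].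
    have a1 : a < N%:Z * m%:Z.
      rewrite ltNge; apply/negP => /mu_lam_anti[_].
      by have := lN N; rewrite add0r /N; lia.
    have a2 : - N%:Z * m%:Z < a.
      rewrite ltNge; apply/negP => /mu_lam_anti[].
      by have := mN N; rewrite add0r /N; lia.
    apply/mapP; exists (absz (a + (N * m)%N%:Z)%R); last lia.
    by rewrite mem_iota; lia.
  exact: finite_seq.
exists (mu 0) => fin.
have muE (a : int) : mu a = mu 0.
  have per (k : int) : mu (a + k * m%:Z) = mu a.
    by have [h _] := mu_lam_period a k; move: h le; nia.
  have h1 : mu (a + `|a| * m%:Z) <= mu 0 by apply: (proj1 (mu_lam_anti _)); nia.
  have h2 : mu 0 <= mu (a + - `|a| * m%:Z) by apply: (proj1 (mu_lam_anti _)); nia.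
  by rewrite !per in h1 h2; lia.
apply: infinite_nat; have := finite_preimage (f := Posz) _ fin.
move=> /(_ ltac:(by move=> i j _ _ [])); apply: sub_finite_set => k _ /=.
by apply/(sk_boxesE D); have := sk_mu_le_lam D k; rewrite muE; lia.
Qed.

End DiagramLabelling.

(** * Coefficients in Verma modules *)

Section VermaBasis.
Context (C : numFieldType) (n kappa : nat) {n_ge2 : atleast2 n}.
Variable H : daha C n kappa.
Variable tau : {lrmorphism {mpoly C[n]} -> C | *%R}.
Local Notation T := (dahaW H).
Local Notation W := (dW n).
Local Notation M := (verma H tau).
Local Notation fs := {fsfun W -> {mpoly C[n]} with 0}.

Let pbw (f : fs) : H := \sum_(w <- finsupp f) T w * dahaU H (f w).

Let pbw_inj : injective pbw.
Proof. exact: bij_inj (daha_pbw H). Qed.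

Let pbwE (f : fs) (A : {fset W}) : (finsupp f `<=` A)%fset ->
  pbw f = \sum_(w <- A) T w * dahaU H (f w).
Proof.
move=> fA; apply: big_fset_incl => // w wA wf.
by rewrite (fsfun_dflt wf) rmorph0 mulr0.
Qed.

Let pbw_coef : {psi : H -> fs | cancel psi pbw}.
Proof. by apply: cid; have [psi _ h] := daha_pbw H; exists psi. Qed.

Let co (h : H) : fs := projT1 pbw_coef h.

Let coK h : pbw (co h) = h.
Proof. exact: (projT2 pbw_coef). Qed.

Let coD (h k : H) g : co (h + k) g = co h g + co k g.
Proof.
pose A := (finsupp (co h) `|` finsupp (co k))%fset.
pose f : fs := [fsfun w in A => co h w + co k w].
have fE w : f w = co h w + co k w.
  rewrite fsfunE; case: ifPn => //; rewrite in_fsetU negb_or => /andP[a b].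
  by rewrite !fsfun_dflt // addr0.
suff -> : co (h + k) = f by [].
apply: pbw_inj; rewrite coK (@pbwE f A); last exact: finsupp_sub.
rewrite -{1}[h]coK -{1}[k]coK (@pbwE (co h) A) ?fsubsetUl //.
rewrite (@pbwE (co k) A) ?fsubsetUr // -big_split /=.
by apply: eq_bigr => w _; rewrite fE rmorphD mulrDr.
Qed.

Let coMU (h : H) p g : co (h * dahaU H p) g = co h g * p.
Proof.
pose A := finsupp (co h).
pose f : fs := [fsfun w in A => co h w * p].
have fE w : f w = co h w * p.
  rewrite fsfunE; case: ifPn => // a; by rewrite fsfun_dflt // mul0r.
suff -> : co (h * dahaU H p) = f by [].
apply: pbw_inj; rewrite coK (@pbwE f A); last exact: finsupp_sub.
rewrite -{1}[h]coK (@pbwE (co h) A) // big_distrl /=.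
by apply: eq_bigr => w _; rewrite fE rmorphM mulrA.
Qed.

Let coT h g : co (T h) g = (g == h)%:R.
Proof.
pose A := [fset h]%fset.
pose f : fs := [fsfun w in A => 1].
have fE w : f w = (w == h)%:R.
  by rewrite fsfunE in_fset1; case: eqP.
suff -> : co (T h) = f by [].
apply: pbw_inj; rewrite coK (@pbwE f A); last exact: finsupp_sub.
by rewrite big_seq_fset1 fE eqxx rmorph1 mulr1.
Qed.

(** The coefficient of [T g] on the generator of the Verma module: the PBW coefficient is a
    polynomial, on which [tau] is then evaluated. *)
Let F g (h : H) : C := tau (co h g).

Let FD g (h k : H) : F g (h + k) = F g h + F g k.
Proof. by rewrite /F coD rmorphD. Qed.

Let F_ideal g (h : H^o) : h \in gen_submod (@verma_ideal C n kappa H tau) -> F g h = 0.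
Proof.
(* Asking for all left multiples [k * h] makes [S] a left ideal, so it suffices to check the
   generators. *)
pose S : {pred H^o} := [pred h : H^o | `[< forall g (k : H), F g (k * h) = 0 >]].
move=> /asboolP /(_ S) hS.
have : h \in S.
  apply: hS => [|_ [p ->]].
    have F0 g' : F g' 0 = 0.
      by have := coD 0 0 g'; rewrite addr0 /F -[X in X = _]addr0 => /addrI <-; rewrite rmorph0.
    split; first by rewrite inE => g' k; rewrite mulr0.
    move=> a x y; rewrite !inE => hx hy g' k.
    have -> : k * (a *: x + y) = k * a * (x : H) + k * y.
      by rewrite mulrDr; congr (_ + _); apply: mulrA.
    by rewrite FD hx hy addr0.
  rewrite inE => g' k; have -> : (tau p)%:A = dahaU H (tau p)%:MP.
    by rewrite -[_%:MP]mulr1 mul_mpolyC linearZ /= rmorph1.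
  rewrite -rmorphB /F coMU rmorphM rmorphB /= -[_%:MP]mulr1 mul_mpolyC.
  by rewrite linearZ /= rmorph1 mulr1 subrr mulr0.
by rewrite inE => /(_ g 1); rewrite mul1r.
Qed.

Definition vcoef (g : W) (x : M) : C := F g (repr x : H^o).

Let piE (h : H^o) : h *: verma_one H tau = \pi_(mod_quot (verma_ideal (H := H) tau)) h.
Proof. by rewrite /verma_one -pi_mod_quotZ; congr (\pi _); apply: mulr1. Qed.

Let vcoefE g (h : H) : vcoef g (h *: verma_one H tau) = F g h.
Proof.
rewrite piE /vcoef; set h' := repr _.
have e : (h' : H) = h + (h' - h) by rewrite addrC subrK.
have hin : (h' : H^o) - (h : H^o) \in gen_submod (@verma_ideal C n kappa H tau).
  by rewrite pi_mod_quotP reprK.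
by rewrite {1}e FD (F_ideal _ hin) addr0.
Qed.

Lemma vcoef_one h g : vcoef g (T h *: verma_one H tau) = (g == h)%:R.
Proof. by rewrite vcoefE /F coT rmorph_nat. Qed.

Let gen (x : M) : exists h : H, x = h *: verma_one H tau.
Proof. by exists (repr x : H^o); rewrite piE reprK. Qed.

Lemma vcoefD g x y : vcoef g (x + y) = vcoef g x + vcoef g y.
Proof.
have [h ->] := gen x; have [k ->] := gen y.
by rewrite -scalerDl !vcoefE FD.
Qed.

Lemma vcoefZ g c x : vcoef g (sc c x) = c * vcoef g x.
Proof.
have [h ->] := gen x; rewrite /sc scalerA !vcoefE.
rewrite mulr_algl -mulr_algr.
have -> : (c%:A : H) = dahaU H c%:MP.
  by rewrite -[_%:MP]mulr1 mul_mpolyC linearZ /= rmorph1.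
rewrite /F coMU rmorphM mulrC; congr (_ * _).
rewrite -[_%:MP]mulr1 mul_mpolyC; have := linearZ_LR tau c 1.
by rewrite rmorph1 mulr1.
Qed.

Lemma verma_one_poly p : dahaU H p *: verma_one H tau = sc (tau p) (verma_one H tau).
Proof.
have [h _] := @verma_hom C n kappa H tau M (verma_one H tau).
by apply: h; exists idfun.
Qed.

Lemma verma_sum (x : M) : exists s : seq W,
  uniq s /\ x = \sum_(g <- s) sc (vcoef g x) (T g *: verma_one H tau).
Proof.
have [h ->] := gen x; exists (finsupp (co h)); split; first exact: fset_uniq.
rewrite -{1}[h]coK scaler_suml; apply: eq_bigr => g _.
by rewrite -scalerA verma_one_poly sc_comm vcoefE.
Qed.

Lemma vcoef0 g : vcoef g 0 = 0.
Proof. by have := vcoefZ g 0 0; rewrite sc0l mul0r. Qed.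

Lemma vcoef_sum g (I : Type) (s : seq I) (P : pred I) (E : I -> M) :
  vcoef g (\sum_(i <- s | P i) E i) = \sum_(i <- s | P i) vcoef g (E i).
Proof. exact: (big_morph (vcoef g) (vcoefD g) (vcoef0 g)). Qed.

Lemma vcoefT g h x : vcoef g (T h *: x) = vcoef (h^-1 * g)%g x.
Proof.
have [s [us xE]] := verma_sum x; rewrite xE scaler_sumr !vcoef_sum.
apply: eq_bigr => k _; rewrite sc_comm scalerA -dahaWM !vcoefZ !vcoef_one.
congr (_ * _%:R); congr nat_of_bool; apply/eqP/eqP => [->|<-].
  by rewrite mulKg.
by rewrite mulVKg.
Qed.

Lemma vcoef_support (x : M) : exists s : seq W, forall g, vcoef g x != 0 -> g \in s.
Proof.
have [s [us xE]] := verma_sum x; exists s => g; apply: contraR => gs.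
rewrite xE vcoef_sum big_seq big1 // => k ks.
rewrite vcoefZ vcoef_one; case: eqP => [e|_]; last by rewrite mulr0.
by rewrite e ks in gs.
Qed.

Lemma vcoef_neq0 (x : M) : x != 0 -> exists g, vcoef g x != 0.
Proof.
move=> x0; have [s [us xE]] := verma_sum x; apply: contrapT => /forallNP h.
case/negP: x0; rewrite xE big1 // => g _.
by have /negP := h g; rewrite negbK => /eqP ->; rewrite sc0l.
Qed.

End VermaBasis.

(** * Symmetrization along blocks *)

Section Inversions.
Context (C : numFieldType) (n kappa : nat) {n_ge2 : atleast2 n}.
Let hn : (2 <= n)%N := n_ge2.
Variable H : daha C n kappa.
Local Notation T := (dahaW H).
Local Notation U := (uZ H).
Local Notation W := (dW n).

(** It is 1 or -1 when [g^-1] reverses the order of [i] and [j], and 0 otherwise. *)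
Definition inversion (g : W) (i j : int) : int :=
  (j < i)%R%:Z - (act g^-1%g j < act g^-1%g i)%R%:Z.

Lemma inversion_cg g i j : cg n i j -> inversion g i j = 0.
Proof.
move=> /cgP[q ->]; rewrite /inversion periodicM; last exact: act_periodic.
by rewrite !ltrDl subrr.
Qed.

Lemma tr_adj_mono (k i j : int) : j < i -> j != tr n k (k + 1) i ->
  tr n k (k + 1) j < tr n k (k + 1) i.
Proof.
set s := tr n k (k + 1) => ji jsi.
have sK : involutive s by apply: trK; rewrite cgS.
have near x : `|s x - x| <= 1.
  by rewrite /s /tr; case: ifP => _; [lia | case: ifP => _; lia].
have ne : s j != s i by rewrite (inj_eq (inv_inj sK)); lia.
have [e|ne2] := eqVneq i (j + 1); last first.
  by have := near i; have := near j; lia.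
have ne3 : s j != j + 1 by apply: contra jsi => /eqP e2; rewrite e -e2 sK.
by have := near i; have := near j; lia.
Qed.

(** Crossing a whole group element leaves one term for each inverted pair. The list [js] may be any
    sufficiently large one, so that a common list can serve several [g]. *)
Lemma uZ_dW (g : W) (i : int) : exists js0 : seq int, forall js, uniq js ->
  {subset js0 <= js} ->
  U i * T g = T g * U (act g^-1%g i) +
    \sum_(j <- js) (inversion g i j)%:~R * T (tg n i j * g)%g.
Proof.
have [N hN] := sg_word_exists g; elim: hN i => [d|k {}N {}g _ IH] i.
  exists [::] => js _ _.
  have e j : act (piz n d)^-1%g j = j - d.
    by apply: (@act_injective _ _ (piz n d)); rewrite actKV act_piz subrK.
  rewrite big1 ?addr0 => [|j _]; first by rewrite e T_pizU subrK.
  by rewrite /inversion !e ltrD2r subrr mulr0z mul0r.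
set s := tr n k (k + 1).
have sK : involutive s by apply: trK; rewrite cgS.
have sgV j : act (sg n k)^-1%g j = s j.
  by apply: (@act_injective _ _ (sg n k)); rewrite actKV act_sg -/s sK.
have [js0 hjs0] := IH (s i).
exists (s i :: map s js0) => js ujs sub.
have ujs' : uniq (map s js) by rewrite map_inj_uniq //; apply: inv_inj.
have sub' : {subset js0 <= map s js}.
  move=> j hj; rewrite -(sK j) map_f //; apply: sub.
  by rewrite inE map_f ?orbT.
rewrite dahaWM mulrA U_T_sg -/s mulrDl -!mulrA (hjs0 _ ujs' sub') mulrDr.
rewrite invgM actM sgV -addrA; congr (_ + _).
rewrite big_map mulr_sumr.
have e1 j : T (sg n k) * ((inversion g (s i) (s j))%:~R * T (tg n (s i) (s j) * g)%g) =
    (inversion g (s i) (s j))%:~R * T (tg n i j * (sg n k * g))%g.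
  have [c|c] := boolP (cg n (s i) (s j)).
    by rewrite inversion_cg // mulr0z !mul0r mulr0.
  rewrite mulrA -intC -mulrA -dahaWM; congr (_ * T _).
  by rewrite mulgA tg_conj // !act_sg -/s !sK mulgA.
rewrite (eq_bigr _ (fun j _ => e1 j)).
have e2 j : inversion (sg n k * g)%g i j =
    inversion g (s i) (s j) + ((j < i)%R%:Z - (s j < s i)%R%:Z).
  by rewrite /inversion invgM !actM !sgV [RHS]addrC addrA subrK.
(* A simple reflection reverses [i] and [j] only for [j = s i], so its correction is a sum with at
   most one nonzero term. *)
have e3 : ((cg n i (k + 1))%:Z - (cg n i k)%:Z)%:~R * T g =
    \sum_(j <- js) ((j < i)%R%:Z - (s j < s i)%R%:Z)%:~R * T (tg n i j * (sg n k * g))%g.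
  have zero j : j != s i -> ((j < i)%R%:Z - (s j < s i)%R%:Z) = 0.
    move=> jsi; case: (ltgtP j i) => [lt|lt|->]; last by rewrite !ltxx.
      by rewrite tr_adj_mono.
    rewrite ltNge ltW // tr_adj_mono //.
    by apply: contra jsi => /eqP ->; rewrite -/s sK.
  rewrite (bigD1_seq (s i)) //=; last by apply: sub; rewrite inE eqxx.
  rewrite (_ : \sum_(j <- js | j != s i) _ = 0) ?addr0; last first.
    by rewrite big1 // => j jsi; rewrite zero // mulr0z mul0r.
  have [c|c] := boolP (cg n i k).
    have -> : s i = i + 1 by rewrite /s /tr c; lia.
    have -> : s (i + 1) = i by rewrite -(_ : s i = i + 1) ?sK // /s /tr c; lia.
    have tE : tg n i (i + 1) = sg n k.
      by rewrite tg_sg; move/cgP: c => [q ->]; rewrite sg_translate.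
    rewrite tE mulgA sgK mul1g; congr (_%:~R * _).
    by rewrite (cgl _ c) cgS; lia.
  have [c'|c'] := boolP (cg n i (k + 1)).
    have e : s i = i - 1 by rewrite /s /tr (negbTE c) c'; lia.
    have -> : s (s i) = i by rewrite sK.
    rewrite e; have tE : tg n i (i - 1) = sg n k.
      rewrite tgC; last by rewrite cg_sym -{2}(subrK 1 i) cgS.
      rewrite -{2}(subrK 1 i) tg_sg.
      move/cgP: c' => [q ->]; rewrite (_ : k + 1 + q * n%:Z - 1 = k + q * n%:Z); last lia.
      by rewrite sg_translate.
    by rewrite tE mulgA sgK mul1g; congr (_%:~R * _); lia.
  by rewrite sK [s i]tr_id // ltxx subrr !mulr0z !mul0r.
rewrite e3 -big_split /=; apply: eq_bigr => j _.
by rewrite e2 -mulrDl -intrD.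
Qed.

End Inversions.

Section BlockSymmetrizer.
Context (C : numFieldType) (n kappa : nat) {n_ge2 : atleast2 n}.
Let hn : (2 <= n)%N := n_ge2.
Variable H : daha C n kappa.
Local Notation T := (dahaW H).
Local Notation U := (uZ H).
Local Notation W := (dW n).

Definition perm_act (s : 'S_n) (j : int) : int :=
  let i := projT1 (cid (residue (n := n) j)) in (s i).+1%:Z + (j - i.+1%:Z).

Lemma perm_actE (s : 'S_n) (i : 'I_n) (q : int) :
  perm_act s (i.+1%:Z + q * n%:Z) = (s i).+1%:Z + q * n%:Z.
Proof.
rewrite /perm_act; case: cid => i' /= hi'.
have -> : i' = i; last by lia.
apply/esym/eqP; rewrite -(cg_ord i i').
by rewrite -(cgl _ (_ : cg n (i.+1%:Z + q * n%:Z) i.+1%:Z)) //; apply/cgP; exists q.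
Qed.

Lemma perm_act_periodic s : periodic n (perm_act s).
Proof.
move=> j; have [i /cgP[q ->]] := residue (n := n) j.
rewrite (_ : i.+1%:Z + q * n%:Z + n%:Z = i.+1%:Z + (q + 1) * n%:Z); last lia.
by rewrite !perm_actE; lia.
Qed.

Lemma perm_act_inj s : injective (perm_act s).
Proof.
move=> j k; have [a /cgP[q ->]] := residue (n := n) j.
have [b /cgP[r ->]] := residue (n := n) k; rewrite !perm_actE => e.
have ab : a = b.
  apply: (@perm_inj _ s); apply/eqP; rewrite -cg_ord; apply/cgP.
  by exists (r - q); lia.
by move: e; rewrite ab; lia.
Qed.

Definition pemb (s : 'S_n) : W := dW_of n (perm_act s).

Lemma act_pemb s (i : 'I_n) (q : int) :
  act (pemb s) (i.+1%:Z + q * n%:Z) = (s i).+1%:Z + q * n%:Z.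
Proof.
rewrite act_dW_of ?perm_actE //; first exact: perm_act_periodic.
exact: perm_act_inj.
Qed.

(** In ['S_n] the product [s * t] applies [s] first, whence the reversed order. *)
Lemma pembM s t : pemb (s * t)%g = (pemb t * pemb s)%g.
Proof.
apply: act_inj => j; have [i /cgP[q ->]] := residue (n := n) j.
by rewrite actM !act_pemb permM.
Qed.

Lemma pemb1 : pemb 1%g = 1%g.
Proof.
apply: act_eq1 => j; have [i /cgP[q ->]] := residue (n := n) j.
by rewrite act_pemb perm1.
Qed.

Lemma pemb_tperm (a b : 'I_n) : a != b -> pemb (tperm a b) = tg n a.+1%:Z b.+1%:Z.
Proof.
move=> ab; have nab : ~~ cg n a.+1%:Z b.+1%:Z by rewrite cg_ord.
apply: act_inj => j; have [i /cgP[q ->]] := residue (n := n) j.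
rewrite act_pemb act_tg // periodicM; last exact: tr_periodic.
congr (_ + _); case: tpermP => [->|->|/eqP ia /eqP ib].
- by rewrite trl.
- by rewrite trr.
- by rewrite tr_id // cg_ord.
Qed.

Variables (bk : int -> int) (mb : int).
Hypothesis bk_le : forall i j : int, i <= j -> bk i <= bk j.
Hypothesis bk_period : forall i : int, bk (i + n%:Z) = bk i + mb.
Hypothesis bk01 : bk 0 != bk 1.

Lemma bk_translate (i q : int) : bk (i + q * n%:Z) = bk i + q * mb.
Proof.
have nat_case (k : nat) (j : int) : bk (j + k%:Z * n%:Z) = bk j + k%:Z * mb.
  elim: k => [|k IHk]; first by rewrite !mul0r !addr0.
  rewrite (_ : j + k.+1%:Z * n%:Z = j + k%:Z * n%:Z + n%:Z); last lia.
  by rewrite bk_period IHk; lia.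
case: q => k; first exact: nat_case.
have := nat_case k.+1 (i + Negz k * n%:Z).
by rewrite (_ : i + Negz k * n%:Z + k.+1%:Z * n%:Z = i); lia.
Qed.

(** Since [bk 0] and [bk 1] differ, a block boundary separates any two consecutive periods. The
    permutations of the blocks thus form a Young subgroup of ['S_n]. *)
Lemma block_residues (i j : int) : bk i = bk j -> exists (a b : 'I_n) (q : int),
  [/\ i = a.+1%:Z + q * n%:Z, j = b.+1%:Z + q * n%:Z & bk a.+1%:Z = bk b.+1%:Z].
Proof.
have H1 (a b : 'I_n) (q r : int) : q < r ->
    bk (a.+1%:Z + q * n%:Z) < bk (b.+1%:Z + r * n%:Z).
  move=> qr; have al := ltn_ord a.
  have h1 : bk (a.+1%:Z + q * n%:Z) <= bk (0 + r * n%:Z) by apply: bk_le; nia.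
  have h2 : bk (1 + r * n%:Z) <= bk (b.+1%:Z + r * n%:Z) by apply: bk_le; lia.
  apply: le_lt_trans h1 _; apply: lt_le_trans h2.
  by rewrite !bk_translate ltrD2r lt_neqAle bk01 bk_le.
have [a /cgP[q iE]] := residue (n := n) i; have [b /cgP[r jE]] := residue (n := n) j.
move=> e; exists a, b, q; have [qr|qr|qr] := ltgtP q r.
- by have := H1 a b q r qr; rewrite -iE -jE e ltxx.
- by have := H1 b a r q qr; rewrite -iE -jE e ltxx.
split=> //; first by rewrite qr.
by move: e; rewrite iE jE qr !bk_translate => /addIr.
Qed.

Lemma block_cg (i j : int) : bk i = bk j -> cg n i j -> i = j.
Proof.
move=> /block_residues[a [b [q [-> -> _]]]].
by rewrite cgDr cg_ord => /eqP ->.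
Qed.

Definition bp (s : 'S_n) : bool := [forall i : 'I_n, bk (s i).+1%:Z == bk i.+1%:Z].

Definition block_perm (g : W) : Prop :=
  (forall j, bk (act g j) = bk j) /\
  (forall N j : int, (N * n%:Z < act g j) = (N * n%:Z < j)).

Lemma bp_block_perm s : bp s -> block_perm (pemb s).
Proof.
move=> /forallP hs; split=> [j|N j]; have [i /cgP[q ->]] := residue (n := n) j.
  by rewrite act_pemb !bk_translate (eqP (hs i)).
rewrite act_pemb; have h1 := ltn_ord i; have h2 := ltn_ord (s i).
have [Nq|qN] := leP N q; apply/idP/idP; nia.
Qed.

Lemma block_permV g : block_perm g -> block_perm (g^-1)%g.
Proof.
move=> [h1 h2]; split=> [j|N j]; first by rewrite -h1 actKV.
by rewrite -h2 actKV.
Qed.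

Variables (V : lmodType H) (e : int).
Hypothesis e2 : e * e = 1.
Let eps : C := e%:~R.
Let eps2 : eps * eps = 1.
Proof. by rewrite -intrM e2. Qed.

Definition bsign (s : 'S_n) : C := eps ^+ (odd_perm s).

Lemma bsignM s t : bsign (s * t)%g = bsign s * bsign t.
Proof.
rewrite /bsign odd_permM; case: (odd_perm s); case: (odd_perm t) => /=;
  by rewrite ?expr0 ?expr1 ?eps2 ?mulr1 ?mul1r.
Qed.

(** The sum over the Young subgroup: a symmetrizer for [e = 1], an antisymmetrizer for [e = -1]. *)
Definition bsum (X : W -> V) : V := \sum_(s : 'S_n | bp s) sc (bsign s) (X (pemb s)).

Lemma sc_sumr (I : Type) (r : seq I) (P : pred I) c (E : I -> V) :
  sc c (\sum_(i <- r | P i) E i) = \sum_(i <- r | P i) sc c (E i).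
Proof. exact: scaler_sumr. Qed.

Lemma eq_bsum (X Y : W -> V) : (forall g, block_perm g -> X g = Y g) ->
  bsum X = bsum Y.
Proof.
by move=> XY; apply: eq_bigr => s /bp_block_perm bs; rewrite XY.
Qed.

Lemma bsumD (X Y : W -> V) : bsum (fun g => X g + Y g) = bsum X + bsum Y.
Proof. by rewrite -big_split /=; apply: eq_bigr => s _; rewrite scDr. Qed.

Lemma bsumZ c (X : W -> V) : bsum (fun g => sc c (X g)) = sc c (bsum X).
Proof.
by rewrite sc_sumr; apply: eq_bigr => s _; rewrite !scA mulrC.
Qed.

Lemma bsum_H (h : H) (X : W -> V) : bsum (fun g => h *: X g) = h *: bsum X.
Proof. by rewrite scaler_sumr; apply: eq_bigr => s _; rewrite sc_comm. Qed.

Lemma bsum_sum (js : seq int) (P : pred int) (X : int -> W -> V) :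
  bsum (fun g => \sum_(j <- js | P j) X j g) = \sum_(j <- js | P j) bsum (X j).
Proof.
rewrite /bsum exchange_big /=; apply: eq_bigr => s _.
exact: sc_sumr.
Qed.

Lemma tperm_block (i j : int) : bk i = bk j -> i != j -> exists a b : 'I_n,
  [/\ a != b, tg n i j = pemb (tperm a b) & bk a.+1%:Z = bk b.+1%:Z].
Proof.
move=> /block_residues[a [b [q [-> -> bab]]]] ne; exists a, b.
have ab : a != b by apply: contra ne => /eqP ->.
split=> //; rewrite pemb_tperm //; apply: act_inj => k.
by rewrite !act_tg ?tr_translate // ?cgDr cg_ord.
Qed.

Lemma bp_tpermL (a b : 'I_n) s : bk a.+1%:Z = bk b.+1%:Z -> bp (tperm a b * s)%g = bp s.
Proof.
move=> ab; have H1 t : bp t -> bp (tperm a b * t)%g.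
  move=> /forallP ht; apply/forallP => i; rewrite permM (eqP (ht _)).
  by case: tpermP => [->|->|//]; rewrite ?ab // eq_sym.
by apply/idP/idP; [move/H1; rewrite mulgA tperm2 mul1g | exact: H1].
Qed.

Lemma bp_tpermR (a b : 'I_n) s : bk a.+1%:Z = bk b.+1%:Z -> bp (s * tperm a b)%g = bp s.
Proof.
move=> ab; have H1 t : bp t -> bp (t * tperm a b)%g.
  move=> /forallP ht; apply/forallP => i; rewrite permM -(eqP (ht i)).
  by case: tpermP => [->|->|//]; rewrite ?ab.
by apply/idP/idP; [move/H1; rewrite -mulgA tperm2 mulg1 | exact: H1].
Qed.

Lemma bsign_tperm (a b : 'I_n) : a != b -> bsign (tperm a b) = eps.
Proof. by move=> ab; rewrite /bsign odd_tperm ab expr1. Qed.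

Lemma bsum_right (X : W -> V) (i j : int) : bk i = bk j -> i != j ->
  bsum (fun g => X (g * tg n i j)%g) = sc eps (bsum X).
Proof.
move=> ij ne; have [a [b [ab tE bab]]] := tperm_block ij ne.
rewrite /bsum [in RHS](reindex_inj (mulgI (tperm a b))) /=.
rewrite sc_sumr; apply: eq_big => [s|s _]; first by rewrite bp_tpermL.
rewrite tE -pembM bsignM bsign_tperm // scA mulrA eps2 mul1r //.
Qed.

Lemma bsum_left (X : W -> V) (i j : int) : bk i = bk j -> i != j ->
  bsum (fun g => X (tg n i j * g)%g) = sc eps (bsum X).
Proof.
move=> ij ne; have [a [b [ab tE bab]]] := tperm_block ij ne.
rewrite /bsum [in RHS](reindex_inj (mulIg (tperm a b))) /=.
rewrite sc_sumr; apply: eq_big => [s|s _]; first by rewrite bp_tpermR.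
rewrite tE -pembM bsignM bsign_tperm // scA mulrC -mulrA eps2 mulr1 //.
Qed.

End BlockSymmetrizer.

(** * The weight of a symmetrized vector *)

Section SymmetrizedVector.
Context (C : numFieldType) (n kappa : nat) {n_ge2 : atleast2 n}.
Let hn : (2 <= n)%N := n_ge2.
Variable H : daha C n kappa.
Local Notation T := (dahaW H).
Local Notation U := (uZ H).
Local Notation W := (dW n).

Variables (bk : int -> int) (mb : int).
Hypothesis bk_le : forall i j : int, i <= j -> bk i <= bk j.
Hypothesis bk_period : forall i : int, bk (i + n%:Z) = bk i + mb.
Hypothesis bk01 : bk 0 != bk 1.
Variables (V : lmodType H) (e : int).
Hypothesis e2 : e * e = 1.
Local Notation eps := (e%:~R : C).
Variables (ct : int -> int) (w : W) (y : V).
Hypothesis ct_block : forall i : int, bk (i + 1) = bk i -> ct (i + 1) = ct i + e.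
Hypothesis y_wt : wt (fun k => ct (act w k)) y.
Let y' := T w *: y.
Hypothesis w_rev : forall i j : int, bk i = bk j -> i < j -> act w^-1%g j < act w^-1%g i.
Hypothesis w_col : forall i j : int, bk i != bk j -> inversion w i j != 0 ->
  exists x, [/\ bk x = bk j, x != j, ~~ cg n i x & T (tg n i x) *: y' = sc (- eps) y'].

Local Notation bsum := (bsum bk e).
Local Notation bsum_left := (bsum_left bk_le bk_period bk01 e2).
Local Notation bsum_right := (bsum_right bk_le bk_period bk01 e2).

(** [y'] is the translate of [y] by an element [w] whose inverse reverses every block ([w_rev]). The
    pairs of different blocks that [w] inverts are harmless by [w_col]: they meet a transposition
    under which [y'] has the opposite sign. *)
Definition block_vector : V := bsum (fun g => T g *: y').

Lemma block_vector_sym (i j : int) : bk i = bk j -> i != j ->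
  T (tg n i j) *: block_vector = sc eps block_vector.
Proof.
move=> ij ne; rewrite -(bsum_left (fun g => T g *: y') ij ne) /block_vector.
rewrite -bsum_H; congr bsum; apply/funext => g.
by rewrite scalerA dahaWM.
Qed.

Lemma ct_blockE (p q : int) : bk p = bk q -> ct q = ct p + e * (q - p).
Proof.
wlog pq : p q / p <= q => [Hw|].
  move=> bpq; have [|/ltW qp] := leP p q; first by move/Hw; apply.
  by rewrite (Hw q p) //; lia.
have -> : q = p + (absz (q - p)%R)%:Z by lia.
elim: (absz _) => [|k IHk] bpq; first by rewrite !addr0 subrr mulr0 addr0.
have h1 : bk p <= bk (p + k%:Z) by apply: bk_le; lia.
have h2 : bk (p + k%:Z) <= bk (p + k.+1%:Z) by apply: bk_le; lia.
have bpk : bk p = bk (p + k%:Z) by lia.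
have stepE : p + k.+1%:Z = p + k%:Z + 1 by lia.
by rewrite stepE ct_block; [rewrite IHk //; lia | rewrite -stepE -bpk -bpq].
Qed.

(** A union of whole periods, hence stable under block permutations. *)
Let window (N : nat) : seq int :=
  [seq k%:Z - (N * n)%N%:Z + 1 | k <- iota 0 (N * n + N * n)].

Let mem_window N (j : int) :
  (j \in window N) = (- N%:Z * n%:Z < j) && ~~ (N%:Z * n%:Z < j).
Proof.
apply/mapP/idP => [[k]|h]; first by rewrite mem_iota => hk ->; lia.
exists (absz (j + (N * n)%N%:Z - 1)%R); last lia.
by rewrite mem_iota; lia.
Qed.

Let window_uniq N : uniq (window N).
Proof. by rewrite map_inj_uniq ?iota_uniq // => i j; lia. Qed.

Let window_perm N (g : W) : block_perm bk g -> perm_eq (map (act g) (window N)) (window N).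
Proof.
move=> hg; apply: uniq_perm => //.
  by rewrite map_inj_uniq //; apply: act_injective.
move=> j; have [_ hV] := block_permV hg.
rewrite -{1}(actKV g j) mem_map; last exact: act_injective.
by rewrite !mem_window !hV.
Qed.

(** The sum counts the labels of the block between [i'] and [i]; this is the shift needed to pass
    from [ct i'] to [ct i]. *)
Let count_block (N : nat) (i i' : int) : bk i = bk i' ->
  i \in window N -> i' \in window N ->
  \sum_(j <- window N | bk j == bk i) ((j < i)%R%:Z - (j < i')%R%:Z) = i - i'.
Proof.
wlog ii : i i' / i' <= i => [Hw|].
  move=> bii hi hi'; have [|/ltW le] := leP i' i; first by move/Hw; apply.
  have := Hw i' i le (esym bii) hi' hi; rewrite -bii => E.
  apply: oppr_inj; rewrite -sumrN opprB -{}E; apply: eq_bigr => j _.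
  by rewrite opprB.
have -> : i = i' + (absz (i - i')%R)%:Z by lia.
elim: (absz _) => [|k IHk] bii hi hi'.
  by rewrite addr0 subrr big1 // => j _; rewrite subrr.
have h1 : bk i' <= bk (i' + k%:Z) by apply: bk_le; lia.
have h2 : bk (i' + k%:Z) <= bk (i' + k.+1%:Z) by apply: bk_le; lia.
have bk' : bk (i' + k%:Z) = bk i' by lia.
have stepE : i' + k.+1%:Z = i' + k%:Z + 1 by lia.
have hk : i' + k%:Z \in window N.
  by move: hi hi'; rewrite !mem_window; lia.
have := IHk bk' hk hi'; rewrite bk' bii => E.
rewrite (_ : i' + k.+1%:Z - i' = i' + k%:Z - i' + 1); last lia.
rewrite -{}E.
have E1 : \sum_(j <- window N | bk j == bk i') (j == i' + k%:Z)%:Z = 1.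
  rewrite -big_filter (bigD1_seq (i' + k%:Z)) ?filter_uniq ?mem_filter ?bk' ?eqxx //=.
  by rewrite big1 // => j /negbTE ->.
set S := (X in _ = X + 1); transitivity (S + \sum_(j <- window N | bk j == bk i') (j == i' + k%:Z)%:Z); last by rewrite E1.
rewrite /S -big_split /=; apply: eq_bigr => j _.
rewrite stepE.
by case: (ltgtP j (i' + k%:Z)) => [lt|lt|->]; case: (ltP j i') => ? /=; case: ltP => ?; lia.
Qed.

Let sc_suml (I : Type) (r : seq I) (P : pred I) (a : I -> C) (x : V) :
  sc (\sum_(i <- r | P i) a i) x = \sum_(i <- r | P i) sc (a i) x.
Proof.
by apply: (big_morph (fun c => sc c x)) => [c d|]; [rewrite scDl | rewrite sc0l].
Qed.

Let eps2 : eps * eps = 1.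
Proof. by rewrite -intrM e2. Qed.

(* The transposition of j and x, where x is the box given by w_col, changes the
   sign of every term of the sum. *)
Let cross_zero (i i' j : int) : bk i' != bk j ->
  bsum (fun g => sc ((i' == act g^-1%g i)%:R * (inversion w i' j)%:~R)
    (T (g * tg n i' j)%g *: y')) = 0.
Proof.
move=> bij; have [->|inv0] := eqVneq (inversion w i' j) 0.
  by rewrite /bsum big1 // => s _; rewrite mulr0z mulr0 sc0l sc0r.
have [x [bx xj cx yx]] := w_col bij inv0.
have cj : ~~ cg n i' j by apply: contra inv0 => /inversion_cg ->.
have cjx : ~~ cg n j x.
  apply/negP => /(block_cg bk_le bk_period bk01 (esym bx)) jx.
  by rewrite jx eqxx in xj.
set X := fun g : W => sc _ _.
have jx : j != x by rewrite eq_sym.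
have E : bsum (fun g => X (g * tg n j x)%g) = sc eps (bsum X).
  exact: bsum_right.
have tE : (tg n j x * tg n i' j * tg n i' x = tg n i' j)%g.
  rewrite -mulgA (tg_conj (tg n i' j) cx) !act_tg // trl [tr n i' j x]tr_id; last 2 first.
  - by rewrite cg_sym.
  - by rewrite cg_sym.
  by rewrite mulgA tgK // mul1g.
have XE g : X (g * tg n j x)%g = sc (- eps) (X g).
  rewrite /X invgM actM.
  have -> : (i' == act (tg n j x)^-1%g (act g^-1%g i)) = (i' == act g^-1%g i).
    have fixi : act (tg n j x) i' = i' by rewrite act_tg // tr_id.
    apply/eqP/eqP => [E'|<-]; first by rewrite -[LHS]fixi E' actKV.
    by apply: (@act_injective _ _ (tg n j x)); rewrite actKV.
  have yE : y' = sc (- eps) (T (tg n i' x) *: y') by rewrite yx scA mulrNN eps2 sc1l.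
  have vE : T (g * tg n j x * tg n i' j)%g *: y' = sc (- eps) (T (g * tg n i' j)%g *: y').
    rewrite [in LHS]yE sc_comm scalerA -dahaWM -!mulgA; congr (sc _ (T _ *: _)).
    by rewrite -[in RHS]tE !mulgA.
  by rewrite vE !scA mulrC.
move: E; rewrite (_ : (fun g => X (g * tg n j x)%g) = fun g => sc (- eps) (X g)); last first.
  by apply/funext => g.
rewrite bsumZ => /eqP; rewrite -subr_eq0 -scBl => /eqP; apply: sc_inj.
rewrite -opprD oppr_eq0 -intrD intr_eq0; move: e2; nia.
Qed.

(** On the term of [g], [U i] has the diagonal value [ct (g^-1 i)]. The inversions inside the block
    of [i] supply the missing [e * (i - g^-1 i)], and those with other blocks cancel. *)
Lemma block_vector_wt : wt ct block_vector.
Proof.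
move=> i.
have [jf hjf] : exists jf : W -> seq int, forall g js, uniq js -> {subset jf g <= js} ->
    U i * T g = T g * U (act g^-1%g i) +
      \sum_(j <- js) (inversion g i j)%:~R * T (tg n i j * g)%g.
  exists (fun g => projT1 (cid (uZ_dW H g i))) => g.
  by case: cid.
pose al : seq int := i :: flatten [seq jf (@pemb n n_ge2 s * w)%g | s <- enum 'S_n].
have [N hN] : exists N : nat, forall j : int, j \in al -> j \in window N.
  elim: (al) => [|a s [N hN]]; first by exists 0%N.
  exists (N + absz a).+1 => j; rewrite inE mem_window => /predU1P[->|/hN]; first by nia.
  by rewrite mem_window; nia.
have iN : i \in window N by apply: hN; rewrite inE eqxx.
pose Z g j := sc (inversion (g * w)%g i j)%:~R (T (tg n i j * g)%g *: y').
have -> : U i *: block_vector =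
    bsum (fun g => sc (ct (act g^-1%g i))%:~R (T g *: y') + \sum_(j <- window N) Z g j).
  rewrite /block_vector -bsum_H; apply: eq_bigr => s _; congr (sc _ _).
  have sub : {subset jf (pemb s * w)%g <= window N}.
    move=> j hj; apply: hN; rewrite inE; apply/orP; right; apply/flattenP.
    by exists (jf (pemb s * w)%g) => //; apply: map_f; rewrite mem_enum.
  rewrite /y' !scalerA -mulrA -dahaWM (hjf _ _ (window_uniq N) sub) scalerDl.
  rewrite -scalerA y_wt sc_comm invgM actM actKV scaler_suml; congr (_ + _).
  apply: eq_bigr => j _; rewrite /Z sc_int !scalerA -mulrA; congr (_ *: y).
  by rewrite -dahaWM mulgA.
have part1 : bsum (fun g => \sum_(j <- window N | bk j == bk i) Z g j) =
    bsum (fun g => sc (e * (i - act g^-1%g i))%:~R (T g *: y')).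
  rewrite bsum_sum.
  have term j : bk j == bk i -> bsum (Z^~ j) =
      bsum (fun h => sc (e * ((j < i)%R%:Z - (act h^-1%g j < act h^-1%g i)%R%:Z))%:~R
        (T h *: y')).
    move=> /eqP bji; have [->|ji] := eqVneq j i.
      apply: eq_bigr => s _; congr (sc _ _).
      by rewrite /Z inversion_cg ?cg_refl // !ltxx subrr mulr0 !mulr0z !sc0l.
    (* After absorbing the transposition of [i] and [j] into [g], the comparison is flipped once by
       it and once by [w_rev], so that [w] disappears. *)
    pose X h := sc (inversion (tg n i j * h * w)%g i j)%:~R (T h *: y').
    have nij : ~~ cg n i j.
      apply/negP => /(block_cg bk_le bk_period bk01 (esym bji)) ij.
      by rewrite ij eqxx in ji.
    have -> : bsum (Z^~ j) = bsum (fun g => X (tg n i j * g)%g).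
      congr bsum; apply/funext => g.
      by rewrite /X /Z !mulgA tgK // mul1g.
    rewrite bsum_left //; last by rewrite eq_sym.
    rewrite -bsumZ; apply: (eq_bsum bk_period bk01) => h hh; rewrite /X scA -intrM.
    congr (sc (e * _)%:~R _); rewrite /inversion; congr (_ - _%:Z).
    rewrite !invgM !actM (_ : (tg n i j)^-1%g = tg n i j); last exact/mulg1_eq/tgK.
    rewrite !act_tg // trr // trl; have [hb _] := block_permV hh.
    set a := act h^-1%g i; set b := act h^-1%g j.
    have bab : bk a = bk b by rewrite !hb bji.
    have [ab|ba|E] := ltgtP b a.
    - by rewrite w_rev.
    - by rewrite ltNge ltW // w_rev.
    - by rewrite E ltxx.
  rewrite (eq_bigr _ term) -bsum_sum; apply: (eq_bsum bk_period bk01) => g hg.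
  rewrite -sc_suml -rmorph_sum -mulr_sumr; congr (sc (e * _)%:~R _).
  have [gb gw] := hg; have [gVb gVw] := block_permV hg.
  have i'N : act g^-1%g i \in window N by rewrite mem_window !gVw -mem_window.
  rewrite -(count_block (N := N) (i := i) (i' := act g^-1%g i)) ?gVb // !sumrB; congr (_ - _).
  rewrite -(perm_big _ (window_perm N hg)) big_map /=; apply: eq_big => j.
    by rewrite gb.
  by rewrite actK.
have part2 : bsum (fun g => \sum_(j <- window N | bk j != bk i) Z g j) = 0.
  (* The transposition is moved to the right of [g]. The sum over [k] with an indicator of
     [k = g^-1 i] frees its indices from [g], so that [cross_zero] applies for fixed [k] and [j]. *)
  transitivity (bsum (fun g => \sum_(j <- window N | bk j != bk i)
      \sum_(k <- window N | bk k == bk i)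
      sc ((k == act g^-1%g i)%:R * (inversion w k j)%:~R) (T (g * tg n k j)%g *: y'))).
    apply: (eq_bsum bk_period bk01) => g hg.
    have [gb gw] := hg; have [gVb gVw] := block_permV hg.
    rewrite -(perm_big _ (window_perm N hg)) big_map /=; apply: eq_big => j.
      by rewrite gb.
    rewrite gb => bji; set k0 := act g^-1%g i.
    have k0N : k0 \in window N by rewrite mem_window !gVw -mem_window.
    have bk0 : bk k0 = bk i by rewrite gVb.
    rewrite -big_filter (bigD1_seq k0) ?filter_uniq ?mem_filter ?bk0 ?eqxx //=.
    rewrite mul1r big1 ?addr0; last by move=> k /negbTE ->; rewrite mul0r sc0l.
    rewrite /Z; have gk0 : act g k0 = i by rewrite actKV.
    have [c|c] := boolP (cg n k0 j).
      rewrite !inversion_cg // ?mulr0z ?sc0l // -gk0.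
      by rewrite injective_cg //; [exact: act_periodic | exact: act_injective].
    rewrite (tg_conj g c) gk0; congr (sc _%:~R _).
    rewrite /inversion invgM !actM actK -/k0; congr (_%:Z - _).
    congr nat_of_bool.
    have [lt|gt|jk] := ltgtP j k0; last by rewrite jk bk0 eqxx in bji.
    - rewrite ltNge; apply/negP => /bk_le; rewrite gb => le.
      by have := bk_le (ltW lt); move: bji; rewrite bk0; lia.
    - apply/negbTE; rewrite -leNgt leNgt; apply/negP => /ltW /bk_le; rewrite gb => le.
      by have := bk_le (ltW gt); move: bji; rewrite bk0; lia.
  rewrite bsum_sum big1 // => j bji; rewrite bsum_sum big1 // => k /eqP bki.
  by apply: cross_zero; rewrite bki eq_sym.
rewrite bsumD; have -> : bsum (fun g => \sum_(j <- window N) Z g j) =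
    bsum (fun g => sc (e * (i - act g^-1%g i))%:~R (T g *: y')).
  rewrite -part1 -[RHS]addr0 -[X in _ = _ + X]part2 -bsumD; congr bsum; apply/funext => g.
  by rewrite [LHS](bigID (fun j => bk j == bk i)).
rewrite -bsumD -bsumZ; apply: (eq_bsum bk_period bk01) => g hg.
have [gVb _] := block_permV hg.
rewrite -scDl -intrD; congr (sc _%:~R _).
by rewrite -ct_blockE // gVb.
Qed.

End SymmetrizedVector.

(** * Diagrams with infinite columns *)

Section InfiniteColumns.
Context (C : numFieldType) (n kappa : nat) {n_ge2 : atleast2 n}.
Let hn : (2 <= n)%N := n_ge2.
Variable H : daha C n kappa.
Local Notation T := (dahaW H).
Local Notation U := (uZ H).
Local Notation W := (dW n).

Lemma uZ_translate (i q : int) : U (i + q * n%:Z) = U i - (kappa%:Z * q)%:~R.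
Proof.
have [j /cgP[r ->]] := residue (n := n) i; have := ltn_ord j => jlt.
rewrite -addrA -mulrDl !U_nat; try lia.
by rewrite mulrDr intrD opprD addrA.
Qed.

Lemma seq_max (A : eqType) (s : seq A) (P : A -> Prop) (f : A -> int) :
  (exists2 x, x \in s & P x) ->
  exists x, [/\ x \in s, P x & forall y, y \in s -> P y -> f y <= f x].
Proof.
elim: s => [[x] //|a s IHs] [x xs Px].
have [[y ys Py]|no] := pselect (exists2 y, y \in s & P y).
  have [|z [zs Pz zmax]] := IHs; first by exists y.
  have [[Pa lt]|nlt] := pselect (P a /\ f z < f a).
    exists a; split=> // [|b]; first by rewrite inE eqxx.
    rewrite inE => /predU1P[->//|bs Pb].
    exact: le_trans (zmax b bs Pb) (ltW lt).
  exists z; split=> // [|b]; first by rewrite inE zs orbT.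
  rewrite inE => /predU1P[->|bs] Pb; last exact: zmax.
  by rewrite leNgt; apply/negP => lt; apply: nlt.
have Pa : P a.
  by move: xs; rewrite inE => /predU1P[<- //|xs]; case: no; exists x.
exists a; split=> // [|b]; first by rewrite inE eqxx.
by rewrite inE => /predU1P[->//|bs Pb]; case: no; exists b.
Qed.

Variables (m : int) (k : nat) (row col : int -> int) (f0 c0 : int).
Hypothesis m_ge2 : 1 < m.
Hypothesis k_gt0 : (0 < k)%N.
Hypothesis n_mk : n%:Z = m * k%:Z.
Hypothesis kappaE : kappa%:Z = m.
Hypothesis row_col : forall a t : int, 0 <= t < k%:Z ->
  row (f0 + a * k%:Z + t) = a /\ col (f0 + a * k%:Z + t) = c0 + t.
Local Notation cont := (cont row col).

Let label_split (i : int) : exists a t, 0 <= t < k%:Z /\ i = f0 + a * k%:Z + t.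
Proof.
exists ((i - f0) %/ k%:Z)%Z, ((i - f0) %% k%:Z)%Z.
have := divz_eq (i - f0) k%:Z; have := @modz_ge0 (i - f0) k%:Z.
have := @ltz_pmod (i - f0) k%:Z; lia.
Qed.

Let row_period (i : int) : row (i + n%:Z) = row i + m.
Proof.
have [a [t [ht ->]]] := label_split i.
rewrite n_mk (_ : f0 + a * k%:Z + t + m * k%:Z = f0 + (a + m) * k%:Z + t); last lia.
by rewrite !(proj1 (row_col _ ht)).
Qed.

Section OneRow.
Variables (V : lmodType H) (v : V).
Hypothesis wv : wt cont v.
Hypothesis Jv : forall j, row_adj row j -> T (sg n j) *: v = sc 1 v.
Variable a : int.
Let r := f0 + a * k%:Z.
Let q := r + k%:Z.

Let kn : k%:Z + k%:Z <= n%:Z.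
Proof. by rewrite n_mk; nia. Qed.

Let sgv (t : int) : 0 <= t -> t + 1 < k%:Z -> T (sg n (r + t)) *: v = v.
Proof.
move=> t0 tk; rewrite Jv ?sc1l // /row_adj.
have [e1 _] := @row_col a t ltac:(lia); have [e2 _] := @row_col a (t + 1) ltac:(lia).
by rewrite -addrA /r e1 e2.
Qed.

Let tgv (x x' : int) : r <= x -> x < x' -> x' < q -> T (tg n x x') *: v = v.
Proof.
move=> rx xx xq.
have -> : x' = x + (absz (x' - x)%R).-1.+1%:Z by lia.
have : x + (absz (x' - x)%R).-1.+1%:Z < q by lia.
elim: (absz _).-1 => [|d IHd] lt.
  rewrite tg_sg; have := @sgv (x - r) ltac:(lia) ltac:(lia).
  by rewrite [r + _]addrC subrK.
set p := x + d.+1%:Z; have pE : x + d.+2%:Z = p + 1 by rewrite /p; lia.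
have sp : T (sg n p) *: v = v.
  have := @sgv (p - r) ltac:(lia) ltac:(lia).
  by rewrite [r + _]addrC subrK.
have xp : ~~ cg n x p by rewrite cg_neq // /p; lia.
have e := tg_conj (sg n p) xp.
rewrite !act_sg trl tr_id in e; last 2 first.
- by rewrite cg_neq // /p; lia.
- by rewrite cg_neq // /p; lia.
rewrite pE -{1}sp scalerA -dahaWM -e dahaWM -scalerA IHd //; first lia.
Qed.

(* The k + 1 vectors obtained from v by letting each of the labels r, ..., q
   play the part of q. *)
Let raise (x : int) : V := if x == q then v else T (tg n x q) *: v.

Let raise_ne (x : int) : x < q -> raise x = T (tg n x q) *: v.
Proof. by move=> xq; rewrite /raise ifN //; lia. Qed.

Let raise_eq : raise q = v.
Proof. by rewrite /raise eqxx. Qed.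

Let raise_down (x : int) : r <= x -> x < q -> T (sg n x) *: raise (x + 1) = raise x.
Proof.
move=> rx xq; rewrite (raise_ne xq).
have [e|ne] := eqVneq (x + 1) q; first by rewrite e raise_eq -e tg_sg.
rewrite raise_ne; last lia.
have c1 : ~~ cg n (x + 1) q by rewrite cg_neq //; lia.
rewrite scalerA -dahaWM (tg_conj (sg n x) c1) !act_sg trr ?cgS // tr_id; last 2 first.
- by rewrite cg_neq //; lia.
- by rewrite cg_neq //; lia.
rewrite dahaWM -scalerA; congr (_ *: _).
have := @sgv (x - r) ltac:(lia) ltac:(lia).
by rewrite [r + _]addrC subrK.
Qed.

Let raise_up (x : int) : r <= x -> x < q -> T (sg n x) *: raise x = raise (x + 1).
Proof.
by move=> rx xq; rewrite -raise_down // scalerA -dahaWM sgK dahaW1 scale1r.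
Qed.

Let raise_other (i x : int) : r <= i -> i < q -> r <= x <= q -> x != i -> x != i + 1 ->
  T (sg n i) *: raise x = raise x.
Proof.
move=> ri iq xr xi xi1; rewrite /raise; have [xq|xq] := eqVneq x q.
  have := @sgv (i - r) ltac:(lia) ltac:(lia).
  by rewrite [r + _]addrC subrK.
have cxq : ~~ cg n x q by rewrite cg_neq //; lia.
have [iq1|iq1] := eqVneq (i + 1) q; last first.
  rewrite scalerA -dahaWM (tg_conj (sg n i) cxq) !act_sg.
  rewrite !tr_id; try by rewrite cg_neq //; lia.
  rewrite dahaWM -scalerA; congr (_ *: _).
  have := @sgv (i - r) ltac:(lia) ltac:(lia).
  by rewrite [r + _]addrC subrK.
have ciq : ~~ cg n i q by rewrite cg_neq //; lia.
rewrite -tg_sg iq1 scalerA -dahaWM.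
have cix : ~~ cg n x i by rewrite cg_neq //; lia.
have e := tg_conj (tg n x q) cix.
rewrite !act_tg // trl tr_id in e; last 2 first.
- by rewrite cg_neq //; lia.
- by rewrite cg_neq //; lia.
rewrite (tgC ciq) -e dahaWM -scalerA tgv //; lia.
Qed.

Definition raised_sum : V := \sum_(t < k.+1) raise (r + t%:Z).

(** The reflection exchanges two neighbouring summands and fixes the others. *)
Lemma raised_sum_sg (i : nat) : (i < k)%N ->
  T (sg n (r + i%:Z)) *: raised_sum = raised_sum.
Proof.
move=> ik; have lt1 : (i < k.+1)%N by lia.
have lt2 : (i.+1 < k.+1)%N by lia.
pose a1 := Ordinal lt1; pose a2 := Ordinal lt2.
rewrite [RHS](reindex_inj (@perm_inj _ (tperm a1 a2))) scaler_sumr.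
apply: eq_bigr => t _; have := ltn_ord t => tk.
have rE : r + i.+1%:Z = r + i%:Z + 1 by lia.
case: tpermP => [->|->|/eqP t1 /eqP t2] /=.
- by rewrite rE raise_up //; lia.
- by rewrite rE raise_down //; lia.
- rewrite raise_other //; try lia.
  + by apply: contra t1 => /eqP e; apply/eqP/val_inj => /=; lia.
  + by apply: contra t2 => /eqP e; apply/eqP/val_inj => /=; lia.
Qed.

Let U_sgC (j x : int) (z : V) : ~~ cg n j x -> ~~ cg n j (x + 1) ->
  U j *: (T (sg n x) *: z) = T (sg n x) *: (U j *: z).
Proof. by move=> h1 h2; rewrite !scalerA T_sgUC. Qed.

Let U_raise_q (d : nat) : (d < k)%N ->
  U q *: raise (q - d.+1%:Z) = sc (cont r + k%:Z - 1)%:~R (raise (q - d.+1%:Z)) + v.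
Proof.
elim: d => [|d IHd] dk.
  rewrite raise_ne; last lia.
  have -> : tg n (q - 1%:Z) q = sg n (q - 1) by rewrite -tg_sg subrK.
  rewrite scalerA U_T_sg subrK trr; last by rewrite -{2}(subrK 1 q) cgS.
  rewrite scalerDl -scalerA wv sc_comm.
  have -> : cont (q - 1) = cont r + k%:Z - 1.
    have := @row_col a (k%:Z - 1) ltac:(lia); have := @row_col a 0 ltac:(lia).
    rewrite /cont addr0 -/r addrA -/q => -[-> ->] [-> ->]; lia.
  congr (_ + _); rewrite cg_refl cg_neq; try lia.
  by rewrite subr0 -sc_int sc1l.
set x := q - d.+2%:Z; have qE : q - d.+1%:Z = x + 1 by rewrite /x; lia.
rewrite -raise_down; try by rewrite /x; lia.
rewrite U_sgC; last 2 first.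
- by rewrite cg_neq // /x; lia.
- by rewrite cg_neq // /x; lia.
rewrite -qE IHd ?scalerDr ?sc_comm; last lia.
have := @sgv (x - r) ltac:(rewrite /x; lia) ltac:(rewrite /x; lia).
by rewrite [r + _]addrC subrK => ->.
Qed.

Let U_raise_far (j : int) (d : nat) : (d <= k)%N -> q < j -> j < r + n%:Z ->
  U j *: raise (q - d%:Z) = sc (cont j)%:~R (raise (q - d%:Z)).
Proof.
elim: d => [|d IHd] dk qj jr; first by rewrite subr0 raise_eq wv.
set x := q - d.+1%:Z; have qE : q - d%:Z = x + 1 by rewrite /x; lia.
rewrite -raise_down; try by rewrite /x; lia.
rewrite U_sgC; last 2 first.
- by rewrite cg_neq // /x; lia.
- by rewrite cg_neq // /x; lia.
by rewrite -qE IHd ?sc_comm //; lia.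
Qed.

Let cont_q : cont q = cont r - 1.
Proof.
have := @row_col (a + 1) 0 ltac:(lia); have := @row_col a 0 ltac:(lia).
rewrite !addr0 (_ : f0 + (a + 1) * k%:Z = q); last by rewrite /q /r; lia.
by rewrite /cont -/r => -[-> ->] [-> ->]; lia.
Qed.

(** Each of the [k] raised vectors contributes an extra [v], which lifts the eigenvalue [cont r - 1]
    of the summand [v] to the common value. *)
Let U_sum_q : U q *: raised_sum = sc (cont r - 1 + k%:Z)%:~R raised_sum.
Proof.
rewrite /raised_sum big_ord_recr /= -/q raise_eq scalerDr scaler_sumr wv cont_q.
have -> : \sum_(i < k) U q *: raise (r + i%:Z) =
    \sum_(i < k) (sc (cont r - 1 + k%:Z)%:~R (raise (r + i%:Z)) + v).
  apply: eq_bigr => i _; have := ltn_ord i => ik.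
  rewrite (_ : r + i%:Z = q - (k - i.+1)%N.+1%:Z); last by rewrite /q; lia.
  rewrite U_raise_q; last lia.
  by rewrite (_ : cont r + k%:Z - 1 = cont r - 1 + k%:Z); last lia.
rewrite big_split /= -sc_sumr scDr -addrA; congr (_ + _).
rewrite sumr_const card_ord [in RHS]intrD scDl addrC; congr (_ + _).
by rewrite sc_int scaler_int pmulrn.
Qed.

Let U_sum_block (d : nat) : (d <= k)%N ->
  U (q - d%:Z) *: raised_sum = sc (cont r - 1 + k%:Z - d%:Z)%:~R raised_sum.
Proof.
elim: d => [|d IHd] dk; first by rewrite !subr0 U_sum_q.
have := @raised_sum_sg (k - d.+1)%N ltac:(lia).
rewrite (_ : r + (k - d.+1)%N%:Z = q - d.+1%:Z); last by rewrite /q; lia.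
set x := q - d.+1%:Z => sy.
have qE : q - d%:Z = x + 1 by rewrite /x; lia.
rewrite qE in IHd; have {}IHd := IHd ltac:(lia).
rewrite -{1}sy scalerA U_T_sg scalerDl -scalerA trl IHd sc_comm sy.
rewrite cg_refl cgS -sc_int -scDl -intrD; congr (sc _%:~R _); lia.
Qed.

Definition raised_weight (j : int) : int :=
  let d := ((j - r) %% n%:Z)%Z in
  (if d <= k%:Z then cont r - 1 + d else cont (r + d)) - kappa%:Z * ((j - r) %/ n%:Z)%Z.

Lemma raised_sum_wt : wt raised_weight raised_sum.
Proof.
move=> j; rewrite /raised_weight; set d := (_ %% _)%Z; set b := (_ %/ _)%Z.
have jE : j = r + d + b * n%:Z by have := divz_eq (j - r) n%:Z; rewrite -/d -/b; lia.
have d0 : 0 <= d by apply: modz_ge0; lia.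
have dn : d < n%:Z by apply: ltz_pmod; lia.
rewrite jE uZ_translate scalerBl -sc_int [in RHS]intrB scBl; congr (_ - _).
have [dk|kd] := leP d k%:Z.
  have -> : r + d = q - (k - absz d)%N%:Z by rewrite /q; lia.
  rewrite U_sum_block; last lia.
  by congr (sc _%:~R _); lia.
rewrite /raised_sum sc_sumr scaler_sumr; apply: eq_bigr => i _.
have := ltn_ord i => ik.
rewrite (_ : r + i%:Z = q - (k - i)%N%:Z); last by rewrite /q; lia.
by apply: U_raise_far; rewrite /q; lia.
Qed.

(** A nonzero sum would generate the simple module, and the weight of [v] would come from a [g] with
    [g r < g q]. The contents of these labels differ by [k], whereas with rows of length [k] the
    content grows by at most [k - 1] from a label to a larger one. *)
Lemma raised_sum_eq0 : simple_mod V -> v != 0 -> raised_sum = 0.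
Proof.
move=> Vs v0; apply/eqP; apply: contraT => y0.
have [h vE] := simple_cyclic Vs y0 v.
pose J j := r <= j < q.
have Jy j : J j -> T (sg n j) *: raised_sum = sc 1 raised_sum.
  move=> /andP[rj jq]; rewrite sc1l.
  have := @raised_sum_sg (absz (j - r)%R) ltac:(move: jq; rewrite /q; lia).
  by rewrite (_ : r + (absz (j - r)%R)%:Z = j); last lia.
have v0' : h *: raised_sum != 0 by rewrite -vE.
have wv' : wt cont (h *: raised_sum) by rewrite -vE.
have [g Jg gE] := cyclic_weight raised_sum_wt Jy v0' wv'.
have mono (d : nat) : (d < k)%N -> act g r < act g (r + d.+1%:Z).
  elim: d => [|d IHd] dk.
    by apply: Jg; rewrite /J /q; lia.
  apply: lt_trans (IHd _) _; first lia.
  rewrite (_ : r + d.+2%:Z = r + d.+1%:Z + 1); last lia.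
  by apply: Jg; rewrite /J /q; lia.
have := mono k.-1 ltac:(lia); rewrite (_ : r + k.-1.+1%:Z = q); last by rewrite /q; lia.
have w1 : cont (act g r) = cont r - 1.
  rewrite gE actK /raised_weight subrr mod0z div0z mulr0 subr0 addr0.
  by rewrite /= ?addr0.
have w2 : cont (act g q) = cont r - 1 + k%:Z.
  rewrite gE actK /raised_weight (_ : q - r = k%:Z); last by rewrite /q; lia.
  rewrite modz_small ?divz_small; try lia.
  by rewrite lexx mulr0 subr0.
have [a0 [t0 [ht0 e0]]] := label_split (act g r).
have [a1 [t1 [ht1 e1]]] := label_split (act g q).
move: w1 w2; rewrite /cont {1 2}e0 {1 2}e1.
have [-> ->] := row_col a0 ht0; have [-> ->] := row_col a1 ht1.
have := @row_col a 0 ltac:(lia); rewrite addr0 -/r => -[-> ->].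
rewrite e0 e1; nia.
Qed.

Lemma row_tg_invariant (x x' : int) : r <= x -> x < q -> r <= x' -> x' < q -> x != x' ->
  T (tg n x x') *: v = v.
Proof.
move=> rx xq rx' xq' xx; have [lt|gt|e] := ltgtP x x'; first exact: tgv.
  by rewrite tgC ?tgv // cg_neq //; lia.
by rewrite e eqxx in xx.
Qed.

Lemma raised_sumE :
  raised_sum = v + \sum_(t < k) T (tg n (r + t%:Z) q) *: v.
Proof.
rewrite /raised_sum big_ord_recr /= -/q raise_eq addrC; congr (_ + _).
by apply: eq_bigr => t _; rewrite raise_ne //; have := ltn_ord t; rewrite /q; lia.
Qed.

End OneRow.

Lemma infinite_columns_no_embedding (M : lmodType H) (v : M)
    (tau : {lrmorphism {mpoly C[n]} -> C | *%R}) (f : {linear M -> verma H tau}) :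
  simple_mod M -> v != 0 -> wt cont v ->
  (forall j, row_adj row j -> T (sg n j) *: v = sc 1 v) -> injective f -> False.
Proof.
move=> Ms v0 wv Jv finj; pose F := f v.
have F0 : F != 0 by apply: contra v0 => /eqP e; apply/eqP/finj; rewrite linear0.
pose r (a : int) : int := f0 + a * k%:Z.
have rq (a : int) : r a + k%:Z = r (a + 1) by rewrite /r; lia.
have nk : k%:Z + k%:Z <= n%:Z by rewrite n_mk; nia.
have inv a (x x' : int) (g : W) : r a <= x < r (a + 1) -> r a <= x' < r (a + 1) -> x != x' ->
    vcoef (tg n x x' * g)%g F = vcoef g F.
  move=> hx hx' xx; have cx : ~~ cg n x x' by rewrite cg_neq //; move: hx hx'; rewrite /r; lia.
  have tv : T (tg n x x') *: v = v.
    by apply: (row_tg_invariant Jv (a := a)) => //; move: hx hx'; rewrite -rq /r; lia.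
  have tF : T (tg n x x') *: F = F by rewrite /F -linearZ /= tv.
  by rewrite -{2}tF vcoefT (mulg1_eq (tgK cx)).
have garnir a (g : W) : vcoef g F != 0 -> exists2 x, r a <= x < r (a + 1) &
    vcoef (tg n x (r (a + 1)) * g)%g F != 0.
  move=> gF; have e := raised_sum_eq0 wv Jv a Ms v0.
  rewrite raised_sumE -/(r a) rq in e.
  have {}e : F + \sum_(t < k) T (tg n (r a + t%:Z) (r (a + 1))) *: F = 0.
    have := congr1 f e; rewrite linearD linear_sum linear0 => e'; rewrite -[RHS]e'; congr (_ + _).
    by apply: eq_bigr => t _; rewrite linearZ.
  apply: contrapT => no; case/negP: gF.
  have := congr1 (vcoef g) e; rewrite vcoefD vcoef0 vcoef_sum big1 ?addr0 => [->//|t _].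
  have := ltn_ord t => tk.
  have ct : ~~ cg n (r a + t%:Z) (r (a + 1)) by rewrite cg_neq // -?rq; lia.
  rewrite vcoefT (mulg1_eq (tgK ct)); apply/eqP; apply: contraT => ne.
  by case: no; exists (r a + t%:Z); rewrite // -rq; lia.
(* Row invariance exchanges [q] with the first box of its row. *)
have garnir' a (g : W) (q : int) : vcoef g F != 0 -> r (a + 1) <= q < r (a + 1 + 1) ->
    exists2 x, r a <= x < r (a + 1) & vcoef (tg n x q * g)%g F != 0.
  move=> gF hq; have [->|qr] := eqVneq q (r (a + 1)); first exact: garnir.
  have hr : r (a + 1) <= r (a + 1) < r (a + 1 + 1) by rewrite /r; lia.
  have [|x hx] := garnir a (tg n q (r (a + 1)) * g)%g; first by rewrite (inv (a + 1)).
  move=> xF; exists x => //.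
  have c1 : ~~ cg n x q by rewrite cg_neq //; move: hx hq; rewrite /r; lia.
  have c2 : ~~ cg n q (r (a + 1)) by rewrite cg_neq //; move: hq; rewrite /r; lia.
  have c3 : ~~ cg n x (r (a + 1)) by rewrite cg_neq //; move: hx; rewrite /r; lia.
  have e := tg_conj (tg n q (r (a + 1))) c1.
  rewrite !act_tg // trl tr_id // in e.
  by move: xF; rewrite mulgA -e -mulgA; rewrite (inv (a + 1) q (r (a + 1)) _ hq hr qr).
have [s hs] := vcoef_support F; have [g0 hg0] := vcoef_neq0 F0.
(* Exchanging [x] in row [a] with [q] in row [a + 1] adds [-2 m n (z x - z q)] to this potential, so
   a maximum forces [z q < z x] whenever the exchanged element is also in the support. *)
have [|g [_ gF gmax]] := @seq_max _ s (fun g => vcoef g F != 0)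
    (fun g => pot n m row (act g^-1%g)).
  by exists g0 => //; apply: hs.
pose z := act g^-1%g.
have up a (q : int) : r (a + 1) <= q < r (a + 1 + 1) ->
    exists2 x, r a <= x < r (a + 1) & z q < z x.
  move=> hq; have [x hx xF] := garnir' a g q gF hq; exists x => //.
  have rowx (a' y : int) : r a' <= y < r (a' + 1) -> row y = a'.
    rewrite -rq => hy; have := @row_col a' (y - r a') ltac:(lia).
    by rewrite -/(r a') addrC subrK => -[].
  have rx := rowx a x hx; have rq' := rowx (a + 1) q hq.
  have row_translate (y u : int) : row (y + u * n%:Z) = row y + u * m.
    have [b [t [ht ->]]] := label_split y.
    rewrite n_mk (_ : f0 + b * k%:Z + t + u * (m * k%:Z) = f0 + (b + u * m) * k%:Z + t); last lia.
    by rewrite !(proj1 (row_col _ ht)).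
  have c : ~~ cg n x q.
    by apply/negP => /cgP[u xE]; move: rx; rewrite xE row_translate rq'; case: (ltrgt0P u); nia.
  have := gmax _ (hs _ xF) xF; rewrite invgM (mulg1_eq (tgK c)).
  rewrite (@pot_swap n _ m row z _ x q) //; try exact: act_periodic.
  - rewrite rx rq'; have ne : z x != z q.
      by apply/eqP => /act_injective e; move: c; rewrite e cg_refl.
    have h2 : 0 < 2 * m * n%:Z by rewrite !mulr_gt0 //; lia.
    have -> : a - (a + 1) = -1 by lia.
    rewrite -/z mulN1r mulrN gerDl oppr_le0 => le.
    have : 0 <= 2 * m * n%:Z * (z x - z q) by exact: le.
    by rewrite pmulr_rge0 // subr_ge0 le_eqVlt eq_sym (negbTE ne).
  - by rewrite actM act_tg // trl.
  - by rewrite actM act_tg // trr.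
  - by move=> j jx jq; rewrite actM act_tg // tr_id.
have iter (d : nat) a (q : int) : r (a + d.+1%:Z) <= q < r (a + d.+1%:Z + 1) ->
    exists2 x, r a <= x < r (a + 1) & z q < z x.
  elim: d a q => [|d IHd] a q; first exact: up.
  rewrite (_ : a + d.+2%:Z = a + 1 + d.+1%:Z); last lia.
  move=> /IHd[x hx zx]; have [x' hx' zx'] := up a x hx.
  by exists x' => //; apply: lt_trans zx zx'.
have [|q [qs _ qmax]] := @seq_max _ [seq r m + t%:Z | t <- iota 0 k] (fun _ => True) z.
  by exists (r m + 0%:Z) => //; apply: (map_f (fun t : nat => r m + t%:Z)); rewrite mem_iota; lia.
have hq : r m <= q < r (m + 1).
  by case/mapP: qs => t; rewrite mem_iota -rq => ht ->; lia.
have [|x hx zx] := @iter (absz m).-1 0 q.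
  by rewrite (_ : 0 + (absz m).-1.+1%:Z = m) //; lia.
(* The translate of [x] is again in row [m], so [z x + n <= z q], against [z q < z x]. *)
have xm : x + n%:Z \in [seq r m + t%:Z | t <- iota 0 k].
  move: hx; rewrite /r => hx; apply/mapP; exists (absz (x - r 0)%R); rewrite ?mem_iota /r; lia.
by have := qmax _ xm I; rewrite /z act_periodic -/z; lia.
Qed.

End InfiniteColumns.

(** * Embedding into a Verma module *)

Section BlockVectorCoefficients.
Context (C : numFieldType) (n kappa : nat) {n_ge2 : atleast2 n}.
Let hn : (2 <= n)%N := n_ge2.
Variable H : daha C n kappa.
Local Notation T := (dahaW H).
Local Notation W := (dW n).

Definition int_char (psi : int -> int) : {lrmorphism {mpoly C[n]} -> C | *%R} :=
  meval (fun k : 'I_n => (psi k.+1%:Z)%:~R).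

Lemma int_char_wt (psi : int -> int) : (forall k, psi (k + n%:Z) = psi k - kappa%:Z) ->
  wt psi (verma_one H (int_char psi)).
Proof.
move=> psiP; apply: wt_of_range => // i hi.
have lt : (i.-1 < n)%N by lia.
have iE : i = (Ordinal lt).+1 by rewrite /=; lia.
by rewrite iE /uZ uext_ord verma_one_poly; congr (sc _ _); apply: mevalXU.
Qed.

Variables (bk : int -> int) (mb : int).
Hypothesis bk_le : forall i j : int, i <= j -> bk i <= bk j.
Hypothesis bk_period : forall i : int, bk (i + n%:Z) = bk i + mb.
Hypothesis bk01 : bk 0 != bk 1.

Lemma block_reversal : exists w : W, forall p q : int,
  (act w^-1%g p < act w^-1%g q) = (bk p < bk q) || (bk p == bk q) && (q < p).
Proof.
have mb0 : 0 < mb.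
  have h1 : bk 0 <= bk 1 by apply: bk_le.
  have h2 : bk 1 <= bk n%:Z by apply: bk_le; lia.
  have := bk_period 0; rewrite add0r; move: bk01; lia.
(* The factor [2 n] lets the block decide first: if [bk p < bk q], then [q - p] is less than
   [n (bk q - bk p + 1)], hence less than [2 n (bk q - bk p)]. *)
pose k (p : int) : int := 2 * n%:Z * bk p - p.
have klt p q : bk p < bk q -> k p < k q.
  have [a /cgP[r pE]] := residue (n := n) p; have [b /cgP[s qE]] := residue (n := n) q.
  have al := ltn_ord a; have bl := ltn_ord b => lt.
  have [sr|rs] := leP s r; first by rewrite /k pE qE in lt *; nia.
  have h1 : bk p <= bk 0 + (r + 1) * mb.
    by rewrite -(bk_translate bk_period bk01); apply: bk_le; rewrite pE; nia.
  have h2 : bk 1 + s * mb <= bk q.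
    by rewrite -(bk_translate bk_period bk01); apply: bk_le; rewrite qE; nia.
  have h3 : bk 0 < bk 1 by rewrite lt_neqAle; apply/andP; split; [exact: bk01 | exact: bk_le].
  have h4 : s - (r + 1) <= (s - (r + 1)) * mb.
    by rewrite ler_peMr //; lia.
  have h5 : s - r <= bk q - bk p by lia.
  have h6 : q - p < (s - r + 1) * n%:Z by rewrite pE qE; lia.
  rewrite /k; nia.
have kI : injective k.
  move=> p q e; have [/klt|/klt|eb] := ltgtP (bk p) (bk q); try lia.
  by move: e; rewrite /k eb; lia.
have [||g gE] := @key_order n n_ge2 (2 * n%:Z * mb - n%:Z) k _ kI.
- nia.
- by move=> j; rewrite /k bk_period; lia.
exists g^-1%g => p q; rewrite invgK gE.
have [/klt ->//|/klt h|eb] := ltgtP (bk p) (bk q) => /=; first lia.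
by rewrite /k eb; lia.
Qed.

Variables (tau : {lrmorphism {mpoly C[n]} -> C | *%R}) (e : int) (y : verma H tau).
Local Notation bsum := (bsum bk e (fun g => T g *: y)).

Lemma bsum_vcoef_neq0 g0 : vcoef g0 bsum != 0 ->
  exists2 g, block_perm bk g & vcoef g0 (T g *: y) != 0.
Proof.
move=> h; apply: contrapT => no; case/negP: h; apply/eqP.
rewrite /bsum vcoef_sum big1 // => s bs; rewrite vcoefZ.
have bg : block_perm bk (@pemb n n_ge2 s) by exact: (bp_block_perm bk_period bk01 bs).
have [->|ne] := eqVneq (vcoef g0 (T (@pemb n n_ge2 s) *: y)) 0; first by rewrite mulr0.
by case: no; exists (pemb s).
Qed.

Lemma pemb_eq1 (s : 'S_n) : pemb s = 1%g -> s = 1%g.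
Proof.
move=> h; apply/perm.permP => i; rewrite perm1; apply/val_inj.
by have := @act_pemb n n_ge2 s i 0; rewrite h act1 !mul0r !addr0 /=; lia.
Qed.

(** For proving that a symmetrized vector is nonzero: at a coefficient reached only by the identity
    nothing can cancel. *)
Lemma bsum_vcoef g0 :
  (forall g, block_perm bk g -> vcoef g0 (T g *: y) != 0 -> g = 1%g) ->
  vcoef g0 bsum = vcoef g0 y.
Proof.
move=> h; rewrite /bsum vcoef_sum (bigD1 1%g) /=; last by apply/forallP => i; rewrite perm1.
rewrite big1 ?addr0.
  by rewrite vcoefZ pemb1 dahaW1 scale1r /bsign odd_perm1 expr0 mul1r.
move=> s /andP[bs s1]; rewrite vcoefZ.
have bg : block_perm bk (@pemb n n_ge2 s) by exact: (bp_block_perm bk_period bk01 bs).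
have [->|ne] := eqVneq (vcoef g0 (T (@pemb n n_ge2 s) *: y)) 0; first by rewrite mulr0.
by move: s1; rewrite (pemb_eq1 (h _ bg ne)) eqxx.
Qed.

End BlockVectorCoefficients.

(** * The vector in the Verma module *)

Section VermaEmbedding.
Context (C : numFieldType) (n kappa : nat) {n_ge2 : atleast2 n}.
Let hn : (2 <= n)%N := n_ge2.
Variable H : daha C n kappa.
Local Notation T := (dahaW H).
Local Notation W := (dW n).

Variables (m l : int) (row col : int -> int) (lab : int -> int -> int).
Hypothesis L : labelling n m l row col lab.
Hypothesis mlk : m + l = kappa%:Z.
Hypothesis row01 : row 0 != row 1.
Local Notation cont := (cont row col).
Local Notation row_adj := (row_adj row).

(** The conditions that [simple_embedding] imposes on the vector of the target module. *)
Definition highest_vector (tau : {lrmorphism {mpoly C[n]} -> C | *%R}) (v : verma H tau) : Prop :=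
  [/\ v != 0, wt cont v, forall j, row_adj j -> T (sg n j) *: v = sc 1 v
    & forall (h : H) psi, h *: v != 0 -> wt psi (h *: v) ->
      exists2 t : W, nb_increasing row col 1 0 t & forall i, psi i = cont (act t^-1%g i)].

Let row_block (i : int) : row (i + 1) = row i -> cont (i + 1) = cont i + 1.
Proof. by move=> h; rewrite /cont (row_succ L h) h; lia. Qed.

Let row_leL (i j : int) : i <= j -> row i <= row j.
Proof. exact: (row_le L). Qed.

Let cont_k (k : int) : cont (k + n%:Z) = cont k - kappa%:Z.
Proof. by rewrite (cont_period L) mlk. Qed.

Let row_vector_adj (V : lmodType H) (w : W) (y : V) (j : int) : row_adj j ->
  T (sg n j) *: block_vector row 1 w y = sc 1 (block_vector row 1 w y).
Proof.
move=> jj; rewrite -tg_sg.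
rewrite (block_vector_sym row_leL (lb_row L) row01 (e := 1) _ w y (esym jj)) //.
by lia.
Qed.

Lemma highest_vector_one_row : m = 1 -> l = 0 ->
  exists tau (v : verma H tau), highest_vector v.
Proof.
move=> m1 l0; have [w wE] := block_reversal row_leL (lb_row L) row01.
pose psi (k : int) := cont (act w k); exists (int_char C n psi).
have psiP k : psi (k + n%:Z) = psi k - kappa%:Z by rewrite /psi act_periodic cont_k.
pose y := verma_one H (int_char C n psi); pose v := @block_vector _ _ _ n_ge2 _ row _ 1 w y; exists v.
have yw : wt psi y by apply: int_char_wt.
have wv : wt cont v.
  apply: (block_vector_wt row_leL (lb_row L) row01 (w := w) _ row_block yw) => //.
    by move=> i j ij lt; rewrite wE ij ltxx eqxx lt.
  (* The inverse of [w] keeps the order of different blocks, so no pair is inverted across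
     blocks. *)
  move=> i j; rewrite eq_sym => ij /negP[]; rewrite /inversion wE (negbTE ij) orbF.
  have [lt|gt|e] := ltgtP j i; last by move: ij; rewrite e eqxx.
    by have := row_leL (ltW lt); rewrite le_eqVlt (negbTE ij) /= => ->.
  by have := row_leL (ltW gt); rewrite leNgt => /negbTE ->.
have Jv j : row_adj j -> T (sg n j) *: v = sc 1 v by exact: row_vector_adj.
split=> // [|h psi' hv wh].
  apply/eqP => v0; have : vcoef w v = 1.
    rewrite /v /block_vector (bsum_vcoef (lb_row L) row01) /y.
      by rewrite vcoef_one eqxx.
    move=> g _; rewrite scalerA -dahaWM vcoef_one pnatr_eq0 eqb0 negbK => /eqP e.
    by apply: (mulIg w); rewrite -e mul1g.
  by rewrite v0 vcoef0 => /eqP; rewrite eq_sym oner_eq0.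
have [t Jt tE] := cyclic_weight wv Jv hv wh; exists t => // p q r c.
(* With period [(1, 0)] the box below [p] is its translate, so any periodic [t] increases along
   columns. *)
have -> : q = p + n%:Z.
  by apply: (lab_inj L); rewrite ?(lb_row L) ?(lb_col L) ?r ?c; lia.
by rewrite act_periodic; lia.
Qed.

Section NoInfiniteColumn.
Hypothesis l_gt0 : 0 < l.

Let label_row (p q : int) : row p = row q -> q - p < n%:Z /\ col q - col p = q - p.
Proof.
move=> e; split.
  have [a [b [r [-> -> _]]]] := block_residues row_leL (lb_row L) row01 e.
  by have := ltn_ord a; have := ltn_ord b; lia.
have := @ct_blockE n n_ge2 _ row_leL row01 1 (mulr1 1) _ row_block _ _ e; rewrite /cont e; lia.
Qed.

Let lab_translate (p : int) (k : nat) :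
  row (p + k%:Z * n%:Z) = row p + k%:Z * m /\ col (p + k%:Z * n%:Z) = col p - k%:Z * l.
Proof.
elim: k => [|k [IHr IHc]]; first by rewrite !mul0r !addr0; lia.
rewrite (_ : p + k.+1%:Z * n%:Z = p + k%:Z * n%:Z + n%:Z); last lia.
by rewrite (lb_row L) (lb_col L) IHr IHc; lia.
Qed.

(* Otherwise the translate of q by n periods would lie in a row with more than n boxes. *)
Let column_bound (p q : int) : col q < col p -> row p - row q < n%:Z * m.
Proof.
move=> cqp; rewrite ltNge; apply/negP => le.
have [r c] := lab_translate q n; set q' := q + _ in r c.
have [||r2 c2] := @lb_skew _ _ _ _ _ _ L q' p (row q') (col p); try nia.
have [h1 h2] := label_row (esym r2); nia.
Qed.

(** By [column_bound] the weight [n * m] outweighs the row difference: the column decides first,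
    from right to left, and then the row. *)
Let key (p : int) : int := row p - n%:Z * m * col p.

Let keyE (p q : int) : (key p < key q) = (col q < col p) || (col p == col q) && (row p < row q).
Proof.
have m0 := lb_m L; have lt a b : col b < col a -> key a < key b.
  by move=> h; have := column_bound h; rewrite /key; nia.
have [h|h|e] := ltgtP (col q) (col p) => /=; first exact: lt.
  by have := lt _ _ h; lia.
by rewrite /key e; lia.
Qed.

Let key_inj : injective key.
Proof.
move=> p q e; have := keyE p q; have := keyE q p; rewrite e !ltxx => h1 h2.
by apply: (lab_inj L); lia.
Qed.

(* The column reading: the columns are read from right to left, each of them
   downwards, with the origin chosen at the end of a column. *)
Let column_reading : exists2 z : W,
  (forall p q, (act z p < act z q) = (key p < key q)) &
  col (act z^-1%g 0) != col (act z^-1%g 1).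
Proof.
have m0 := lb_m L.
have [||z zE] := @key_order n n_ge2 (m + n%:Z * m * l) key _ key_inj; first nia.
  by move=> j; rewrite /key (lb_row L) (lb_col L); lia.
have [[j hj]|/forallNP no] :=
    pselect (exists j, col (act z^-1%g j) != col (act z^-1%g (j + 1))).
  exists (piz n (- j) * z)%g => [p q|]; first by rewrite !actM !act_piz ltrD2r zE.
  have e i : act (piz n (- j) * z)^-1%g i = act z^-1%g (i + j).
    apply: (@act_injective _ _ (piz n (- j) * z)%g).
    by rewrite actKV actM actKV act_piz addrK.
  by rewrite !e add0r addrC.
(* If no column ended, all labels would stay in one column, although [n] steps must move [l > 0]
   columns. *)
have const (k : nat) : col (act z^-1%g k%:Z) = col (act z^-1%g 0).
  elim: k => [//|k IHk]; rewrite -IHk; have /negP := no k%:Z.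
  by rewrite negbK => /eqP ->; congr (col (act _ _)); lia.
by have := lb_col L (act z^-1%g 0); rewrite -act_periodic add0r const; lia.
Qed.

Lemma highest_vector_exists : exists tau (v : verma H tau), highest_vector v.
Proof.
have [z zE z01] := column_reading; have m0 := lb_m L.
pose bk (j : int) : int := - col (act z^-1%g j).
pose ct (j : int) : int := cont (act z^-1%g j).
have zlt i j : (i < j) = (key (act z^-1%g i) < key (act z^-1%g j)).
  by rewrite -zE !actKV.
have bk_le i j : i <= j -> bk i <= bk j.
  by rewrite /bk le_eqVlt zlt keyE => /predU1P[->|]; lia.
have bk_period i : bk (i + n%:Z) = bk i + l.
  by rewrite /bk act_periodic (lb_col L); lia.
have bk01 : bk 0 != bk 1 by rewrite /bk eqr_opp.
have next p q : row q = row p + 1 -> col q = col p -> act z q = act z p + 1.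
  move=> r c; have lt : act z p < act z q by rewrite zE keyE r c eqxx; lia.
  apply/eqP; rewrite eq_le; apply/andP; split; last lia.
  rewrite leNgt zlt actK keyE; apply/negP => h1.
  have : act z p < act z p + 1 by lia.
  rewrite zlt actK keyE; lia.
have ct_block i : bk (i + 1) = bk i -> ct (i + 1) = ct i + (-1).
  rewrite /bk => e; have {}e : col (act z^-1%g (i + 1)) = col (act z^-1%g i) by lia.
  have : i < i + 1 by lia.
  rewrite zlt keyE e ltxx eqxx /= => lt.
  have [||r c] := @lb_skew _ _ _ _ _ _ L (act z^-1%g i) (act z^-1%g (i + 1))
    (row (act z^-1%g i) + 1) (col (act z^-1%g i)); try lia.
  have := next _ _ r c; rewrite actKV => e2.
  have e3 : act z^-1%g (i + 1) = lab (row (act z^-1%g i) + 1) (col (act z^-1%g i)).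
    by rewrite -e2 actK.
  by rewrite /ct /cont e3 r c; lia.
have [w1 w1E] := block_reversal bk_le bk_period bk01.
pose psi (k : int) := ct (act w1 k); exists (int_char C n psi).
have psiP k : psi (k + n%:Z) = psi k - kappa%:Z.
  by rewrite /psi act_periodic /ct act_periodic cont_k.
pose y0 := verma_one H (int_char C n psi).
have yw0 : wt psi y0 by apply: int_char_wt.
pose y := @block_vector _ _ _ n_ge2 _ bk _ (-1) w1 y0.
have yw : wt ct y.
  apply: (block_vector_wt bk_le bk_period bk01 (w := w1) _ ct_block yw0) => //.
    by move=> i j ij lt; rewrite w1E ij ltxx eqxx lt.
  move=> i j; rewrite eq_sym => ij /negP[]; rewrite /inversion w1E (negbTE ij) orbF.
  have [lt|gt|e] := ltgtP j i; last by move: ij; rewrite e eqxx.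
    by have := bk_le _ _ (ltW lt); rewrite le_eqVlt (negbTE ij) /= => ->.
  by have := bk_le _ _ (ltW gt); rewrite leNgt => /negbTE ->.
have ysym i j : bk i = bk j -> i != j -> T (tg n i j) *: y = sc (-1)%:~R y.
  by move=> ij ne; rewrite (block_vector_sym bk_le bk_period bk01 (e := -1) _ w1 y0 ij ne).
pose v := @block_vector _ _ _ n_ge2 _ row _ 1 z^-1%g y; exists v.
have wv : wt cont v.
  apply: (block_vector_wt row_leL (lb_row L) row01 (w := z^-1%g) _ row_block yw) => //.
    move=> i j ij lt; rewrite invgK zE keyE; have := label_row ij; lia.
  move=> i j ij; rewrite /inversion invgK zE keyE => inv.
  (* When row reading and column reading disagree on [i] and [j], one of them lies above and to the
     left of the other, so by skewness the corner in the row of [j] and the column of [i] is a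
     box. *)
  have [x [rx cx ne]] : exists x, [/\ row x = row j, col x = col i & x != j].
    have hx : row (lab (row j) (col i)) = row j /\ col (lab (row j) (col i)) = col i.
      have [lt|gt|e] := ltgtP j i; last by move: ij; rewrite e eqxx.
      - have le := row_leL (ltW lt); apply: (@lb_skew _ _ _ _ _ _ L j i); lia.
      - have le := row_leL (ltW gt); apply: (@lb_skew _ _ _ _ _ _ L i j); lia.
    exists (lab (row j) (col i)); split; try by case: hx.
    apply/negP => /eqP e; move: hx inv; rewrite e => -[_ ce].
    rewrite ce ltxx eqxx /=; have [lt|gt|e'] := ltgtP j i.
    - by have := row_leL (ltW lt); move: ij; lia.
    - by have := row_leL (ltW gt); move: ij; lia.
    - by move: ij; rewrite e' eqxx.
  (* Here [l > 0] matters: distinct boxes of one column are never translates of each other, so their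
     transposition exists. *)
  exists x; have cix : ~~ cg n i x.
    apply/negP => /cgP[q xE]; have [q0|q0] := eqVneq q 0.
      by move: xE; rewrite q0 mul0r addr0 => e; move: ij; rewrite e rx eqxx.
    have : col i = col x - q * l.
      case: (ltP 0 q) => h.
        by have [_] := lab_translate x (absz q); rewrite gez0_abs ?ltW // -xE.
      have [_] := lab_translate i (absz q).
      have -> : i + (absz q)%:Z * n%:Z = x by rewrite xE; lia.
      lia.
    by rewrite cx; nia.
  split=> //; rewrite scalerA -dahaWM.
  have -> : (tg n i x * z^-1 = z^-1 * tg n (act z i) (act z x))%g.
    have c : ~~ cg n (act z i) (act z x).
      by rewrite injective_cg //; [exact: act_periodic | exact: act_injective].
    by rewrite (tg_conj z^-1%g c) !actK.
  rewrite dahaWM -scalerA ysym ?sc_comm -?intrN // /bk ?actK ?cx //.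
  by rewrite (inj_eq (@act_injective _ _ z)); apply: contra cix => /eqP ->; rewrite cg_refl.
have Jv j : row_adj j -> T (sg n j) *: v = sc 1 v by exact: row_vector_adj.
split=> // [|h psi' hv wh].
  (* As for Young symmetrizers, a row permutation contributing to this coefficient must, conjugated
     by [z], be inverse to a column permutation. It then preserves rows and columns and is
     trivial. *)
  apply/eqP => v0; have : vcoef (z^-1 * w1)%g v = 1.
    have supp h g : block_perm bk g -> vcoef h (T g *: (T w1 *: y0)) != 0 -> h = (g * w1)%g.
      by move=> _; rewrite scalerA -dahaWM vcoef_one pnatr_eq0 eqb0 negbK => /eqP.
    rewrite /v /block_vector (bsum_vcoef (lb_row L) row01).
      rewrite vcoefT invgK mulKVg /y /block_vector (bsum_vcoef bk_period bk01).
        by rewrite vcoef_one eqxx.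
      by move=> g bg /(supp _ _ bg) e; apply: (mulIg w1); rewrite -e mul1g.
    move=> g [bg _]; rewrite scalerA -dahaWM vcoefT /y /block_vector.
    move=> /(bsum_vcoef_neq0 bk_period bk01)[c bc /(supp _ _ bc) e].
    have {}e : (c = z * g^-1 * z^-1)%g.
      by apply: (mulIg w1); rewrite -e invMg invgK !mulgA.
    have [bc' _] := bc; apply: act_eq1 => j; apply: (lab_inj L); first exact: bg.
    have := bc' (act z (act g j)); rewrite /bk e !actM !actK.
    by lia.
  by rewrite v0 vcoef0 => /eqP; rewrite eq_sym oner_eq0.
have [k kE] : exists k : H, v = k *: y.
  exists (\sum_(s : 'S_n | bp row s) (bsign C 1 s)%:A * (T (@pemb n n_ge2 s) * T z^-1%g)).
  by rewrite scaler_suml; apply: eq_bigr => s _; rewrite -!scalerA.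
have hk : h *: v = (h * k) *: y by rewrite kE scalerA.
rewrite hk in hv wh.
(* A weight of [H v] is one of [H y]. As [y] is antisymmetric in each column, the element [g]
   increases down the columns in the column reading, and [z] translates this back to the row
   labels. *)
have [|g Jg gE] := cyclic_weight (J := fun j => bk (j + 1) = bk j) (eps := (-1)%:~R) yw _ hv wh.
  by move=> j jj; rewrite -tg_sg ysym //; lia.
exists (g * z)%g => [p q r c|i]; last by rewrite gE /ct invMg actM.
rewrite addr0 in c; have e := next _ _ r c.
by rewrite !actM e; apply: Jg; rewrite /bk -e !actK c.
Qed.

End NoInfiniteColumn.

End VermaEmbedding.

(** * The simple module of a diagram *)

Section SimpleModule.
Context (C : numFieldType) (n kappa : nat) {n_ge2 : atleast2 n}.
Let hn : (2 <= n)%N := n_ge2.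
Variables (H : daha C n kappa) (m : nat) (l : int) (D : skew_diagram n m l).
Hypothesis m_gt0 : (0 < m)%N.
Hypothesis mlk : m%:Z + l = kappa%:Z.
Local Notation T := (dahaW H).
Local Notation row := (dg_row D).
Local Notation col := (dg_col D).
Local Notation cont := (cont row col).

Let L : labelling n m%:Z l row col (dg_lab D).
Proof. exact: diagram_labelling. Qed.

Let box_start (a : int) : sk_mu D a <= sk_mu D a <= sk_lam D a.
Proof. by rewrite lexx sk_mu_le_lam. Qed.

Let box_end (a : int) : sk_mu D a <= sk_lam D a <= sk_lam D a.
Proof. by rewrite lexx sk_mu_le_lam. Qed.

Lemma dg_row01 : row 0 != row 1.
Proof.
have e1 : dg_lab D 1 (sk_mu D 1) = 1.
  rewrite /dg_lab (@row_readingE n m l D (1, sk_mu D 1)) /=; last lia.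
  by rewrite /T0_base /= big_geq //; lia.
have e0 : dg_lab D 0 (sk_lam D 0) = 0.
  by have := @dg_lab_next n m l D m_gt0 0; rewrite add0r e1; lia.
have [r0 _] := @dg_labP n m l D m_gt0 0 (sk_lam D 0) (box_end 0).
have [r1 _] := @dg_labP n m l D m_gt0 1 (sk_mu D 1) (box_start 1).
by rewrite -{1}e0 -{1}e1 r0 r1.
Qed.

Lemma is_LD_vector (M : lmodType H) : is_LD D M ->
  exists v : M, [/\ v != 0, wt cont v &
    forall j, row_adj row j -> T (sg n j) *: v = sc 1 v].
Proof.
move=> [[[u u0] _] [g gsurj]].
pose one := verma_one H (skew_char C D).
pose pi (y : verma H (skew_char C D)) : small_verma H D :=
  \pi_(mod_quot (@small_verma_rel C n kappa H m l D)) y.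
have gZ (h : H) : h *: g (pi one) = g (pi (h *: one)).
  by rewrite /pi pi_mod_quotZ linearZ.
exists (g (pi one)); split=> [|k|j jj].
(* The image of the generator generates all of [M], so it vanishes only if [M] does. *)
- apply: contra u0 => /eqP gp; have [x <-] := gsurj u.
  elim/quotW: x => y; elim/quotW: y => h.
  have -> : h = h *: (1 : H^o) by rewrite -[LHS]mulr1.
  by rewrite pi_mod_quotZ; apply/eqP; apply: etrans (esym (gZ h)) _; rewrite gp scaler0.
- have wone : wt (T0_content D) one.
    by apply: int_char_wt => i; rewrite -mlk; apply: (cont_period L).
  by rewrite gZ wone /sc [RHS]gZ.
have [i /cgP[q jE]] := residue (n := n) j; have ilt := ltn_ord i.
have ri : row (i.+1%:Z + 1) = row i.+1%:Z.
  have := cont_translate L q i.+1%:Z.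
  have rt (k : int) : row (k + q * n%:Z) = row k + q * m%:Z.
    exact: (bk_translate (lb_row L) dg_row01).
  by move: jj; rewrite /row_adj jE addrAC !rt => /addIr.
(* Label 1 opens a row, so [n] and [n + 1] lie in different rows and the affine reflection [s_0]
   never occurs. *)
have i_n : (1 <= i.+1 < n)%N.
  rewrite /= ltn_neqAle ilt andbT; apply/negP => /eqP iE; move: ri; rewrite iE.
  rewrite addrC (lb_row L) -[n%:Z]add0r (lb_row L) => /addIr e.
  by have := dg_row01; rewrite e eqxx.
have -> : sg n j = dW_s n i.+1.
  by rewrite jE sg_translate /sg modz_small ?absz_nat ?/dW_saff //; lia.
rewrite sc1l gZ; apply/eqP; rewrite -subr_eq0 -linearB.
rewrite (_ : _ - _ = 0) ?linear0 //; apply/eqP; rewrite subr_eq0 -pi_mod_quotP.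
apply: sub_gen_submod; exists i.+1; last by rewrite scalerBl scale1r.
split; first lia.
by rewrite -/(dg_row D _) -[RHS]/(dg_row D _) -ri; congr (dg_row D _); lia.
Qed.

Lemma no_infinite_column_embedding (M : lmodType H) : is_LD D M ->
  kappa = 1%N \/ 0 < l ->
  exists (tau : {lrmorphism {mpoly C[n]} -> C | *%R}) (f : {linear M -> verma H tau}),
    injective f.
Proof.
move=> DM kl; have [vM [vM0 wM JM]] := is_LD_vector DM.
have l0 : 0 <= l := dg_l_ge0 D m_gt0.
have [tau [v [v0 wv Jv cw]]] : exists tau (v : verma H tau), highest_vector row col v.
  case: kl => [k1|l_gt0]; last exact: (highest_vector_exists H L mlk dg_row01).
  (* [m + l = 1] with [m > 0] and [l >= 0] leaves [m = 1] and [l = 0]. *)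
  by apply: (highest_vector_one_row H L mlk dg_row01); lia.
exists tau; exact: (simple_embedding L mlk (proj1 DM) vM0 v0 wM wv JM Jv cw).
Qed.

Lemma infinite_column_no_embedding (M : lmodType H) : is_LD D M ->
  (2 <= kappa)%N -> l = 0 ->
  forall (tau : {lrmorphism {mpoly C[n]} -> C | *%R}) (f : {linear M -> verma H tau}),
    ~ injective f.
Proof.
move=> DM k2 le tau f finj; have [vM [vM0 wM JM]] := is_LD_vector DM.
have per (a k : int) : sk_mu D (a + k * m%:Z) = sk_mu D a /\
    sk_lam D (a + k * m%:Z) = sk_lam D a.
  have [-> ->] := mu_lam_period D m_gt0 a k.
  have -> : k * l = 0 by rewrite le mulr0.
  by rewrite !subr0.
(* For [l = 0] the bounds are periodic as well as monotone, hence constant: the diagram is a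
   vertical strip. *)
have const (a : int) : sk_mu D a = sk_mu D 0 /\ sk_lam D a = sk_lam D 0.
  have h1 := @mu_lam_anti _ _ _ D m_gt0 0 (a + `|a| * m%:Z) ltac:(nia).
  have h2 := @mu_lam_anti _ _ _ D m_gt0 (a + - `|a| * m%:Z) 0 ltac:(nia).
  by move: h1 h2; rewrite !(proj1 (per _ _)) !(proj2 (per _ _)); lia.
pose k : nat := absz (row_size D 0); have lk : sk_lam D 0 = sk_mu D 0 + k%:Z - 1.
  by have := sk_mu_le_lam D 0; rewrite /k /row_size; lia.
have k_gt0 : (0 < k)%N by have := sk_mu_le_lam D 0; lia.
have n_mk : n%:Z = m%:Z * k%:Z.
  rewrite -(sk_degree D) (eq_bigr (fun=> k%:Z)) => [|a _].
    by rewrite sumr_const_nat subn1 /=; lia.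
  by have [-> ->] := const a%:Z; lia.
pose f0 := dg_lab D 0 (sk_mu D 0).
have labE (a : int) : dg_lab D a (sk_mu D 0) = f0 + a * k%:Z.
  have step b : dg_lab D (b + 1) (sk_mu D 0) = dg_lab D b (sk_mu D 0) + k%:Z.
    have := dg_lab_next D m_gt0 b; rewrite (proj1 (const _)) (proj2 (const _)) => ->.
    have -> : sk_lam D 0 = sk_mu D 0 + (k%:Z - 1) by lia.
    by rewrite (dg_lab_shift D m_gt0); lia.
  have nat_case (d : nat) b : dg_lab D (b + d%:Z) (sk_mu D 0) = dg_lab D b (sk_mu D 0) + d%:Z * k%:Z.
    elim: d => [|d IHd]; first by rewrite mul0r !addr0.
    by rewrite (_ : b + d.+1%:Z = b + d%:Z + 1) ?step ?IHd; lia.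
  have [a0|a0] := leP 0 a.
    by have := nat_case (absz a) 0; rewrite gez0_abs // add0r.
  have := nat_case (absz a) a; rewrite (_ : a + (absz a)%:Z = 0); last lia.
  by rewrite -/f0; lia.
have row_col (a t : int) : 0 <= t < k%:Z ->
    row (f0 + a * k%:Z + t) = a /\ col (f0 + a * k%:Z + t) = sk_mu D 0 + t.
  move=> ht; rewrite -labE -(dg_lab_shift D m_gt0); apply: (dg_labP m_gt0) => //.
  by have [-> ->] := const a; lia.
by apply: (infinite_columns_no_embedding (m := m%:Z) _ k_gt0 n_mk _ row_col DM.1 vM0 wM JM finj); lia.
Qed.

End SimpleModule.

Local Open Scope complex_scope.

Theorem theorem1p1 (R : realType) (n kappa m : nat) (l : int)
    (hn : (2 <= n)%N) (hkappa : (1 <= kappa)%N) (hm : (1 <= m <= n)%N)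
    (hml : m%:Z + l = kappa%:Z)
    (H : daha R[i] n kappa) (D : skew_diagram n m l)
    (L : lmodType H) (hL : is_LD D L) :
  (exists (tau : {lrmorphism {mpoly R[i][n]} -> R[i] | *%R})
          (f : {linear L -> verma H tau}), injective f) <->
  (kappa = 1%N \/ (2 <= kappa)%N /\ ~ has_infinite_column D).
Proof.
have n_ge2 : atleast2 n := hn; have m_gt0 : (0 < m)%N by lia.
have l0 : 0 <= l := dg_l_ge0 D m_gt0.
split=> [[tau [f finj]]|k_l].
  have [k1|k_ne1] := eqVneq kappa 1%N; [by left | right].
  have k2 : (2 <= kappa)%N by lia.
  split=> // /(infinite_columnP D m_gt0) le.
  exact: (infinite_column_no_embedding m_gt0 hml hL k2 le finj).
apply: (no_infinite_column_embedding m_gt0 hml hL).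
case: k_l => [|[_ /(infinite_columnP D m_gt0) l_ne0]]; [by left | right].
by rewrite lt_neqAle l0 eq_sym andbT; apply/eqP.
Qed.
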